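(* Let $F$ be a holomorphic automorphism of $\mathbb{C}^k$ which has an attracting fixed point at $0$. Then there exists an $\epsilon>0$ such that for any sequence $f_1, f_2, \ldots$ of holomorphic automorphisms of $\mathbb{C}^k$ which satisfy $\|F(z)-f_n(z)\|<\epsilon$ for every $n\in\mathbb{N}$ and all $z$ in the unit ball, the basin of attraction of the sequence $f_1,f_2,\ldots$ is biholomorphic to $\mathbb{C}^k$.
   Context: $F$ has an attracting fixed point at $0$ means that $F(0)=0$ and all eigenvalues of $F'(0)$ are smaller than $1$ in absolute value. The unit ball is the Euclidean unit ball of $\mathbb{C}^k$ centered at the origin. Write $f(n)=f_n\circ\cdots\circ f_1$. Basin of attraction. The maps $f_n$ need not fix $0$. If $\epsilon$ is chosen small enough (depending on $F$), there is a small open neighborhood $\mathcal{N}$ of $0$, contained in the unit ball, such that $f_n(\mathcal{N})\subset\subset\mathcal{N}$ (i.e. $f_n(\mathcal{N})$ is relatively compact in $\mathcal{N}$) for every $n\in\mathbb{N}$ and every such sequence. The existence of such an $\mathcal{N}$ is part of what is meant by the theorem. The basin of attraction of the sequence is then defined as $\bigcup_{n} f(n)^{-1}(\mathcal{N})$. The paper's convention is that this set does not depend on the choice of such a small $\mathcal{N}$, and that if all $f_n$ fix the origin it equals the set of all $z\in\mathbb{C}^k$ with $f(n)(z)\to 0$ as $n\to\infty$.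
   Formalization: The basin is taken for one suitable N serving all sequences; its independence of N is stated only for smaller neighborhoods N' inside N with the union of all f_n(N') relatively compact in N', because without this uniformity the independence fails (e.g. F(z)=z/2, N' the disc of radius 2ε). *)

(* Defs.v *)
From HB Require Import structures.
From mathcomp Require Import all_boot all_order all_algebra.
From mathcomp Require Import all_classical all_reals all_analysis.
From mathcomp Require Import complex.
Set Implicit Arguments.
Unset Strict Implicit.
Unset Printing Implicit Defensive.
Import Order.TTheory GRing.Theory Num.Theory.
Import numFieldNormedType.Exports.
Local Open Scope classical_set_scope.
Local Open Scope ring_scope.

(* The field R[i], packed as a numClosedFieldType: this is what gives R[i] and
   the row vectors over it their topology and their complex normed module
   structure. *)
Definition Cplx (R : realType) : numClosedFieldType := (complex R).

Notation Ck R k := 'rV[Cplx R]_k.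

Section HolomorphicMaps.
Context {R : realType} {k : nat}.
Implicit Types (z : Ck R k) (f g F : Ck R k -> Ck R k) (U V A B N : set (Ck R k)).

(* The norm that the library puts on row vectors is the sup norm; it induces
   the same topology as the Euclidean norm, but not the same unit ball. *)
Definition enorm z : R := Num.sqrt (\sum_(i < k) Normc.normc (z 0 i) ^+ 2).

Definition unit_ball : set (Ck R k) := [set z | enorm z < 1].

(* The scalars being Cplx R, differentiability is complex differentiability. *)
Definition holomorphic_on U f : Prop :=
  open U /\ forall z, U z -> differentiable f z.

Definition biholomorphic U V : Prop :=
  exists f g : Ck R k -> Ck R k,
    [/\ holomorphic_on U f, holomorphic_on V g,
        set_fun U V f, set_fun V U g &
        {in U, cancel f g} /\ {in V, cancel g f}].

Definition holomorphic_automorphism f : Prop :=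
  exists g, [/\ holomorphic_on setT f, holomorphic_on setT g,
                cancel f g & cancel g f].

(* 'J F 0 acts on row vectors from the right: it is the transpose of the usual
   matrix of F'(0), and has the same eigenvalues. *)
Definition attracting_fixed_point0 F : Prop :=
  F 0 = 0 /\ forall a : Cplx R, eigenvalue ('J F 0) a -> `|a| < 1.

Definition relatively_compact_in A B : Prop :=
  precompact A /\ closure A `<=` B.

End HolomorphicMaps.

(* Sequences f_1, f_2, ... are indexed from 0, so that f n stands for f_(n+1)
   and comp_upto f n for f_n \o ... \o f_1. *)
Fixpoint comp_upto (T : Type) (f : nat -> T -> T) (n : nat) : T -> T :=
  if n is m.+1 then f m \o comp_upto f m else id.

Definition basin (T : Type) (f : nat -> T -> T) (N : set T) : set T :=
  \bigcup_n (comp_upto f n.+1 @^-1` N).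

(* Main.v *)
Require Import Defs.
From mathcomp Require Import all_boot all_order all_algebra.
From mathcomp Require Import all_classical all_reals all_analysis.
From mathcomp Require Import complex.
From mathcomp Require Import ring lra zify.
Set Implicit Arguments.
Unset Strict Implicit.
Unset Printing Implicit Defensive.
Import Order.TTheory GRing.Theory Num.Theory.
Import numFieldNormedType.Exports.
Local Open Scope classical_set_scope.
Local Open Scope ring_scope.

(** The theorem holds because, near the origin, the sequence can be conjugated by
    a sequence of holomorphic maps to polynomial automorphisms, for which the whole
    space is attracted to the origin.

    In linear coordinates in which F'(0) is triangular with very small entries
    below the diagonal, the f_n are close, on a fixed polydisc, to a diagonal
    contraction D ([adapted_coordinates]).  The orbit of the origin stays near the
    origin; expressing the maps relative to this orbit makes them fix the origin,
    without changing the basin ([perturbed_basin]).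

    Order the coordinates by the rate at which D contracts them.  A monomial in
    component i is kept if it involves only coordinates contracted strictly less
    than the i-th one, or is a single coordinate contracted as much.  For any other
    monomial, D contracts the monomial strictly more than the i-th coordinate
    ([nonresonance]).  Therefore the f_n are conjugated, up to terms of order d + 1,
    to polynomial maps g_n that contain only the monomials that are kept: the
    coefficients of the conjugacies and of the g_n at all times together are the
    fixed point of a contraction ([formal_conjugation]).  When d is so large that
    a ^ (d + 1) is small compared with the strongest contraction of D, where a < 1
    is a rate of contraction for the f_n, a second fixed point argument corrects
    these formal conjugacies to holomorphic maps Phi_n on the unit polydisc with
    Phi_(n+1) o f_n = g_n o Phi_n ([holomorphic_conjugation]).

    The g_n have a triangular structure.  They are hence automorphisms
    ([gmap_automorphism]), and every orbit of the sequence g_n tends to the origin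
    ([gmap_orbit]).  As Phi_n is close to the identity, it has a local inverse, and
    z |-> g(n)^-1 (Phi_n (f(n) z)), which does not depend on n once f(n) z is small,
    maps the basin of the f_n isomorphically to the basin of the g_n, which is the
    whole space ([normalized_basin]).

    The complex analysis needed is that of bounded holomorphic functions: Cauchy's
    estimates, their limits and their Taylor polynomials.  It is derived here from
    a discrete Cauchy formula in which averages over roots of unity play the role
    of the contour integral ([goursat], [cauchy_formula], [montel], [taylor]). *)

(** * The modulus on the complex field *)

Section Modulus.
Context {R : realType}.
Local Notation C := (Cplx R).
Implicit Types (x y z : C) (a b : R).

(** The norm of the complex field takes its values in that field.  All
    estimates use this real-valued modulus, so that they live in an ordered
    field. *)
Definition cn (z : C) : R := Normc.normc z.

Definition rc (a : R) : C := real_complex R a.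

Lemma normE z : `|z| = rc (cn z).
Proof. by []. Qed.

Lemma le_rc a b : (rc a <= rc b) = (a <= b).
Proof. exact: lecR. Qed.

Lemma lt_rc a b : (rc a < rc b) = (a < b).
Proof. exact: ltcR. Qed.

Lemma rcD a b : rc (a + b) = rc a + rc b. Proof. exact: rmorphD. Qed.
Lemma rcB a b : rc (a - b) = rc a - rc b. Proof. exact: rmorphB. Qed.
Lemma rcM a b : rc (a * b) = rc a * rc b. Proof. exact: rmorphM. Qed.
Lemma rc0 : rc 0 = 0. Proof. exact: rmorph0. Qed.
Lemma rc1 : rc 1 = 1. Proof. exact: rmorph1. Qed.
Lemma rc_nat n : rc n%:R = n%:R. Proof. exact: rmorph_nat. Qed.
Lemma rc_inj : injective rc. Proof. exact: complexI. Qed.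

Lemma cn_ge0 z : 0 <= cn z.
Proof. by rewrite -le_rc rc0 -normE. Qed.

Lemma cn0 : cn 0 = 0. Proof. exact: Normc.normc0. Qed.

Lemma cn1 : cn 1 = 1. Proof. exact: Normc.normc1. Qed.

Lemma cn_eq0 z : (cn z == 0) = (z == 0).
Proof. by rewrite -(inj_eq rc_inj) -normE rc0 normr_eq0. Qed.

Lemma cn_gt0 z : (0 < cn z) = (z != 0).
Proof. by rewrite lt_def cn_eq0 cn_ge0 andbT. Qed.

Lemma cnM x y : cn (x * y) = cn x * cn y.
Proof. exact: Normc.normcM. Qed.

Lemma cnV x : cn x^-1 = (cn x)^-1.
Proof. exact: Normc.normcV. Qed.

Lemma cn_div x y : cn (x / y) = cn x / cn y.
Proof. by rewrite cnM cnV. Qed.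

Lemma cnX x n : cn (x ^+ n) = cn x ^+ n.
Proof. by elim: n => [|n IH]; rewrite ?expr0 ?cn1// !exprS cnM IH. Qed.

Lemma cnD x y : cn (x + y) <= cn x + cn y.
Proof. by rewrite -le_rc rcD -!normE ler_normD. Qed.

Lemma cnN x : cn (- x) = cn x.
Proof. by apply: rc_inj; rewrite -!normE normrN. Qed.

Lemma cnB x y : cn (x - y) <= cn x + cn y.
Proof. by rewrite -(cnN y); exact: cnD. Qed.

Lemma cn_distC x y : cn (x - y) = cn (y - x).
Proof. by rewrite -cnN opprB. Qed.

Lemma cn_dist_add y x z : cn (x - z) <= cn (x - y) + cn (y - z).
Proof. by rewrite (_ : x - z = (x - y) + (y - z)) ?cnD//; ring. Qed.

Lemma cn_rc a : cn (rc a) = `|a|.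
Proof. by rewrite /cn /rc /= expr0n /= addr0 sqrtr_sqr. Qed.

Lemma cn_nat n : cn n%:R = n%:R.
Proof. by rewrite -rc_nat cn_rc ger0_norm ?ler0n. Qed.

Lemma cn_sum (I : Type) (s : seq I) (P : pred I) (F : I -> C) :
  cn (\sum_(i <- s | P i) F i) <= \sum_(i <- s | P i) cn (F i).
Proof.
elim/big_rec2: _ => [|i x y _ IH]; first by rewrite cn0.
by apply: le_trans (cnD _ _) _; rewrite lerD2l.
Qed.

Lemma cn_prod (I : Type) (s : seq I) (P : pred I) (F : I -> C) :
  cn (\prod_(i <- s | P i) F i) = \prod_(i <- s | P i) cn (F i).
Proof. by elim/big_rec2: _ => [|i x y _ <-]; rewrite ?cn1 ?cnM. Qed.

Lemma cn_Re z : `|complex.Re z| <= cn z.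
Proof.
case: z => x y; rewrite /cn /= -sqrtr_sqr ler_wsqrtr//.
by rewrite lerDl sqr_ge0.
Qed.

Lemma cn_Im z : `|complex.Im z| <= cn z.
Proof.
case: z => x y; rewrite /cn /= -sqrtr_sqr ler_wsqrtr//.
by rewrite lerDr sqr_ge0.
Qed.

Lemma cn_le_ReIm z : cn z <= `|complex.Re z| + `|complex.Im z|.
Proof.
case: z => x y; rewrite /cn /=.
rewrite -[leRHS]ger0_norm ?addr_ge0// -sqrtr_sqr ler_wsqrtr//.
rewrite sqrrD !real_normK ?num_real// addrAC lerDl mulrn_wge0 // mulr_ge0//.
Qed.

End Modulus.

(** * Limits of sequences of complex numbers *)

Section Limits.
Context {R : realType}.
Local Notation C := (Cplx R).

Definition clim (u : nat -> C) (l : C) : Prop :=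
  forall e : R, 0 < e -> exists n0, forall n, (n0 <= n)%N -> cn (u n - l) < e.

Lemma clim_cst (l : C) : clim (fun=> l) l.
Proof. by move=> e e0; exists 0%N => n _; rewrite subrr cn0. Qed.

Lemma climD u v l m : clim u l -> clim v m -> clim (fun n => u n + v n) (l + m).
Proof.
move=> hu hv e e0; have e20 : 0 < e / 2 by rewrite divr_gt0.
have [n1 h1] := hu _ e20; have [n2 h2] := hv _ e20.
exists (maxn n1 n2) => n; rewrite geq_max => /andP[/h1 a1 /h2 a2].
rewrite (_ : _ - _ = (u n - l) + (v n - m)); last by ring.
by apply: le_lt_trans (cnD _ _) _; lra.
Qed.

Lemma climZ (a : C) u l : clim u l -> clim (fun n => a * u n) (a * l).
Proof.
move=> hu e e0; have c0 := cn_ge0 a.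
have e1 : 0 < e / (cn a + 1) by rewrite divr_gt0//; lra.
have [n1 h1] := hu _ e1; exists n1 => n /h1; rewrite -mulrBr cnM => h.
apply: le_lt_trans (_ : (cn a + 1) * cn (u n - l) < _).
  by rewrite ler_wpM2r ?cn_ge0// lerDl.
by rewrite mulrC -ltr_pdivlMr//; lra.
Qed.

Lemma climB u v l m : clim u l -> clim v m -> clim (fun n => u n - v n) (l - m).
Proof.
move=> hu hv; have := climD hu (climZ (-1) hv).
by rewrite mulN1r (_ : (fun n => _) = (fun n => u n - v n))//; apply/funext => n; rewrite mulN1r.
Qed.

Lemma clim_le (u : nat -> C) l (M : R) :
  clim u l -> (exists n0, forall n, (n0 <= n)%N -> cn (u n) <= M) -> cn l <= M.
Proof.
move=> hu [n0 hM]; apply/ler_addgt0Pr => e e0.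
have [n1 h1] := hu _ e0.
have := h1 _ (leq_maxr n0 n1); have := hM _ (leq_maxl n0 n1).
set n := maxn _ _ => a1 a2.
rewrite (_ : l = u n - (u n - l)); last by ring.
by apply: le_trans (cnB _ _) _; lra.
Qed.

Lemma clim_uniq u l m : clim u l -> clim u m -> l = m.
Proof.
move=> hl hm; apply/eqP; rewrite -subr_eq0 -cn_eq0 eq_le cn_ge0 andbT.
have := climB hl hm; move/clim_le; apply.
by exists 0%N => n _; rewrite subrr cn0.
Qed.

Lemma eq_clim u v l : (forall n, u n = v n) -> clim u l -> clim v l.
Proof. by move=> /funext ->. Qed.

Lemma clim_squeeze (u : nat -> C) l (e : nat -> R) :
  (forall n, cn (u n - l) <= e n) ->
  (forall d : R, 0 < d -> exists n0, forall n, (n0 <= n)%N -> e n < d) ->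
  clim u l.
Proof.
move=> h he d /he[n0 hn0]; exists n0 => n /hn0; exact: le_lt_trans.
Qed.

Lemma expr_small (q : R) : 0 <= q -> q < 1 -> forall d : R, 0 < d ->
  exists n0, forall n, (n0 <= n)%N -> q ^+ n < d.
Proof.
move=> q0 q1 d d0.
have hq : `|q| < 1 by rewrite ger0_norm.
have /cvgrPdist_lt/(_ _ d0)[n0 _ h] := cvg_expr hq.
exists n0 => n /h /=; rewrite sub0r normrN ger0_norm ?exprn_ge0//.
Qed.

(** Completeness of the complex field, from that of the reals. *)
Lemma clim_cauchy (u : nat -> C) :
  (forall e : R, 0 < e -> exists n0, forall n m,
      (n0 <= n)%N -> (n0 <= m)%N -> cn (u n - u m) < e) ->
  exists l, clim u l.
Proof.
move=> hu.
have part (p : C -> R) (hp : forall x y, p (x - y) = p x - p y)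
    (hp1 : forall x, `|p x| <= cn x) :
    exists l : R, forall e, 0 < e -> exists n0, forall n,
      (n0 <= n)%N -> `|p (u n) - l| < e.
  have : cvg ((fun n => p (u n)) @ \oo).
    apply/cauchy_cvgP; apply/cauchy_ballP => e e0.
    have [n0 h] := hu _ e0.
    pose S := [set p (u n) | n in [set n | (n0 <= n)%N]].
    exists (S, S) => /=; first by split; exists n0 => // n hn; exists n.
    move=> [_ _] /= [[n hn <-] [m hm <-]]; rewrite /ball /= -hp.
    by apply: le_lt_trans (hp1 _) _; exact: h.
  move=> /cvg_ex[l /cvgrPdist_lt hl]; exists l => e /hl[n0 _ h].
  by exists n0 => n /h /=; rewrite distrC.
have [|a ha] := part (@complex.Re R) _ (@cn_Re R); first by case=> x1 x2 [].
have [|b hb] := part (@complex.Im R) _ (@cn_Im R); first by case=> x1 x2 [].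
exists (Complex a b) => e e0; have e20 : 0 < e / 2 by rewrite divr_gt0.
have [n1 h1] := ha _ e20; have [n2 h2] := hb _ e20.
exists (maxn n1 n2) => n; rewrite geq_max => /andP[/h1 a1 /h2 a2].
apply: le_lt_trans (cn_le_ReIm _) _.
case: (u n) a1 a2 => x y /= a1 a2; lra.
Qed.

End Limits.

(** * A discrete form of Goursat's lemma *)

Section Goursat.
Context {R : realType}.
Local Notation C := (Cplx R).
Implicit Types (phi h : C -> C) (z t : C) (p q : R * R).

Definition is_cder phi (t a : C) : Prop :=
  forall e : R, 0 < e -> exists2 d : R, 0 < d &
    forall u, cn u < d -> cn (phi (t + u) - phi t - u * a) <= e * cn u.

Context (G : R * R -> C).

Definition trap h p q : C := (h (G p) + h (G q)) / 2 * (G q - G p).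

Definition mid p q : R * R := ((p.1 + q.1) / 2, (p.2 + q.2) / 2).

(** The trapezoidal sum over the image of the segment from p to q, cut into
    2 ^ n equal pieces.  Defining it by bisection makes its additivity hold by
    computation. *)
Fixpoint seg h n p q : C :=
  if n is m.+1 then seg h m p (mid p q) + seg h m (mid p q) q else trap h p q.

Definition bdy h n (x y l m : R) : C :=
  seg h n (x, y) (x + l, y) + seg h n (x + l, y) (x + l, y + m)
  - seg h n (x, y + m) (x + l, y + m) - seg h n (x, y) (x, y + m).

Lemma bdyS h n x y l m :
  bdy h n.+1 x y l m =
    bdy h n x y (l / 2) (m / 2) + bdy h n (x + l / 2) y (l / 2) (m / 2)
    + bdy h n x (y + m / 2) (l / 2) (m / 2)
    + bdy h n (x + l / 2) (y + m / 2) (l / 2) (m / 2).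
Proof.
rewrite /bdy /= /mid /=.
have e1 (a b : R) : a + b / 2 + b / 2 = a + b by field.
have e2 (a b : R) : (a + (a + b)) / 2 = a + b / 2 by field.
have e3 (a : R) : (a + a) / 2 = a by field.
rewrite !e1 !e2 !e3; ring.
Qed.

Definition inbox (x y l m : R) p :=
  [/\ x <= p.1, p.1 <= x + l, y <= p.2 & p.2 <= y + m].

Lemma inbox_mid x y l m p q :
  inbox x y l m p -> inbox x y l m q -> inbox x y l m (mid p q).
Proof. by case=> a1 a2 a3 a4 [b1 b2 b3 b4]; split => /=; lra. Qed.

Definition l1d p q : R := `|p.1 - q.1| + `|p.2 - q.2|.

Lemma l1d_midl p q : l1d p (mid p q) = l1d p q / 2.
Proof.
rewrite /l1d /=.
have e (a b : R) : a - (a + b) / 2 = (a - b) / 2 by field.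
by rewrite !e !normrM !(@ger0_norm _ 2^-1)//; field.
Qed.

Lemma l1d_midr p q : l1d (mid p q) q = l1d p q / 2.
Proof.
rewrite /l1d /=.
have e (a b : R) : (a + b) / 2 - b = (a - b) / 2 by field.
by rewrite !e !normrM !(@ger0_norm _ 2^-1)//; field.
Qed.

Lemma seg_le h (M L : R) x y l m : 0 <= M ->
  (forall p, inbox x y l m p -> cn (h (G p)) <= M) ->
  (forall p q, inbox x y l m p -> inbox x y l m q ->
     cn (G p - G q) <= L * l1d p q) ->
  forall n p q, inbox x y l m p -> inbox x y l m q ->
    cn (seg h n p q) <= M * L * l1d p q.
Proof.
move=> M0 hM hL; elim=> [|n IH] p q hp hq /=; last first.
  have hm := inbox_mid hp hq.
  apply: le_trans (cnD _ _) _; apply: le_trans (lerD (IH _ _ hp hm) (IH _ _ hm hq)) _.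
  by rewrite l1d_midl l1d_midr; lra.
rewrite /trap cnM -mulrA; apply: ler_pM; rewrite ?cn_ge0//; last first.
  by rewrite cn_distC; exact: hL.
rewrite cn_div cn_nat; have := cnD (h (G p)) (h (G q)).
by have := hM _ hp; have := hM _ hq; lra.
Qed.

(** The trapezoidal rule is exact for polynomials of degree at most one. *)
Lemma seg_affine (a b : C) n p q :
  seg (fun z => a + b * z) n p q =
    (a * G q + b * G q ^+ 2 / 2) - (a * G p + b * G p ^+ 2 / 2).
Proof.
elim: n p q => [|n IH] p q /=; first by rewrite /trap; field.
by rewrite !IH; ring.
Qed.

Lemma bdy_affine (a b : C) n x y l m : bdy (fun z => a + b * z) n x y l m = 0.
Proof. by rewrite /bdy !seg_affine; ring. Qed.

Lemma segD h1 h2 n p q :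
  seg (fun z => h1 z + h2 z) n p q = seg h1 n p q + seg h2 n p q.
Proof.
elim: n p q => [|n IH] p q /=; first by rewrite /trap; field.
by rewrite !IH; ring.
Qed.

Lemma bdyD h1 h2 n x y l m :
  bdy (fun z => h1 z + h2 z) n x y l m = bdy h1 n x y l m + bdy h2 n x y l m.
Proof. by rewrite /bdy !segD; ring. Qed.

Lemma bdy_le h (M L : R) n x y l m : 0 <= M -> 0 <= l -> 0 <= m ->
  (forall p, inbox x y l m p -> cn (h (G p)) <= M) ->
  (forall p q, inbox x y l m p -> inbox x y l m q ->
     cn (G p - G q) <= L * l1d p q) ->
  cn (bdy h n x y l m) <= 2 * M * L * (l + m).
Proof.
move=> M0 l0 m0 hM hL; have B := seg_le M0 hM hL.
have i1 : inbox x y l m (x, y) by split => /=; lra.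
have i2 : inbox x y l m (x + l, y) by split => /=; lra.
have i3 : inbox x y l m (x + l, y + m) by split => /=; lra.
have i4 : inbox x y l m (x, y + m) by split => /=; lra.
rewrite /bdy; apply: le_trans (cnB _ _) _.
apply: le_trans (lerD (cnB _ _) (lexx _)) _.
apply: le_trans (lerD (lerD (cnD _ _) (lexx _)) (lexx _)) _.
have := B n _ _ i1 i2; have := B n _ _ i2 i3; have := B n _ _ i4 i3.
have := B n _ _ i1 i4.
rewrite /l1d /= !subrr !normr0.
have e (a b : R) : 0 <= b -> `|a - (a + b)| = b.
  by move=> b0; rewrite distrC addrAC subrr add0r ger0_norm.
by rewrite !e//; lra.
Qed.

(** Where the function is differentiable, subtracting its affine part leaves
    boundary sums that are small compared with the area. *)
Lemma bdy_local h (L : R) (x y l m : R) P a : 0 <= L ->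
  (forall p q, inbox x y l m p -> inbox x y l m q ->
     cn (G p - G q) <= L * l1d p q) ->
  inbox x y l m P -> is_cder h (G P) a ->
  forall e, 0 < e -> exists2 d : R, 0 < d &
    forall n x' y' l' m', 0 <= l' -> 0 <= m' -> l' + m' < d ->
      inbox x' y' l' m' P ->
      (forall p, inbox x' y' l' m' p -> inbox x y l m p) ->
      cn (bdy h n x' y' l' m') <= e * (l' + m') ^+ 2.
Proof.
move=> L0 hL hP hd e e0.
pose e' := e / (2 * (L + 1) ^+ 2).
have L1 : 0 < L + 1 by lra.
have e'0 : 0 < e' by rewrite divr_gt0// mulr_gt0// exprn_gt0.
have [d d0 hd'] := hd _ e'0.
exists (d / (L + 1)); first by rewrite divr_gt0.
move=> n x' y' l' m' l0 m0 lm hP' sub.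
rewrite ltr_pdivlMr// in lm.
set z0 := G P.
have -> : h = fun z => (h z0 - a * z0 + a * z) + (h z - h z0 - (z - z0) * a).
  by apply/funext => z; ring.
rewrite bdyD bdy_affine add0r.
have dist p : inbox x' y' l' m' p -> cn (G p - z0) <= L * (l' + m').
  move=> hp; apply: le_trans (hL _ _ (sub _ hp) hP) _.
  rewrite ler_wpM2l// /l1d lerD// ler_norml.
    by case: hp => ? ? _ _; case: hP' => ? ? _ _; lra.
  by case: hp => _ _ ? ?; case: hP' => _ _ ? ?; lra.
have lm0 : 0 <= l' + m' by lra.
apply: le_trans (@bdy_le _ (e' * (L * (l' + m'))) L _ _ _ _ _ _ _ _ _ _) _ => //.
- by rewrite mulr_ge0 ?(ltW e'0)// mulr_ge0.
- move=> p hp; have hz := dist _ hp.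
  have hz' : cn (G p - z0) < d by apply: le_lt_trans hz _; nra.
  have := hd' _ hz'; rewrite (_ : z0 + (G p - z0) = G p); last by ring.
  move=> h1; apply: le_trans h1 _; by rewrite ler_wpM2l// ltW.
- by move=> p q hp hq; exact: hL (sub _ hp) (sub _ hq).
have -> : 2 * (e' * (L * (l' + m'))) * L * (l' + m')
        = e * (l' + m') ^+ 2 * (L ^+ 2 / (L + 1) ^+ 2).
  by rewrite /e'; field; rewrite gt_eqF.
rewrite -[leRHS]mulr1 ler_wpM2l ?mulr_ge0 ?sqr_ge0 ?(ltW e0)//.
by rewrite ler_pdivrMr ?exprn_gt0// mul1r; nra.
Qed.

(** The pigeonhole step of the bisection: a box where the boundary sums do not
    become small compared with the area contains a quarter with this defect. *)
Lemma bdy_quarter h (e s : R) x y l m :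
  (forall N, exists2 n, (N <= n)%N & e * s ^+ 2 < cn (bdy h n x y l m)) ->
  exists a b : bool,
    forall N, exists2 n, (N <= n)%N &
      e * (s / 2) ^+ 2 <
        cn (bdy h n (x + a%:R * (l / 2)) (y + b%:R * (m / 2)) (l / 2) (m / 2)).
Proof.
move=> bad; apply: contrapT => nex.
have good (a b : bool) : exists N, forall n, (N <= n)%N ->
    cn (bdy h n (x + a%:R * (l / 2)) (y + b%:R * (m / 2)) (l / 2) (m / 2))
      <= e * (s / 2) ^+ 2.
  apply: contrapT => h1; apply: nex; exists a, b => N.
  apply: contrapT => h2; apply: h1; exists N => n hn.
  by rewrite leNgt; apply/negP => h3; apply: h2; exists n.
have [N1 h1] := good false false; have [N2 h2] := good true false.
have [N3 h3] := good false true; have [N4 h4] := good true true.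
pose N := (N1 + N2 + N3 + N4)%N.
have [[|n] // hn] := bad N.+1.
rewrite bdyS.
rewrite ltnS /N in hn.
move: (h1 n ltac:(lia)) (h2 n ltac:(lia)) (h3 n ltac:(lia)) (h4 n ltac:(lia)).
rewrite !mul0r !mul1r !addr0 => a1 a2 a3 a4; apply/negP; rewrite -leNgt.
apply: le_trans (cnD _ _) _; apply: le_trans (lerD (cnD _ _) (lexx _)) _.
apply: le_trans (lerD (lerD (cnD _ _) (lexx _)) (lexx _)) _.
lra.
Qed.

(** Goursat's lemma: were the boundary sums not to tend to zero, repeated
    quartering would lead to a point at which the map is not differentiable. *)
Lemma goursat h (L x y l m : R) : 0 <= L -> 0 < l -> 0 < m ->
  (forall p q, inbox x y l m p -> inbox x y l m q ->
     cn (G p - G q) <= L * l1d p q) ->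
  (forall p, inbox x y l m p -> exists a, is_cder h (G p) a) ->
  clim (fun n => bdy h n x y l m) 0.
Proof.
move=> L0 l0 m0 hL hd; apply: contrapT => ncl.
have [e e0 bad0] : exists2 e : R, 0 < e &
    forall N, exists2 n, (N <= n)%N & e * (l + m) ^+ 2 < cn (bdy h n x y l m).
  apply: contrapT => h1; apply: ncl => e e0; apply: contrapT => h2; apply: h1.
  exists (e / (2 * (l + m) ^+ 2)).
    by rewrite divr_gt0// mulr_gt0// exprn_gt0// addr_gt0.
  move=> N; apply: contrapT => h3; apply: h2; exists N => n hn.
  rewrite subr0 ltNge; apply/negP => h4; apply: h3; exists n => //.
  apply: lt_le_trans h4; rewrite (_ : _ * _ = e / 2); first lra.
  by field; rewrite gt_eqF// addr_gt0.
pose sc (j : nat) (r : R) := r / 2 ^+ j.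
have scS j r : sc j r / 2 = sc j.+1 r by rewrite /sc exprS; field; rewrite expf_neq0.
pose bad (p : R * R) j := forall N, exists2 n, (N <= n)%N &
  e * (sc j (l + m)) ^+ 2 < cn (bdy h n p.1 p.2 (sc j l) (sc j m)).
pose next (p : R * R) j (ab : bool * bool) : R * R :=
  (p.1 + ab.1%:R * sc j.+1 l, p.2 + ab.2%:R * sc j.+1 m).
have [ch hch] : exists ch : (R * R) * nat -> bool * bool, forall p j,
    bad p j -> bad (next p j (ch (p, j))) j.+1.
  have : forall pj : (R * R) * nat, exists ab, bad pj.1 pj.2 ->
      bad (next pj.1 pj.2 ab) pj.2.+1.
    move=> [p j] /=; have [hb|nb] := pselect (bad p j); last by exists (true, true).
    have [a [b hab]] := bdy_quarter hb.
    by exists (a, b) => _ N; have [n n1 n2] := hab N; exists n => //=; rewrite -!scS.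
  by move=> /choice[ch hch]; exists ch => p j; exact: (hch (p, j)).
pose fix pt j : R * R := if j is i.+1 then next (pt i) i (ch (pt i, i)) else (x, y).
have ptbad j : bad (pt j) j.
  elim: j => [|j IH]; last exact: hch.
  by rewrite /bad /sc /= expr0 !divr1.
have sc0 j r : 0 <= r -> 0 <= sc j r by move=> r0; rewrite divr_ge0// exprn_ge0.
have stp (b : bool) j r : 0 <= r ->
    0 <= b%:R * sc j.+1 r /\ b%:R * sc j.+1 r + sc j.+1 r <= sc j r.
  move=> r0; have := sc0 j.+1 _ r0; have := scS j r.
  by case: b; rewrite /= ?mul0r ?mul1r; lra.
have l0' := ltW l0; have m0' := ltW m0.
have inc j i : [/\ (pt j).1 <= (pt (j + i)%N).1,
    (pt (j + i)%N).1 + sc (j + i)%N l <= (pt j).1 + sc j l,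
    (pt j).2 <= (pt (j + i)%N).2 &
    (pt (j + i)%N).2 + sc (j + i)%N m <= (pt j).2 + sc j m].
  elim: i => [|i [a1 a2 a3 a4]]; first by rewrite addn0.
  rewrite addnS /=; set k := (j + i)%N in a1 a2 a3 a4 *.
  have [b1 b2] := stp (ch (pt k, k)).1 k _ l0'.
  have [b3 b4] := stp (ch (pt k, k)).2 k _ m0'.
  by split; lra.
have cmp (c : (R * R) -> R) (r : R) (c0 : 0 <= r)
    (hc : forall j i, c (pt j) <= c (pt (j + i)%N) /\ c (pt (j + i)%N) + sc (j + i)%N r <= c (pt j) + sc j r) :
    exists X, forall j, c (pt j) <= X <= c (pt j) + sc j r.
  pose S := [set c (pt j) | j in [set: nat]].
  have ubS j : ubound S (c (pt j) + sc j r).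
    move=> _ [i _ <-]; have [ij|ji] := leqP i j.
      have [a1 a2] := hc i (j - i)%N; rewrite subnKC// in a1 a2.
      by apply: le_trans a1 _; rewrite lerDl sc0.
    have [a1 a2] := hc j (i - j)%N; rewrite subnKC ?(ltnW ji)// in a1 a2.
    by apply: le_trans a2; rewrite lerDl sc0.
  have nS : S !=set0 by exists (c (pt 0)); exists 0%N.
  have hS : has_sup S by split => //; exists (c (pt 0) + sc 0 r).
  exists (sup S) => j; apply/andP; split; last exact: ge_sup.
  by apply: ub_le_sup => //; [exact: hS.2|exists j].
have [X hX] := cmp (fun p => p.1) l l0' (fun j i => let: And4 a b _ _ := inc j i in conj a b).
have [Y hY] := cmp (fun p => p.2) m m0' (fun j i => let: And4 _ _ a b := inc j i in conj a b).
have hin j : inbox (pt j).1 (pt j).2 (sc j l) (sc j m) (X, Y).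
  by have /andP[? ?] := hX j; have /andP[? ?] := hY j; split.
have hsub j p : inbox (pt j).1 (pt j).2 (sc j l) (sc j m) p -> inbox x y l m p.
  have := inc 0%N j; rewrite add0n /= /sc expr0 !divr1 -/(sc _ _) => -[a1 a2 a3 a4].
  by rewrite -!/(sc _ _) in a2 a4 * => -[b1 b2 b3 b4]; split; lra.
have [a ha] := hd _ (hsub 0%N _ (hin 0%N)).
have [d d0 hloc] := bdy_local L0 hL (hsub 0%N _ (hin 0%N)) ha e0.
have [j0 hj0] := @expr_small R 2^-1 ltac:(lra) ltac:(lra) (d / (l + m)) ltac:(by rewrite divr_gt0// addr_gt0).
have := hj0 _ (leqnn _); rewrite ltr_pdivlMr ?addr_gt0// => hj.
have [n _] := ptbad j0 0%N.
apply/negP; rewrite -leNgt.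
have scD : sc j0 l + sc j0 m = sc j0 (l + m) by rewrite /sc mulrDl.
rewrite -scD; apply: hloc (hin j0) (hsub j0); rewrite ?sc0//.
by rewrite scD /sc mulrC -exprVn.
Qed.

End Goursat.

(** * Cauchy's formula as a limit of averages over roots of unity *)

Section Cauchy.
Context {R : realType}.
Local Notation C := (Cplx R).
Implicit Types (phi : C -> C) (z t w : C).

Definition cis (x : R) : C := Complex (cos x) (sin x).

Lemma cisD x y : cis (x + y) = cis x * cis y.
Proof. by rewrite /cis cosD sinD; congr Complex; ring. Qed.

Lemma cis0 : cis 0 = 1.
Proof. by rewrite /cis cos0 sin0. Qed.

Lemma cn_cis x : cn (cis x) = 1.
Proof. by rewrite /cn /= cos2Dsin2 sqrtr1. Qed.

Lemma cis_neq0 x : cis x != 0.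
Proof. by rewrite -cn_eq0 cn_cis oner_eq0. Qed.

Lemma cisN x : cis (- x) = (cis x)^-1.
Proof.
apply: (mulfI (cis_neq0 x)); rewrite -cisD subrr cis0 divff//; exact: cis_neq0.
Qed.

Lemma cisMn x n : cis (x * n%:R) = cis x ^+ n.
Proof.
elim: n => [|n IH]; first by rewrite mulr0 cis0 expr0.
by rewrite exprS -IH -cisD; congr cis; rewrite mulrSr; ring.
Qed.

Lemma cis2pi : cis (2 * pi) = 1.
Proof. by rewrite /cis mulr_natl cos2pi sin2pi. Qed.

Lemma cis_lip x y : cn (cis x - cis y) <= 2 * `|x - y|.
Proof.
wlog xy : x y / x <= y.
  move=> H; have [|/ltW] := leP x y; first exact: H.
  by rewrite cn_distC distrC; exact: H.
apply: le_trans (cn_le_ReIm _) _; rewrite /cis /=.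
rewrite (_ : 2 * `|x - y| = `|x - y| + `|x - y|); last by ring.
have lip (f f' : R -> R) : (forall y0 : R, is_derive y0 1 f (f' y0)) ->
    (forall y0, `|f' y0| <= 1) -> `|f x - f y| <= `|x - y|.
  move=> fd f1; have [|z _ h] := @MVT_segment R f f' x y xy (fun y0 _ => fd y0).
    apply: derivable_within_continuous => y0 _; exact: (@ex_derive _ _ _ _ _ _ _ (fd y0)).
  by rewrite distrC h normrM distrC ler_piMl// distrC.
apply: lerD.
- apply: (lip _ (fun y0 => - sin y0)) => y0.
  by rewrite normrN ler_norml sin_geN1 sin_le1.
- apply: (lip _ cos) => y0.
  by rewrite ler_norml cos_geN1 cos_le1.
Qed.

Lemma cis_neq1 (t : R) : 0 < t < 1 -> cis (2 * pi * t) != 1.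
Proof.
move=> /andP[t0 t1]; apply/eqP => -[h _].
have s0 : 0 < sin (pi * t).
  by apply: sin_gt0_pi; rewrite mulr_gt0 ?pi_gt0//= gtr_pMr ?pi_gt0.
have := cos2Dsin2 (pi * t); have := cosD (pi * t) (pi * t).
rewrite (_ : pi * t + pi * t = 2 * pi * t); last by ring.
by rewrite h; nra.
Qed.

(** The nodes on the circle are the roots of unity of order 2 ^ n: a power of two,
    to match the bisection in the trapezoidal sums. *)
Definition uroot n (j : nat) : C := cis (2 * pi * (j%:R / 2 ^+ n)).

Definition avg n (f : C -> C) : C := (2 ^+ n)^-1 * \sum_(j < 2 ^ n) f (uroot n j).

Lemma two_neq0 n : (2 ^+ n : R) != 0. Proof. by rewrite expf_neq0. Qed.
Lemma twoC_neq0 n : (2 ^+ n : C) != 0. Proof. by rewrite expf_neq0// pnatr_eq0. Qed.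

Lemma rootE n j : uroot n j = uroot n 1 ^+ j.
Proof. by rewrite /uroot -cisMn; congr cis; ring. Qed.

Lemma root_n n j : uroot n j ^+ (2 ^ n) = 1.
Proof.
rewrite /uroot -cisMn natrX (_ : _ * _ = 2 * pi * j%:R); last first.
  by field; rewrite two_neq0.
by rewrite cisMn cis2pi expr1n.
Qed.

Lemma cn_root n j : cn (uroot n j) = 1. Proof. exact: cn_cis. Qed.

Lemma root_neq0 n j : uroot n j != 0. Proof. exact: cis_neq0. Qed.

Lemma avgD n f g : avg n (fun z => f z + g z) = avg n f + avg n g.
Proof. by rewrite /avg big_split mulrDr. Qed.

Lemma avgZ n a f : avg n (fun z => a * f z) = a * avg n f.
Proof. by rewrite /avg -mulr_sumr mulrCA. Qed.

Lemma avg_cst n a : avg n (fun=> a) = a.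
Proof.
rewrite /avg sumr_const card_ord -(mulr_natl a) natrX mulrA mulVf ?mul1r//.
Qed.

Lemma avg_le n f (M : R) : (forall j, cn (f (uroot n j)) <= M) -> cn (avg n f) <= M.
Proof.
move=> h; rewrite /avg cnM cnV cnX cn_nat.
rewrite mulrC ler_pdivrMr ?exprn_gt0//.
apply: le_trans (cn_sum _ _ _) _.
apply: le_trans (ler_sum _ (fun (j : 'I_(2 ^ n)) _ => h j)) _.
by rewrite sumr_const card_ord -(mulr_natr M) natrX.
Qed.

Lemma eq_avg n f g : (forall j, f (uroot n j) = g (uroot n j)) -> avg n f = avg n g.
Proof. by move=> h; rewrite /avg; congr (_ * _); apply: eq_bigr => j _. Qed.

(** Orthogonality of the characters of the group of roots of unity. *)
Lemma avg_root n (m m' : nat) : (m < 2 ^ n)%N -> (m' < 2 ^ n)%N ->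
  avg n (fun z => z ^+ m / z ^+ m') = (m == m')%:R.
Proof.
move=> hm hm'; have [<-|mm'] := eqVneq m m'.
  rewrite -[RHS](avg_cst n); apply: eq_avg => j.
  by rewrite divff ?expf_neq0 ?root_neq0.
rewrite /avg; apply/eqP; rewrite mulf_eq0; apply/orP; right.
pose q := uroot n 1 ^+ m / uroot n 1 ^+ m'.
rewrite (eq_bigr (fun j : 'I_(2 ^ n) => q ^+ j)); last first.
  move=> j _; rewrite rootE /q exprMn exprVn -!exprM.
  by rewrite (mulnC m) (mulnC m').
have q1 : q != 1.
  apply: contra mm' => /eqP q1.
  have e : uroot n 1 ^+ m = uroot n 1 ^+ m'.
    by rewrite -[RHS]mul1r -q1 /q divfK// expf_neq0// root_neq0.
  move: e; wlog lt : m m' hm hm' {q q1} / (m <= m')%N.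
    by move=> H e; have [|/ltnW] := leqP m m' => h; [exact: H e|rewrite eq_sym; exact: H].
  rewrite -(subnK lt) exprD => e.
  have {e} : uroot n 1 ^+ (m' - m) = 1.
    by apply: (mulIf (expf_neq0 m (root_neq0 n 1))); rewrite mul1r -e.
  rewrite subnK// => e; apply/eqP/eqP; move: lt; rewrite leq_eqVlt => /orP[//|lt].
  have := @cis_neq1 ((m' - m)%:R / 2 ^+ n).
  rewrite -/(uroot n (m' - m)) rootE e eqxx; move=> /(_ _)/negP[]//.
  rewrite divr_gt0 ?ltr0n ?subn_gt0 ?exprn_gt0//= ltr_pdivrMr ?exprn_gt0// mul1r.
  by rewrite -natrX ltr_nat (leq_ltn_trans (leq_subr _ _)).
have := subrX1 q (2 ^ n).
rewrite {1}/q exprMn exprVn -!exprM -!(mulnC (2 ^ n)%N) !exprM root_n !expr1n.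
rewrite invr1 mulr1 subrr => /esym/eqP; rewrite mulf_eq0 subr_eq0 (negbTE q1) /=.
by move=> /eqP h; rewrite h.
Qed.

(** In the geometric series of x / z, only the degrees that are multiples of
    2 ^ n have an average different from zero. *)
Lemma avg_kernel n (x : C) : cn x < 1 ->
  avg n (fun z => (1 - x / z)^-1) = (1 - x ^+ (2 ^ n))^-1.
Proof.
move=> x1.
have nz (y : C) : cn y < 1 -> 1 - y != 0.
  by move=> h; rewrite subr_eq0; apply: contraTneq h => <-; rewrite cn1 ltxx.
have xN : 1 - x ^+ (2 ^ n) != 0.
  by apply: nz; rewrite cnX exprn_ilt1 ?cn_ge0// -lt0n expn_gt0.
apply: (mulfI xN); rewrite divff// -avgZ.
have -> : avg n (fun z => (1 - x ^+ (2 ^ n)) * (1 - x / z)^-1) =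
    avg n (fun z => \sum_(m < 2 ^ n) x ^+ m * (z ^+ 0 / z ^+ m)).
  apply: eq_avg => j.
  have xz : 1 - x / uroot n j != 0 by apply: nz; rewrite cn_div cn_root divr1.
  apply: (mulIf xz); rewrite divfK//.
  have -> : x ^+ (2 ^ n) = (x / uroot n j) ^+ (2 ^ n).
    by rewrite exprMn exprVn root_n invr1 mulr1.
  have := subrX1 (x / uroot n j) (2 ^ n).
  move=> h; rewrite -(opprB _ 1) h -mulNr opprB mulrC; congr (_ * _).
  by apply: eq_bigr => m _; rewrite expr0 mul1r exprMn exprVn.
rewrite (_ : avg n _ = \sum_(m < 2 ^ n) x ^+ m * avg n (fun z => z ^+ 0 / z ^+ m)).
  have N0 : (0 < 2 ^ n)%N by rewrite expn_gt0.
  rewrite (bigD1 (Ordinal N0)) //= avg_root// eqxx expr0 mulr1 big1 ?addr0// => m m0.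
  rewrite avg_root// (_ : (0%N == m) = false) ?mulr0//.
  by apply: contraNF m0 => /eqP h; apply/eqP/val_inj.
rewrite /avg; under [RHS]eq_bigr do rewrite mulrCA mulr_sumr.
by rewrite -mulr_sumr exchange_big.
Qed.

Lemma sin_root_ge n : 4 <= 2 ^+ n.+2 * sin (2 * pi / 2 ^+ n.+2) :> R.
Proof.
elim: n => [|n IH].
  rewrite (_ : 2 * pi / 2 ^+ 2 = pi / 2 :> R); last by field.
  by rewrite sin_pihalf mulr1 expr2; lra.
apply: le_trans IH _; set x := 2 * pi / 2 ^+ n.+3.
have -> : 2 * pi / 2 ^+ n.+2 = x + x :> R by rewrite /x [2 ^+ n.+3]exprS; field; rewrite two_neq0.
rewrite sinD [2 ^+ n.+3]exprS.
have p0 : 0 < 2 ^+ n.+2 :> R by rewrite exprn_gt0.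
have s0 : 0 < sin x.
  apply: sin_gt0_pi; apply/andP; split.
    by apply: divr_gt0; [rewrite mulr_gt0// pi_gt0|exact: exprn_gt0].
  rewrite /x ltr_pdivrMr ?exprn_gt0// mulrC ltr_pM2l ?pi_gt0//.
  by rewrite exprS ltr_pMr//; apply: exprn_egt1; rewrite ?ltr1n.
have sc : sin x * cos x <= sin x by rewrite (ler_piMr (ltW s0)) ?cos_le1.
rewrite (mulrC (cos x)) -mulr2n -[sin x * cos x *+ 2]mulr_natl mulrCA -mulrA.
by rewrite !ler_pM2l.
Qed.

(** The circle of radius r, contracted towards w along straight lines.  The first
    coordinate of p is the factor of contraction, the second one the angle. *)
Definition shrink (r : R) (w : C) (p : R * R) : C :=
  w + rc p.1 * (rc r * cis (2 * pi * p.2) - w).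

Lemma shrink_lip (r : R) w x l p q : 0 <= r -> r <= 1 -> cn w <= 1 ->
  0 <= x -> x + l <= 1 ->
  inbox x 0 l 1 p -> inbox x 0 l 1 q ->
  cn (shrink r w p - shrink r w q) <= (2 + 4 * pi) * l1d p q.
Proof.
move=> r0 r1 w1 x0 xl hp hq.
have -> : shrink r w p - shrink r w q =
    rc (p.1 - q.1) * (rc r * cis (2 * pi * p.2) - w)
    + rc q.1 * (rc r * (cis (2 * pi * p.2) - cis (2 * pi * q.2))).
  by rewrite /shrink rcB; ring.
apply: le_trans (cnD _ _) _; rewrite !cnM !cn_rc.
have a1 : cn (rc r * cis (2 * pi * p.2) - w) <= 2.
  apply: le_trans (cnB _ _) _; rewrite cnM cn_cis cn_rc ger0_norm//; lra.
have a2 : cn (cis (2 * pi * p.2) - cis (2 * pi * q.2)) <= 4 * pi * `|p.2 - q.2|.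
  apply: le_trans (cis_lip _ _) _.
  rewrite -mulrBr normrM (@ger0_norm _ (2 * pi)) ?mulr_ge0 ?pi_ge0//; lra.
have a3 : `|q.1| <= 1.
  by case: hq => ? ? _ _; rewrite ger0_norm; lra.
have a4 : `|r| <= 1 by rewrite ger0_norm.
have h1 : `|p.1 - q.1| * cn (rc r * cis (2 * pi * p.2) - w) <= `|p.1 - q.1| * 2.
  by rewrite ler_wpM2l.
have h2 : `|q.1| * (`|r| * cn (cis (2 * pi * p.2) - cis (2 * pi * q.2)))
    <= 4 * pi * `|p.2 - q.2|.
  rewrite mulrA; apply: le_trans a2; rewrite ler_piMl ?cn_ge0//.
  by rewrite mulr_ile1.
apply: le_trans (lerD h1 h2) _; rewrite /l1d.
have p0 := @pi_ge0 R.
have := mulr_ge0 p0 (normr_ge0 (p.1 - q.1)); have := normr_ge0 (p.2 - q.2).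
nra.
Qed.

Lemma seg_row G h n (a b c c' : R) : (forall s, G (s, c) = G (s, c')) ->
  seg G h n (a, c) (b, c) = seg G h n (a, c') (b, c').
Proof.
move=> hG; elim: n a b => [|n IH] a b /=; first by rewrite /trap !hG.
have e (x : R) : (x + x) / 2 = x by field.
by rewrite /mid /= !e !IH.
Qed.

Lemma seg_column G h n (s a b : R) :
  seg G h n (s, a) (s, b) = \sum_(j < 2 ^ n)
    trap G h (s, a + (b - a) * (j%:R / 2 ^+ n)) (s, a + (b - a) * (j.+1%:R / 2 ^+ n)).
Proof.
elim: n a b => [|n IH] a b /=.
  by rewrite big_ord_recl big_ord0 addr0 !divr1 mulr0 mulr1 addr0 addrC subrK.
have e (x : R) : (x + x) / 2 = x by field.
rewrite /mid /= !e !IH expnS mul2n -addnn big_split_ord /=; congr (_ + _);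
  apply: eq_bigr => j _; congr (trap G h (s, _) (s, _)).
1,2: by rewrite exprS; field; rewrite two_neq0.
all: by rewrite ?natrD -?[(_ + j).+1]/(2 ^ n + j.+1)%N -?addnS ?natrD natrX exprS;
  field; rewrite two_neq0.
Qed.

(** Over a circle about w, shrunk by the factor s, the trapezoidal sum of the
    Cauchy integrand is an average over roots of unity, in which s occurs only
    in the argument of phi. *)
Lemma seg_circle phi n (r s : R) w : 0 < s -> 0 < r -> cn w < r ->
  seg (shrink r w) (fun z => phi z / (z - w)) n (s, 0) (s, 1) =
  (2 ^+ n * ((uroot n 1 - (uroot n 1)^-1) / 2)) *
    avg n (fun z => phi (w + rc s * (rc r * z - w)) * (rc r * z / (rc r * z - w))).
Proof.
move=> s0 r0 wr; rewrite seg_column /avg [RHS]mulrC mulrACA mulVf ?twoC_neq0// mul1r.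
have nz z : cn z = 1 -> rc r * z - w != 0.
  move=> hz; rewrite subr_eq0; apply: contraTneq wr => <-.
  by rewrite cnM hz mulr1 cn_rc gtr0_norm// ltxx.
have s0' : rc s != 0 by rewrite -cn_eq0 cn_rc normr_eq0 gt_eqF.
pose Z j := rc r * uroot n j - w.
pose H j := phi (w + rc s * Z j) / (rc s * Z j).
pose K j := H j * (rc s * rc r * uroot n j) * (1 - (uroot n 1)^-1) / 2.
have Z0 j : Z j != 0 by apply: nz; exact: cn_root.
rewrite (eq_bigr (fun j : 'I_(2 ^ n) =>
    H j * (rc s * rc r * uroot n j) * (uroot n 1 - 1) / 2 + K j.+1)); last first.
  move=> j _; rewrite /trap /shrink /= subr0 !mul1r !add0r.
  rewrite -!/(uroot n _) /K /H -!/(Z _).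
  have wK (y : C) : w + y - w = y by ring.
  rewrite !wK; move: (Z0 j) (Z0 j.+1); rewrite /Z (rootE n j.+1) exprSr -rootE.
  set p1 := phi _; set p2 := phi _; move: p1 p2 => p1 p2.
  have := root_neq0 n 1; move: (uroot n j) (uroot n 1) (rc s) s0' (rc r) => u v y hy z hv h1 h2.
  by field; rewrite hy hv h1 h2.
rewrite big_split /=.
have -> : \sum_(j < 2 ^ n) K j.+1 = \sum_(j < 2 ^ n) K j.
  have KN : K (2 ^ n)%N = K 0%N.
    rewrite /K /H /Z (_ : uroot n (2 ^ n) = uroot n 0)//.
    by rewrite rootE root_n /uroot mul0r mulr0 cis0.
  apply: (@addrI _ (K 0%N)); rewrite -(big_ord_recl _ (fun j : 'I__ => K j)) /=.
  by rewrite big_ord_recr /= KN addrC.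
rewrite -big_split mulr_suml; apply: eq_bigr => j _ /=; rewrite /K /H /Z.
by field; rewrite root_neq0 s0' nz ?cn_root.
Qed.

End Cauchy.

(** * Holomorphic functions of one complex variable *)

Section Derivative.
Context {R : realType}.
Local Notation C := (Cplx R).
Implicit Types (phi psi : C -> C) (t w a b c : C).

Lemma is_cder_lip phi t a : is_cder phi t a -> exists2 d : R, 0 < d &
  forall u, cn u < d -> cn (phi (t + u) - phi t) <= (cn a + 1) * cn u.
Proof.
move=> /(_ 1 ltr01)[d d0 h]; exists d => // u /h hu.
rewrite (_ : phi (t + u) - phi t = (phi (t + u) - phi t - u * a) + u * a); last by ring.
apply: le_trans (cnD _ _) _; rewrite cnM; lra.
Qed.

Lemma is_cder_cont phi t a : is_cder phi t a -> forall e : R, 0 < e ->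
  exists2 d : R, 0 < d & forall u, cn u < d -> cn (phi (t + u) - phi t) < e.
Proof.
move=> /is_cder_lip[d d0 h] e e0; have a1 : 0 < cn a + 1 by have := cn_ge0 a; lra.
exists (Num.min d (e / (cn a + 1))); first by rewrite lt_min d0 divr_gt0.
move=> u; rewrite lt_min ltr_pdivlMr// => /andP[/h h1 h2].
by apply: le_lt_trans h1 _; rewrite mulrC.
Qed.

Lemma is_cder_cst c t : is_cder (fun=> c) t 0.
Proof.
move=> e e0; exists 1 => // u _; rewrite mulr0 !subrr cn0.
by rewrite mulr_ge0 ?cn_ge0// ltW.
Qed.

Lemma is_cderD phi psi t a b : is_cder phi t a -> is_cder psi t b ->
  is_cder (fun z => phi z + psi z) t (a + b).
Proof.
move=> hf hg e e0; have e2 : 0 < e / 2 by rewrite divr_gt0.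
have [d1 d10 h1] := hf _ e2; have [d2 d20 h2] := hg _ e2.
exists (Num.min d1 d2); first by rewrite lt_min d10.
move=> u; rewrite lt_min => /andP[/h1 a1 /h2 a2].
rewrite (_ : _ - _ - _ = (phi (t + u) - phi t - u * a) + (psi (t + u) - psi t - u * b)).
  by apply: le_trans (cnD _ _) _; lra.
by ring.
Qed.

Lemma is_cderM phi psi t a b : is_cder phi t a -> is_cder psi t b ->
  is_cder (fun z => phi z * psi z) t (a * psi t + phi t * b).
Proof.
move=> hf hg e e0.
pose K := cn (phi t) + cn (psi t) + (cn a + 1) * (cn b + 1) + 1.
have [f0 g0 a0 b0] := And4 (cn_ge0 (phi t)) (cn_ge0 (psi t)) (cn_ge0 a) (cn_ge0 b).
have ab0 : 0 <= (cn a + 1) * (cn b + 1) by rewrite mulr_ge0//; lra.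
have K0 : 0 < K by rewrite /K; lra.
have e2 : 0 < e / K by rewrite divr_gt0.
have [d1 d10 h1] := hf _ e2; have [d2 d20 h2] := hg _ e2.
have [d3 d30 h3] := is_cder_lip hf; have [d4 d40 h4] := is_cder_lip hg.
exists (Num.min (Num.min d1 d2) (Num.min (Num.min d3 d4) (e / K))).
  by rewrite !lt_min d10 d20 d30 d40.
move=> u; rewrite !lt_min => /andP[/andP[/h1 k1 /h2 k2] /andP[/andP[/h3 k3 /h4 k4] k5]].
rewrite (_ : _ - _ - _ = phi t * (psi (t + u) - psi t - u * b)
   + psi t * (phi (t + u) - phi t - u * a)
   + (phi (t + u) - phi t) * (psi (t + u) - psi t)); last by ring.
apply: le_trans (cnD _ _) _; apply: le_trans (lerD (cnD _ _) (lexx _)) _; rewrite !cnM.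
have u0 := cn_ge0 u.
have m1 := ler_wpM2l f0 k2; have m2 := ler_wpM2l g0 k1.
have m3 := ler_pM (cn_ge0 _) (cn_ge0 _) k3 k4.
apply: le_trans (lerD (lerD m1 m2) m3) _.
rewrite (_ : (cn a + 1) * cn u * ((cn b + 1) * cn u) =
  (cn a + 1) * (cn b + 1) * (cn u * cn u)); last by ring.
have m4 : (cn a + 1) * (cn b + 1) * (cn u * cn u) <=
    (cn a + 1) * (cn b + 1) * (e / K * cn u).
  by rewrite ler_wpM2l// ler_wpM2r// ltW.
apply: le_trans (lerD (lexx _) m4) _.
have eu : 0 <= e / K * cn u by rewrite mulr_ge0// ltW.
have -> : e * cn u = K * (e / K * cn u) by field; rewrite gt_eqF.
rewrite /K; move: eu; set X := e / K * cn u; nra.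
Qed.

Lemma is_cderZ c phi t a : is_cder phi t a -> is_cder (fun z => c * phi z) t (c * a).
Proof.
by move=> h; have := is_cderM (is_cder_cst c t) h; rewrite mul0r add0r.
Qed.

Lemma is_cder_invB w t : t - w != 0 ->
  is_cder (fun z => (z - w)^-1) t (- (t - w) ^- 2).
Proof.
move=> tw e e0; pose m := cn (t - w).
have m0 : 0 < m by rewrite /m cn_gt0.
exists (Num.min (m / 2) (e * m ^+ 3 / 2)).
  by rewrite lt_min divr_gt0//= divr_gt0// mulr_gt0// exprn_gt0.
move=> u; rewrite lt_min => /andP[h1 h2].
have h3 : m / 2 <= cn (t + u - w).
  have := cn_dist_add (t + u - w) (t - w) 0; rewrite !subr0 -/m.
  rewrite (_ : t - w - (t + u - w) = - u) ?cnN; last by ring.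
  by move=> h; lra.
have tuw : t + u - w != 0 by rewrite -cn_gt0; apply: lt_le_trans h3; lra.
rewrite (_ : _ - _ - _ = u * (u / ((t - w) ^+ 2 * (t + u - w)))); last first.
  by field; rewrite tw tuw.
rewrite cnM mulrC ler_wpM2r ?cn_ge0// cn_div cnM cnX -/m.
rewrite ler_pdivrMr; last by rewrite mulr_gt0 ?exprn_gt0//; lra.
apply: le_trans (ltW h2) _.
rewrite (_ : e * m ^+ 3 / 2 = e * (m ^+ 2 * (m / 2))); last by ring.
by rewrite ler_wpM2l ?(ltW e0)// ler_wpM2l ?exprn_ge0// ltW.
Qed.

Lemma is_cder_aff phi c b t a : is_cder phi (c + b * t) a ->
  is_cder (fun s => phi (c + b * s)) t (b * a).
Proof.
move=> h e e0; have b0 := cn_ge0 b.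
have e1 : 0 < e / (cn b + 1) by rewrite divr_gt0//; lra.
have [d d0 hd] := h _ e1.
exists (d / (cn b + 1)); first by rewrite divr_gt0//; lra.
move=> u; rewrite ltr_pdivlMr; last by lra.
move=> hu; have u0 := cn_ge0 u.
have : cn (b * u) < d by rewrite cnM; nra.
move=> /hd; rewrite (_ : c + b * t + b * u = c + b * (t + u)); last by ring.
rewrite (_ : b * u * a = u * (b * a)); last by ring.
move=> /le_trans; apply; rewrite cnM mulrA ler_wpM2r//.
by rewrite mulrAC ler_pdivrMr; [nra|lra].
Qed.

Lemma is_cder_sum (I : Type) (s : seq I) (f : I -> C -> C) (a : I -> C) t :
  (forall i, is_cder (f i) t (a i)) ->
  is_cder (fun z => \sum_(i <- s) f i z) t (\sum_(i <- s) a i).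
Proof.
move=> h; elim: s => [|i s IH].
  rewrite big_nil (_ : (fun z => _) = fun=> 0); first exact: is_cder_cst.
  by apply/funext => z; rewrite big_nil.
rewrite big_cons (_ : (fun z => _) = fun z => f i z + \sum_(j <- s) f j z).
  exact: is_cderD.
by apply/funext => z; rewrite big_cons.
Qed.

Lemma is_cder_ext phi psi t a (r : R) : 0 < r ->
  (forall u, cn u < r -> phi (t + u) = psi (t + u)) ->
  is_cder phi t a -> is_cder psi t a.
Proof.
move=> r0 he h e /h[d d0 hd]; exists (Num.min d r); first by rewrite lt_min d0.
move=> u; rewrite lt_min => /andP[/hd k1 /he <-].
by rewrite -{2}(addr0 t) -he ?cn0// addr0.
Qed.

Definition holo phi c (r : R) := forall t, cn (t - c) < r -> exists a, is_cder phi t a.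

(** By Goursat's lemma, contracting the circle towards w does not change the
    limit of the averages.  On a small circle, phi is almost constant and the
    kernel has average almost one. *)
Lemma cauchy_formula phi (r : R) w : 0 < r -> r < 1 -> holo phi 0 1 -> cn w < r ->
  clim (fun n => avg n (fun z => phi (rc r * z) * (rc r * z / (rc r * z - w)))) (phi w).
Proof.
move=> r0 r1 hphi wr.
have w0 := cn_ge0 w.
have nz z : cn z = 1 -> r - cn w <= cn (rc r * z - w).
  move=> hz; have := cn_dist_add w (rc r * z) 0.
  by rewrite !subr0 cnM hz mulr1 cn_rc gtr0_norm//; lra.
have nz0 z : cn z = 1 -> rc r * z - w != 0.
  by move=> /nz h; rewrite -cn_gt0; apply: lt_le_trans h; rewrite subr_gt0.
pose A s n := avg n (fun z => phi (w + rc s * (rc r * z - w)) * (rc r * z / (rc r * z - w))).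
have cvA s : 0 < s -> s < 1 -> clim (fun n => A 1 n - A s n) 0.
  move=> s0 s1; pose h z := phi z / (z - w).
  have G0 y : shrink r w (y, 0) = shrink r w (y, 1) :> C.
    by rewrite /shrink /= mulr0 mulr1 cis0 cis2pi.
  have hb : clim (fun n => bdy (shrink r w) h n s 0 (1 - s) 1) 0.
    apply: (@goursat _ _ _ (2 + 4 * pi)) => //; rewrite ?subr_gt0//.
    - by have := @pi_ge0 R; lra.
    - by move=> p q; apply: shrink_lip; lra.
    - move=> [y th] [/= y1 y2 _ _].
      have hin : cn (shrink r w (y, th)) < 1.
        rewrite /shrink /= (_ : w + _ = rc (1 - y) * w + rc y * (rc r * cis (2 * pi * th))).
          apply: le_lt_trans (cnD _ _) _; rewrite !cnM !cn_rc cn_cis mulr1.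
          rewrite !ger0_norm; [nra|lra..].
        by rewrite rcB rc1; ring.
      have [|a ha] := hphi (shrink r w (y, th)); first by rewrite subr0.
      eexists; apply: (is_cderM ha); apply: is_cder_invB.
      rewrite /shrink /= addrC addKr mulf_neq0 ?nz0 ?cn_cis//.
      by rewrite -cn_eq0 cn_rc normr_eq0; lra.
  move=> e e0; have [n0 hn] := hb _ e0; exists (maxn n0 2) => n.
  rewrite geq_max => /andP[/hn]; rewrite subr0 /bdy.
  rewrite add0r (addrC s) subrK (seg_row h n s 1 G0).
  have cancel (x1 x2 x3 : C) : x1 + x2 - x1 - x3 = x2 - x3 by ring.
  rewrite cancel.
  rewrite /h !seg_circle//; set k := _ * (_ / 2).
  move=> h1 n2; rewrite subr0 -!/(A _ _).
  rewrite -!/(A _ _) -mulrBr cnM in h1.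
  have k1 : 1 <= cn k.
    rewrite /k cnM cnX cn_nat /uroot -cisN.
    case: n n2 {hn k h1} => [|[|n]]// _.
    pose y : R := 2 * pi / 2 ^+ n.+2.
    have := @sin_root_ge R n; rewrite -/y.
    rewrite (_ : 2 * pi * (1%:R / 2 ^+ n.+2) = y); last by rewrite /y; ring.
    move=> h4; have := cn_Im ((cis y - cis (- y)) / 2).
    have -> : (cis y - cis (- y)) / 2 = Complex 0 (sin y).
      apply: (mulIf (_ : 2 != 0 :> C)); first by rewrite pnatr_eq0.
      rewrite divfK ?pnatr_eq0// mulr_natr mulr2n /cis cosN sinN.
      by apply/eqP; rewrite eq_complex /=; apply/andP; split; apply/eqP; ring.
    move=> h5; apply: le_trans (_ : 2 ^+ n.+2 * sin y <= _); first by lra.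
    rewrite ler_wpM2l ?exprn_ge0//.
    by apply: le_trans (_ : `|sin y| <= _); [exact: ler_norm|exact: h5].
  by apply: le_lt_trans h1; rewrite ler_peMl ?cn_ge0.
have kE z : cn z = 1 -> rc r * z / (rc r * z - w) = (1 - (w / rc r) / z)^-1.
  move=> hz; have z0 : z != 0 by rewrite -cn_eq0 hz oner_eq0.
  have rr : rc r != 0 by rewrite -cn_eq0 cn_rc normr_eq0 gt_eqF.
  have e1 : 1 - w / rc r / z = (rc r * z - w) / (rc r * z) by field; rewrite z0 rr.
  by rewrite e1 invf_div.
pose K := r / (r - cn w).
have K0 : 0 < K by rewrite divr_gt0// subr_gt0.
have kK z : cn z = 1 -> cn (rc r * z / (rc r * z - w)) <= K.
  move=> hz; rewrite cn_div cnM hz mulr1 cn_rc gtr0_norm// /K ler_wpM2l ?(ltW r0)//.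
  by rewrite lef_pV2 ?posrE ?cn_gt0 ?nz0 ?subr_gt0// nz.
pose x := w / rc r.
have x1 : cn x < 1 by rewrite cn_div cn_rc gtr0_norm// ltr_pdivrMr// mul1r.
have cvk : clim (fun n => avg n (fun z => rc r * z / (rc r * z - w))) 1.
  have xs := expr_small (cn_ge0 x) x1.
  move=> e e0; have e1 : 0 < e / 4 by lra.
  have [n1 h1] := xs _ e1; have [n2 h2] := xs (2^-1) ltac:(lra).
  exists (maxn n1 n2) => n hn.
  have h2n : (n < 2 ^ n)%N by exact: ltn_expl.
  have {}h1 := h1 (2 ^ n)%N (leq_trans (leq_trans (leq_maxl _ _) hn) (ltnW h2n)).
  have {}h2 := h2 (2 ^ n)%N (leq_trans (leq_trans (leq_maxr _ _) hn) (ltnW h2n)).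
  rewrite (@eq_avg _ _ _ (fun z => (1 - x / z)^-1)); last first.
    by move=> j; rewrite kE ?cn_root.
  rewrite avg_kernel//; set y := x ^+ _; rewrite -cnX -/y in h1 h2.
  have y1 : 2^-1 < cn (1 - y).
    by have := cn_dist_add y 1 0; rewrite !subr0 cn1; lra.
  have y0 : 1 - y != 0 by rewrite -cn_gt0; lra.
  rewrite (_ : _ - 1 = y / (1 - y)); last by field.
  rewrite cn_div ltr_pdivrMr ?cn_gt0//; nra.
move=> e e0.
pose e1 := e / (4 * K).
have e10 : 0 < e1 by rewrite divr_gt0// mulr_gt0.
have [a ha] : exists a, is_cder phi w a.
  by apply: hphi; rewrite subr0; exact: lt_trans r1.
have [d d0 hd] := is_cder_cont ha e10.
pose s := Num.min (1 / 2) (d / 4).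
have s0 : 0 < s by rewrite lt_min; apply/andP; split; lra.
have s1 : s < 1 by rewrite gt_min; apply/orP; left; lra.
have sd : s * 2 < d by apply: le_lt_trans (_ : d / 4 * 2 < _); [rewrite ler_wpM2r// ge_min lexx orbT|lra].
have e4 : 0 < e / 4 by lra.
have [n1 h1] := cvA s s0 s1 _ e4.
have e5 : 0 < e / (4 * (cn (phi w) + 1)).
  by rewrite divr_gt0// mulr_gt0//; have := cn_ge0 (phi w); lra.
have [n2 h2] := cvk _ e5.
exists (maxn n1 n2) => n; rewrite geq_max => /andP[/h1 {}h1 /h2 {}h2].
rewrite subr0 in h1.
have -> : avg n (fun z => phi (rc r * z) * (rc r * z / (rc r * z - w))) = A 1 n.
  by apply: eq_avg => j; rewrite rc1 mul1r [w + _]addrC subrK.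
set k := avg n _ in h2.
rewrite (_ : _ - _ = (A 1 n - A s n) + (A s n - phi w * k) + phi w * (k - 1)); last by ring.
apply: le_lt_trans (cnD _ _) _; apply: le_lt_trans (lerD (cnD _ _) (lexx _)) _.
have b2 : cn (A s n - phi w * k) <= e1 * K.
  have -> : A s n - phi w * k = avg n (fun z =>
      (phi (w + rc s * (rc r * z - w)) - phi w) * (rc r * z / (rc r * z - w))).
    rewrite -mulNr /A /k -(avgZ n (- phi w)) -avgD.
    by apply: eq_avg => j; rewrite mulrBl mulNr.
  apply: avg_le => j; rewrite cnM; apply: ler_pM; rewrite ?cn_ge0//; last first.
    by apply: kK; rewrite cn_root.
  apply/ltW/hd; apply: le_lt_trans sd.
  rewrite cnM cn_rc gtr0_norm// ler_wpM2l ?(ltW s0)//.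
  apply: le_trans (cnB _ _) _; rewrite cnM cn_root mulr1 cn_rc gtr0_norm//; lra.
have b3 : cn (phi w * (k - 1)) <= e / 4.
  rewrite cnM; have f0 := cn_ge0 (phi w).
  apply: le_trans (_ : (cn (phi w) + 1) * (e / (4 * (cn (phi w) + 1))) <= _).
    by apply: ler_pM; rewrite ?cn_ge0// ?lerDl// ltW.
  rewrite le_eqVlt; apply/orP; left; apply/eqP; field; rewrite gt_eqF//; lra.
have : e1 * K = e / 4 by rewrite /e1; field; rewrite gt_eqF.
lra.
Qed.

End Derivative.

Section Disc.
Context {R : realType}.
Local Notation C := (Cplx R).
Implicit Types (phi psi : C -> C) (t w a b c : C).

Definition bounded_on phi c (r M : R) := forall t, cn (t - c) < r -> cn (phi t) <= M.

Let r34 : R := 3 / 4.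

(** The difference quotient at the origin, extended by the derivative. *)
Definition dquot phi a t : C := if t == 0 then a else (phi t - phi 0) / t.

Section Unit.
Context (phi : C -> C) (M : R) (a : C).
Context (hol : holo phi 0 1) (bnd : bounded_on phi 0 1 M) (der : is_cder phi 0 a).

Let r0 : 0 < r34. Proof. by rewrite /r34; lra. Qed.
Let r1 : r34 < 1. Proof. by rewrite /r34; lra. Qed.

Let M0 : 0 <= M.
Proof. by apply: le_trans (cn_ge0 (phi 0)) (bnd _); rewrite subrr cn0. Qed.

Let cn_r z : cn z = 1 -> cn (rc r34 * z) = r34.
Proof. by move=> h; rewrite cnM h mulr1 cn_rc gtr0_norm. Qed.

Let phi_r z : cn z = 1 -> cn (phi (rc r34 * z)) <= M.
Proof. by move=> h; apply: bnd; rewrite subr0 cn_r. Qed.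

Let dist_r z t : cn z = 1 -> r34 - cn t <= cn (rc r34 * z - t).
Proof.
move=> h; have := cn_dist_add t (rc r34 * z) 0; rewrite !subr0 cn_r//; lra.
Qed.

Let nz_r z t : cn z = 1 -> cn t < r34 -> rc r34 * z - t != 0.
Proof. by move=> /dist_r h1 h; rewrite -cn_gt0; have := h1 t; lra. Qed.

(** The averages of the Cauchy integrand for the difference quotient at t.  Unlike
    the quotient itself, they are explicitly holomorphic at the origin. *)
Definition mean_dquot n t : C := avg n (fun z => phi (rc r34 * z) / (rc r34 * z - t)).

Let cauchy_mean t : cn t < r34 ->
  clim (fun n => t * mean_dquot n t) (phi t - phi 0).
Proof.
move=> ht; have c1 := cauchy_formula r0 r1 hol ht.
have c0 := cauchy_formula r0 r1 hol (_ : cn 0 < r34); rewrite cn0 in c0.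
apply: eq_clim (climB c1 (c0 r0)) => n; rewrite /mean_dquot -avgZ.
rewrite -[X in _ - X]mul1r -[1]opprK mulNr opprK -(avgZ n (-1)) -avgD.
apply: eq_avg => j; rewrite subr0.
have h1 := nz_r (cn_root n j) ht.
have h2 : rc r34 * uroot n j != 0 by rewrite -cn_gt0 cn_r// cn_root.
by move: (rc r34 * _) h1 h2 => z h1 h2; field; rewrite h1 h2.
Qed.

Let mean_second n t : cn t <= 1 / 2 ->
  cn (t * mean_dquot n t - t * mean_dquot n 0) <= 6 * M * cn t ^+ 2.
Proof.
move=> ht.
have -> : t * mean_dquot n t - t * mean_dquot n 0 = t ^+ 2 *
    avg n (fun z => phi (rc r34 * z) * (rc r34 * z * (rc r34 * z - t))^-1).
  rewrite -mulNr -!avgZ -avgD; apply: eq_avg => j; rewrite subr0.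
  have h1 : rc r34 * uroot n j - t != 0.
    by apply: nz_r; rewrite ?cn_root// /r34; lra.
  have h2 : rc r34 * uroot n j != 0 by rewrite -cn_gt0 cn_r// cn_root.
  by move: (rc r34 * _) h1 h2 => z h1 h2; field; rewrite h1 h2.
rewrite cnM cnX mulrC ler_wpM2r ?exprn_ge0 ?cn_ge0//.
apply: avg_le => j; rewrite cnM mulrC; apply: ler_pM; rewrite ?cn_ge0 ?phi_r ?cn_root//.
rewrite cnV cnM cn_r ?cn_root//.
have := dist_r t (cn_root n j); rewrite /r34 => h.
rewrite -[leRHS]invrK lef_pV2 ?posrE; lra.
Qed.

Lemma clim_mean_dquot0 : clim (fun n => mean_dquot n 0) a.
Proof.
move=> e e0; have e4 : 0 < e / 4 by lra.
have [d d0 hd] := der e4.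
pose tau := Num.min (1 / 2) (Num.min (d / 2) (e / (4 * (6 * M + 1)))).
have M1 : 0 < 4 * (6 * M + 1) by have := M0; lra.
have tau0 : 0 < tau by rewrite !lt_min !divr_gt0.
have ctau : cn (rc tau) = tau by rewrite cn_rc gtr0_norm.
have t1 : tau <= 1 / 2 by rewrite ge_min lexx.
have t2 : tau <= d / 2 by rewrite /tau minCA ge_min lexx.
have t3 : tau <= e / (4 * (6 * M + 1)) by rewrite /tau minA ge_min lexx orbT.
rewrite ler_pdivlMr// in t3.
have etau : 0 < e * tau / 4 by rewrite divr_gt0// mulr_gt0.
have ht : cn (rc tau) < r34 by rewrite ctau /r34; lra.
have [n0 hn] := cauchy_mean ht etau.
exists n0 => n hn0; have k1 := hn n hn0.
have := @mean_second n (rc tau); rewrite ctau => /(_ t1) k2.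
have := hd (rc tau); rewrite ctau add0r => /(_ ltac:(lra)) k3.
rewrite -(ltr_pM2l tau0) -{1}ctau -cnM.
rewrite (_ : rc tau * (mean_dquot n 0 - a) =
  (phi (rc tau) - phi 0 - rc tau * a)
  + (rc tau * mean_dquot n (rc tau) - (phi (rc tau) - phi 0))
  - (rc tau * mean_dquot n (rc tau) - rc tau * mean_dquot n 0)); last by ring.
apply: le_lt_trans (cnB _ _) _; apply: le_lt_trans (lerD (cnD _ _) (lexx _)) _.
apply: le_lt_trans (lerD (lerD k3 (lexx _)) k2) _.
have := M0; move: k1 t3 tau0; rewrite expr2; nra.
Qed.

Lemma second_order_unit t : cn t <= 1 / 2 ->
  cn (phi t - phi 0 - t * a) <= 6 * M * cn t ^+ 2.
Proof.
move=> ht; have ht' : cn t < r34 by rewrite /r34; lra.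
apply: (clim_le (climB (cauchy_mean ht') (climZ t clim_mean_dquot0))).
by exists 0%N => n _; exact: mean_second.
Qed.

Lemma clim_mean_dquot t : cn t < r34 -> clim (fun n => mean_dquot n t) (dquot phi a t).
Proof.
move=> ht; rewrite /dquot; case: eqP => [->|/eqP t0]; first exact: clim_mean_dquot0.
rewrite mulrC; apply: eq_clim (climZ t^-1 (cauchy_mean ht)) => n.
by rewrite mulrA mulVf ?mul1r.
Qed.

Lemma mean_dquot_le n t : cn t < 1 / 2 -> cn (mean_dquot n t) <= 4 * M.
Proof.
move=> ht; apply: avg_le => j; rewrite cn_div mulrC.
apply: ler_pM; rewrite ?invr_ge0 ?cn_ge0 ?phi_r ?cn_root//.
have := dist_r t (cn_root n j); rewrite /r34 => h.
rewrite -[leRHS]invrK lef_pV2 ?posrE; lra.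
Qed.

Lemma mean_dquot_holo n t : cn t < r34 -> exists b, is_cder (mean_dquot n) t b.
Proof.
move=> ht; pose z (j : nat) := rc r34 * uroot n j.
have e (j : nat) : (fun t => phi (z j) / (z j - t)) = (fun t => (- phi (z j)) * (t - z j)^-1).
  apply/funext => s; rewrite -(opprB s (z j)); have [->|h] := eqVneq (s - z j) 0.
    by rewrite oppr0 invr0 !mulr0.
  by rewrite invrN mulrN mulNr.
have hj (j : 'I_(2 ^ n)) : is_cder (fun t => phi (z j) / (z j - t)) t
    ((- phi (z j)) * (- (t - z j) ^- 2)).
  rewrite e; apply: is_cderZ; apply: is_cder_invB.
  by rewrite -oppr_eq0 opprB; apply: nz_r; rewrite ?cn_root.
by eexists; exact: (is_cderZ (2 ^+ n)^-1 (is_cder_sum _ hj)).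
Qed.

(** Schwarz's lemma, with a constant that is not optimal. *)
Lemma dquot_le t : cn t < 1 -> cn (dquot phi a t) <= 4 * M.
Proof.
move=> ht; have [h|h] := ltP (cn t) (1 / 2).
  have ht' : cn t < r34 by rewrite /r34; lra.
  apply: (clim_le (clim_mean_dquot ht')).
  by exists 0%N => n _; exact: mean_dquot_le.
rewrite /dquot ifF; last by apply/negbTE; rewrite -cn_gt0; lra.
rewrite cn_div ler_pdivrMr; last by lra.
apply: le_trans (cnB _ _) _.
have := @bnd t; rewrite subr0 => /(_ ht) b1.
have := @bnd 0; rewrite subr0 cn0 => /(_ ltr01) b2.
have := M0; nra.
Qed.

Lemma dquotE t : phi t = phi 0 + t * dquot phi a t.
Proof.
rewrite /dquot; case: eqP => [->|/eqP h]; first by rewrite mul0r addr0.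
by rewrite mulrC divfK// addrC subrK.
Qed.

End Unit.

Lemma holo_aff phi c (r : R) : 0 < r -> holo phi c r ->
  holo (fun s => phi (c + rc r * s)) 0 1.
Proof.
move=> r0 h t; rewrite subr0 => ht.
have [|a ha] := h (c + rc r * t).
  by rewrite addrC addKr cnM cn_rc gtr0_norm// gtr_pMr.
by exists (rc r * a); exact: is_cder_aff.
Qed.

Lemma bounded_aff phi c (r M : R) : 0 < r -> bounded_on phi c r M ->
  bounded_on (fun s => phi (c + rc r * s)) 0 1 M.
Proof.
move=> r0 h t; rewrite subr0 => ht; apply: h.
by rewrite addrC addKr cnM cn_rc gtr0_norm// gtr_pMr.
Qed.

(** Cauchy's estimate for the remainder of the first order expansion. *)
Lemma second_order phi c (r M : R) a u : 0 < r -> holo phi c r ->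
  bounded_on phi c r M -> is_cder phi c a -> cn u <= r / 2 ->
  cn (phi (c + u) - phi c - u * a) <= 6 * M / r ^+ 2 * cn u ^+ 2.
Proof.
move=> r0 h b d hu; have rr : rc r != 0 by rewrite -cn_gt0 cn_rc gtr0_norm.
have d' : is_cder (fun s => phi (c + rc r * s)) 0 (rc r * a).
  by apply: is_cder_aff; rewrite mulr0 addr0.
have := @second_order_unit _ _ _ (holo_aff r0 h) (bounded_aff r0 b) d' (u / rc r).
rewrite cn_div cn_rc gtr0_norm//; move=> /(_ ltac:(by rewrite ler_pdivrMr//; lra)).
have e1 : rc r * (u / rc r) = u by rewrite mulrC divfK.
have e2 : u / rc r * (rc r * a) = u * a by rewrite mulrA divfK.
rewrite mulr0 addr0 e1 e2 => h1.
apply: le_trans h1 _; rewrite le_eqVlt; apply/orP; left; apply/eqP.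
by field; rewrite gt_eqF.
Qed.

Lemma schwarz phi c (r M : R) u : 0 < r -> holo phi c r ->
  bounded_on phi c r M -> cn u < r -> cn (phi (c + u) - phi c) <= 4 * M / r * cn u.
Proof.
move=> r0 h b hu; have rr : rc r != 0 by rewrite -cn_gt0 cn_rc gtr0_norm.
have [|a d] := h c; first by rewrite subrr cn0.
have d' : is_cder (fun s => phi (c + rc r * s)) 0 (rc r * a).
  by apply: is_cder_aff; rewrite mulr0 addr0.
have hu' : cn (u / rc r) < 1 by rewrite cn_div cn_rc gtr0_norm// ltr_pdivrMr// mul1r.
have := dquot_le (holo_aff r0 h) (bounded_aff r0 b) d' hu'.
have := dquotE (fun s => phi (c + rc r * s)) (rc r * a) (u / rc r).
have e1 : rc r * (u / rc r) = u by rewrite mulrC divfK.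
rewrite e1 mulr0 addr0 => ->.
rewrite (addrC (phi c)) addrK cnM cn_div cn_rc gtr0_norm// => h1.
have := cn_ge0 u => u0; have ur : 0 <= cn u / r by rewrite divr_ge0// ltW.
apply: le_trans (ler_wpM2l ur h1) _; rewrite le_eqVlt; apply/orP; left; apply/eqP.
by field; rewrite gt_eqF.
Qed.

(** The remainders of the first order expansions are bounded uniformly, so that
    the expansions pass to the pointwise limit. *)
Lemma montel (f : nat -> C -> C) phi c (r M : R) (a : nat -> C) : 0 < r ->
  (forall n, holo (f n) c r) -> (forall n, bounded_on (f n) c r M) ->
  (forall t, cn (t - c) < r -> clim (fun n => f n t) (phi t)) ->
  (forall n, is_cder (f n) c (a n)) ->
  exists2 l, is_cder phi c l & clim a l.
Proof.
move=> r0 hh hb hl hd.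
have hc : cn (c - c) < r by rewrite subrr cn0.
have M0 : 0 <= M by apply: le_trans (cn_ge0 _) (hb 0%N _ hc).
pose K := 6 * M / r ^+ 2.
have K0 : 0 <= K by apply: divr_ge0; [rewrite mulr_ge0|rewrite exprn_ge0// ltW].
have so n u : cn u <= r / 2 -> cn (f n (c + u) - f n c - u * a n) <= K * cn u ^+ 2.
  by move=> hu; exact: (second_order r0 (hh n) (hb n) (hd n)).
have [l al] : exists l, clim a l.
  apply: clim_cauchy => e e0.
  have K1 : 0 < 8 * (K + 1) by lra.
  pose tau := Num.min (r / 2) (e / (8 * (K + 1))).
  have tau0 : 0 < tau by rewrite !lt_min !divr_gt0.
  have ctau : cn (rc tau) = tau by rewrite cn_rc gtr0_norm.
  have t1 : tau <= r / 2 by rewrite ge_min lexx.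
  have t2 : tau <= e / (8 * (K + 1)) by rewrite /tau ge_min lexx orbT.
  rewrite ler_pdivlMr// in t2.
  have ht : cn (c + rc tau - c) < r by rewrite addrC addKr ctau; lra.
  have e1 : 0 < e * tau / 16 by rewrite divr_gt0// mulr_gt0.
  have [n1 h1] := hl _ ht _ e1; have [n2 h2] := hl _ hc _ e1.
  exists (maxn n1 n2) => n m; rewrite !geq_max => /andP[/h1 p1 /h2 p2] /andP[/h1 q1 /h2 q2].
  have := so n (rc tau); have := so m (rc tau); rewrite ctau => /(_ t1) s1 /(_ t1) s2.
  rewrite -(ltr_pM2l tau0) -{1}ctau -cnM.
  rewrite (_ : rc tau * (a n - a m) =
    ((f n (c + rc tau) - phi (c + rc tau)) - (f m (c + rc tau) - phi (c + rc tau)))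
    - ((f n c - phi c) - (f m c - phi c))
    - ((f n (c + rc tau) - f n c - rc tau * a n)
       - (f m (c + rc tau) - f m c - rc tau * a m))); last by ring.
  apply: le_lt_trans (cnB _ _) _.
  apply: le_lt_trans (lerD (cnB _ _) (cnB _ _)) _.
  apply: le_lt_trans (lerD (lerD (cnB _ _) (cnB _ _)) (lexx _)) _.
  apply: le_lt_trans (lerD (lexx _) (lerD s2 s1)) _.
  move: p1 p2 q1 q2 tau0 t2; rewrite expr2; nra.
exists l => // e e0.
have K1 : 0 < K + 1 by lra.
exists (Num.min (r / 2) (e / (K + 1))); first by rewrite !lt_min !divr_gt0.
move=> u; rewrite lt_min => /andP[u1 u2]; rewrite ltr_pdivlMr// in u2.
have hu : cn (c + u - c) < r by rewrite addrC addKr; lra.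
apply: le_trans (_ : K * cn u ^+ 2 <= _).
  apply: (clim_le (climB (climB (hl _ hu) (hl _ hc)) (climZ u al))).
  by exists 0%N => n _; apply: so; exact: ltW.
rewrite expr2; have := cn_ge0 u; nra.
Qed.

Lemma holo_sub phi c (r : R) c' r' : holo phi c r -> cn (c' - c) + r' <= r -> holo phi c' r'.
Proof.
move=> h hr t ht; apply: h; have := cn_dist_add c' t c; lra.
Qed.

Lemma bounded_sub phi c (r : R) M c' r' :
  bounded_on phi c r M -> cn (c' - c) + r' <= r -> bounded_on phi c' r' M.
Proof.
move=> h hr t ht; apply: h; have := cn_dist_add c' t c; lra.
Qed.

Lemma holo_lim (f : nat -> C -> C) phi c (r M : R) :
  (forall n, holo (f n) c r) -> (forall n, bounded_on (f n) c r M) ->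
  (forall t, cn (t - c) < r -> clim (fun n => f n t) (phi t)) -> holo phi c r.
Proof.
move=> hh hb hl t ht; pose r' := r - cn (t - c).
have hr : cn (t - c) + r' <= r by rewrite /r'; lra.
have r'0 : 0 < r' by rewrite subr_gt0.
have /choice[a ha] : forall n, exists a, is_cder (f n) t a by move=> n; exact: hh.
have [||s hs|//|l hl' _] := @montel f phi t r' M a r'0; last by exists l.
- by move=> n; exact: holo_sub (hh n) hr.
- by move=> n; exact: bounded_sub (hb n) hr.
- apply: hl; have := cn_dist_add t s c; rewrite /r' in hs; lra.
Qed.

(** Riemann's theorem on removable singularities, for difference quotients: near
    the origin, they are bounded limits of Cauchy averages. *)
Lemma dquot_holo phi (M : R) a : holo phi 0 1 -> bounded_on phi 0 1 M ->
  is_cder phi 0 a -> holo (dquot phi a) 0 1.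
Proof.
move=> h b d t; rewrite subr0 => ht; have [t0|t0] := eqVneq t 0.
  have : holo (dquot phi a) 0 (1 / 2).
    apply: (@holo_lim (fun n => mean_dquot phi n) _ _ _ (4 * M)).
    - by move=> n s; rewrite subr0 => hs; apply: mean_dquot_holo; rewrite /r34; lra.
    - by move=> n s; rewrite subr0; exact: (mean_dquot_le b).
    - by move=> s; rewrite subr0 => hs; apply: (clim_mean_dquot h b) => //; rewrite /r34; lra.
  by apply; rewrite t0 subrr cn0.
have [|c hc] := h t; first by rewrite subr0.
have hq : exists2 x, is_cder (fun z => (phi z + - phi 0) * (z - 0)^-1) t x & True.
  eexists => //; apply: is_cderM; last by apply: is_cder_invB; rewrite subr0.
  by apply: is_cderD hc _; exact: is_cder_cst.
have [x hx _] := hq; exists x; apply: is_cder_ext (_ : 0 < cn t) _ hx; first by rewrite cn_gt0.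
move=> u hu; rewrite subr0 /dquot ifF//; apply/negbTE.
apply: contraTneq hu => htu; rewrite (_ : u = - t) ?cnN ?ltxx//.
by apply/eqP; rewrite -addr_eq0 addrC htu.
Qed.

End Disc.

(** * Holomorphic functions of several complex variables *)

Section Vectors.
Context {R : realType} {k : nat}.
Local Notation C := (Cplx R).
Local Notation V := (Ck R k).
Implicit Types (x y z h u : V) (e f : V -> C).

(** The norm of vectors, made real-valued like the modulus. *)
Definition vn (z : V) : R := \big[Num.max/0]_(i < k) cn (z 0 i).

Lemma vn_ge0 z : 0 <= vn z.
Proof. exact: bigmax_ge_id. Qed.

Lemma cn_le_vn z i : cn (z 0 i) <= vn z.
Proof. exact: (le_bigmax _ (fun i => cn (z 0 i))). Qed.

Lemma vn_le z (r : R) : 0 <= r -> (forall i, cn (z 0 i) <= r) -> vn z <= r.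
Proof. by move=> r0 h; apply/bigmax_leP; split. Qed.

Lemma vn_lt z (r : R) : 0 < r -> (forall i, cn (z 0 i) < r) -> vn z < r.
Proof. by move=> r0 h; apply/bigmax_ltP; split. Qed.

Lemma vn0 : vn 0 = 0.
Proof.
apply/eqP; rewrite eq_le vn_ge0 andbT; apply: vn_le => // i.
by rewrite mxE cn0.
Qed.

Lemma vn_eq0 z : (vn z == 0) = (z == 0).
Proof.
apply/eqP/eqP => [h|->]; last exact: vn0.
apply/rowP => i; rewrite mxE; apply/eqP; rewrite -cn_eq0 eq_le cn_ge0 andbT.
by rewrite -h cn_le_vn.
Qed.

Lemma vnD x y : vn (x + y) <= vn x + vn y.
Proof.
apply: vn_le => [|i]; first by rewrite addr_ge0 ?vn_ge0.
by rewrite mxE; apply: le_trans (cnD _ _) _; rewrite lerD ?cn_le_vn.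
Qed.

Lemma vnZ a x : vn (a *: x) = cn a * vn x.
Proof.
have le (b : C) z : vn (b *: z) <= cn b * vn z.
  apply: vn_le => [|i]; first by rewrite mulr_ge0 ?cn_ge0 ?vn_ge0.
  by rewrite mxE cnM ler_wpM2l ?cn_ge0 ?cn_le_vn.
apply/eqP; rewrite eq_le le /=.
have [->|a0] := eqVneq a 0; first by rewrite cn0 mul0r vn_ge0.
rewrite mulrC -ler_pdivlMr ?cn_gt0//; have := le a^-1 (a *: x).
by rewrite scalerA mulVf// scale1r cnV mulrC.
Qed.

Lemma vnN x : vn (- x) = vn x.
Proof. by rewrite -scaleN1r vnZ cnN cn1 mul1r. Qed.

Lemma vnB x y : vn (x - y) <= vn x + vn y.
Proof. by rewrite -(vnN y); exact: vnD. Qed.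

Lemma vn_distC x y : vn (x - y) = vn (y - x).
Proof. by rewrite -vnN opprB. Qed.

Lemma vn_dist_add y x z : vn (x - z) <= vn (x - y) + vn (y - z).
Proof. by apply: le_trans (vnD _ _); rewrite addrA subrK. Qed.

Lemma pos_rc (a : C) : 0 < a -> exists2 c : R, 0 < c & a = rc c.
Proof.
by case: a => a b; rewrite ltcE /= => /andP[/eqP -> a0]; exists a.
Qed.

Lemma mx_norm_vn z : `|z| = rc (vn z).
Proof.
have zE : `|z| = mx_norm z by [].
apply/eqP; rewrite eq_le; apply/andP; split.
  have b0 : 0 <= rc (vn z) by rewrite -rc0 le_rc vn_ge0.
  rewrite zE mx_normE -[leRHS]/((NngNum b0)%:num) num_le.
  apply/bigmax_leP; split=> [|[i j] _]; rewrite -num_le//=.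
  by rewrite normE le_rc ord1 cn_le_vn.
have [z0|z0] := eqVneq z 0; first by rewrite z0 vn0 rc0 normr0.
have : 0 < `|z| by rewrite normr_gt0.
move=> /pos_rc[c c0 hc]; rewrite hc le_rc; apply: vn_le => [|i]; first exact: ltW.
rewrite -le_rc -hc -normE zE mx_normE -[leLHS]nngE num_le.
exact: (le_bigmax _ (fun i : 'I_1 * 'I_k => `|z i.1 i.2|%:nng) (0, i)).
Qed.

Lemma nbhs_vn z (U : set V) :
  nbhs z U <-> exists2 d : R, 0 < d & forall w, vn (w - z) < d -> U w.
Proof.
split.
  move=> /nbhs_ballP[d /= /pos_rc[c c0 dc] h].
  exists c => // w hw; apply: h.
  by rewrite mx_norm_ball /ball_ /= mx_norm_vn dc lt_rc vn_distC.
move=> [d d0 h]; apply/nbhs_ballP; exists (rc d); first by rewrite /= -rc0 lt_rc.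
by move=> w; rewrite mx_norm_ball /ball_ /= mx_norm_vn lt_rc vn_distC; exact: h.
Qed.

Lemma open_vn (U : set V) :
  open U <-> forall z, U z -> exists2 d : R, 0 < d & forall w, vn (w - z) < d -> U w.
Proof.
rewrite openE; split => h z Uz; first by apply/nbhs_vn; exact: h.
by apply/nbhs_vn; exact: h.
Qed.

Definition lin (p : 'I_k -> C) h : C := \sum_i h 0 i * p i.

Lemma linZ p a x : lin p (a *: x) = a * lin p x.
Proof. by rewrite /lin mulr_sumr; apply: eq_bigr => i _; rewrite mxE mulrA. Qed.

Lemma lin_le p h : cn (lin p h) <= (\sum_i cn (p i)) * vn h.
Proof.
rewrite mulr_suml; apply: le_trans (cn_sum _ _ _) _; apply: ler_sum => i _.
by rewrite cnM mulrC ler_wpM2l ?cn_ge0 ?cn_le_vn.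
Qed.

(** Complex differentiability in terms of the real-valued norms. *)
Definition sdiff_at e z p := forall eps : R, 0 < eps -> exists2 d : R, 0 < d &
  forall h, vn h < d -> cn (e (z + h) - e z - lin p h) <= eps * vn h.

Definition sdiff e z := exists p, sdiff_at e z p.

Lemma sdiff_lip e z : sdiff e z -> exists2 L : R, 0 <= L & exists2 d : R, 0 < d &
  forall h, vn h < d -> cn (e (z + h) - e z) <= L * vn h.
Proof.
move=> [p /(_ 1 ltr01)[d d0 hd]]; exists (1 + \sum_i cn (p i)).
  by rewrite addr_ge0// sumr_ge0// => i _; exact: cn_ge0.
exists d => // h /hd; rewrite mulrDl; have := lin_le p h => h1 h2.
rewrite (_ : _ - _ = (e (z + h) - e z - lin p h) + lin p h); last by rewrite subrK.
by apply: le_trans (cnD _ _) _; exact: lerD.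
Qed.

Lemma sdiff_cst a z : sdiff (fun=> a) z.
Proof.
exists (fun=> 0) => eps eps0; exists 1 => // h _.
rewrite /lin big1 ?subr0 ?subrr ?cn0 ?mulr_ge0 ?vn_ge0// ?ltW// => i _.
by rewrite mulr0.
Qed.

Lemma sdiff_coord i z : sdiff (fun z => z 0 i) z.
Proof.
exists (fun j => (i == j)%:R) => eps eps0; exists 1 => // h _.
rewrite /lin (bigD1 i)//= eqxx mulr1 big1 => [|j].
  rewrite addr0 mxE (_ : _ - _ - _ = 0) ?cn0; last by ring.
  by rewrite mulr_ge0 ?vn_ge0// ltW.
by rewrite eq_sym => /negbTE ->; rewrite mulr0.
Qed.

Lemma sdiff_ext e f z (r : R) : 0 < r ->
  (forall h, vn h < r -> e (z + h) = f (z + h)) -> sdiff e z -> sdiff f z.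
Proof.
move=> r0 ef [p hp]; exists p => eps /hp[d d0 hd].
exists (Num.min d r); first by rewrite lt_min d0.
move=> h; rewrite lt_min => /andP[/hd h1 h2].
by rewrite -ef// -{2}(addr0 z) -ef ?vn0// addr0.
Qed.

Lemma sdiffD e f z : sdiff e z -> sdiff f z -> sdiff (fun z => e z + f z) z.
Proof.
move=> [p hp] [q hq]; exists (fun i => p i + q i) => eps eps0.
have e2 : 0 < eps / 2 by rewrite divr_gt0.
have [d1 d10 h1] := hp _ e2; have [d2 d20 h2] := hq _ e2.
exists (Num.min d1 d2); first by rewrite lt_min d10.
move=> h; rewrite lt_min => /andP[/h1 k1 /h2 k2].
rewrite (_ : lin _ h = lin p h + lin q h); last first.
  by rewrite /lin -big_split; apply: eq_bigr => i _; rewrite mulrDr.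
rewrite (_ : _ - _ - _ = (e (z + h) - e z - lin p h) + (f (z + h) - f z - lin q h)).
  by apply: le_trans (cnD _ _) _; lra.
by ring.
Qed.

Definition vdiff (F : V -> V) z := forall i, sdiff (fun z => F z 0 i) z.

Lemma vdiff_lip (F : V -> V) z : vdiff F z -> exists2 L : R, 0 <= L &
  exists2 d : R, 0 < d & forall h, vn h < d -> vn (F (z + h) - F z) <= L * vn h.
Proof.
move=> hF.
have /choice[Ld hLd] : forall i, exists Ld : R * R, [/\ 0 <= Ld.1, 0 < Ld.2 &
    forall h, vn h < Ld.2 -> cn (F (z + h) 0 i - F z 0 i) <= Ld.1 * vn h].
  by move=> i; have [L L0 [d d0 h]] := sdiff_lip (hF i); exists (L, d).
exists (\big[Num.max/0]_i (Ld i).1); first exact: bigmax_ge_id.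
exists (\big[Num.min/1]_i (Ld i).2).
  by apply/bigmin_gtP; split => // i _; have [] := hLd i.
move=> h /bigmin_gtP[_ hh]; apply: vn_le => [|i].
  by rewrite mulr_ge0 ?vn_ge0// bigmax_ge_id.
rewrite !mxE; have [_ _ /(_ _ (hh i isT)) h1] := hLd i.
apply: le_trans h1 _; rewrite ler_wpM2r ?vn_ge0//.
exact: (le_bigmax _ (fun i => (Ld i).1)).
Qed.

Lemma vdiff_cont (F : V -> V) z : vdiff F z -> forall eps : R, 0 < eps ->
  exists2 d : R, 0 < d & forall w, vn (w - z) < d -> vn (F w - F z) < eps.
Proof.
move=> /vdiff_lip[L L0 [d d0 h]] eps eps0; have L1 : 0 < L + 1 by lra.
exists (Num.min d (eps / (L + 1))); first by rewrite lt_min d0 divr_gt0.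
move=> w; rewrite lt_min ltr_pdivlMr// => /andP[/h]; rewrite subrKC => h1 h2.
by apply: le_lt_trans h1 _; have := vn_ge0 (w - z); nra.
Qed.

Lemma sdiff_comp e (F : V -> V) z : sdiff e (F z) -> vdiff F z ->
  sdiff (fun z => e (F z)) z.
Proof.
move=> [p hp] hF; have [L L0 [d0 d00 hL]] := vdiff_lip hF.
have /choice[q hq] := hF.
exists (fun j => \sum_i p i * q i j) => eps eps0.
pose P := \sum_i cn (p i); have P0 : 0 <= P by rewrite sumr_ge0// => i _; exact: cn_ge0.
have e1 : 0 < eps / (2 * (L + 1)) by rewrite divr_gt0//; lra.
have e2 : 0 < eps / (2 * (P + 1)) by rewrite divr_gt0//; lra.
have [d1 d10 h1] := hp _ e1.
have /choice[d2 hd2] : forall i, exists d : R, 0 < d /\ forall h, vn h < d ->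
    cn (F (z + h) 0 i - F z 0 i - lin (q i) h) <= eps / (2 * (P + 1)) * vn h.
  by move=> i; have [d dd hd] := hq i _ e2; exists d.
exists (Num.min (Num.min d0 (d1 / (L + 1))) (\big[Num.min/1]_i d2 i)).
  rewrite !lt_min d00 divr_gt0//=; last by lra.
  by apply/bigmin_gtP; split => // i _; have [] := hd2 i.
move=> h; rewrite !lt_min => /andP[/andP[h2 h3] /bigmin_gtP[_ h4]].
have k0 := hL _ h2; have v0 := vn_ge0 h.
rewrite ltr_pdivlMr in h3; last by lra.
have k1 := h1 (F (z + h) - F z) (_ : _); rewrite subrKC in k1.
have {}k1 : cn (e (F (z + h)) - e (F z) - lin p (F (z + h) - F z)) <= eps / 2 * vn h.
  apply: le_trans (k1 _) _; first by apply: le_lt_trans k0 _; nra.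
  apply: le_trans (_ : eps / (2 * (L + 1)) * (L * vn h) <= _).
    by rewrite ler_wpM2l// ltW.
  rewrite (_ : _ * (L * _) = eps / 2 * (vn h * (L / (L + 1)))); last first.
    by field; rewrite gt_eqF//; lra.
  rewrite ler_wpM2l//; first by lra.
  by rewrite ler_piMr// ler_pdivrMr; lra.
rewrite (_ : _ - lin _ h = (e (F (z + h)) - e (F z) - lin p (F (z + h) - F z))
   + \sum_i (F (z + h) 0 i - F z 0 i - lin (q i) h) * p i); last first.
  under [X in _ = _ + X]eq_bigr do rewrite mulrBl.
  rewrite sumrB (_ : \sum_i (F (z + h) 0 i - F z 0 i) * p i = lin p (F (z + h) - F z)).
    rewrite (_ : \sum_i lin (q i) h * p i = lin (fun j => \sum_i p i * q i j) h).
      by ring.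
    rewrite /lin; under eq_bigr do rewrite mulr_suml.
    rewrite exchange_big; apply: eq_bigr => i _; rewrite mulr_sumr.
    by apply: eq_bigr => j _; ring.
  by apply: eq_bigr => i _; rewrite !mxE.
apply: le_trans (cnD _ _) _.
have k2 : cn (\sum_i (F (z + h) 0 i - F z 0 i - lin (q i) h) * p i) <= eps / 2 * vn h.
  apply: le_trans (cn_sum _ _ _) _.
  apply: le_trans (_ : \sum_i (eps / (2 * (P + 1)) * vn h) * cn (p i) <= _).
    apply: ler_sum => i _; rewrite cnM ler_wpM2r ?cn_ge0//.
    by apply: (hd2 i).2; exact: h4.
  rewrite -mulr_sumr -/P.
  rewrite (_ : _ * P = eps / 2 * (vn h * (P / (P + 1)))); last first.
    by field; rewrite gt_eqF//; lra.
  rewrite ler_wpM2l//; first by lra.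
  by rewrite ler_piMr// ler_pdivrMr; lra.
lra.
Qed.

Lemma is_cder_line e c u t p : sdiff_at e (c + t *: u) p ->
  is_cder (fun s => e (c + s *: u)) t (lin p u).
Proof.
move=> hp eps eps0.
have u0 := vn_ge0 u; have u1 : 0 < vn u + 1 by lra.
have [d d0 hd] := hp _ (divr_gt0 eps0 u1).
exists (d / (vn u + 1)); first by rewrite divr_gt0.
move=> s; rewrite ltr_pdivlMr// => hs; have s0 := cn_ge0 s.
have hs' : vn (s *: u) < d by rewrite vnZ; nra.
have := hd _ hs'; rewrite linZ vnZ -[c + t *: u + _]addrA -scalerDl => /le_trans; apply.
rewrite (_ : _ * (cn s * _) = eps * cn s * (vn u / (vn u + 1))); last first.
  by field; rewrite gt_eqF.
by rewrite ler_piMr ?mulr_ge0 ?(ltW eps0)// ler_pdivrMr// mul1r; lra.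
Qed.

Lemma sdiffM e f z : sdiff e z -> sdiff f z -> sdiff (fun z => e z * f z) z.
Proof.
move=> he hf; have [L L0 [d0 d00 hL]] := sdiff_lip he.
have [L' L'0 [d0' d0'0 hL']] := sdiff_lip hf.
case: he hf => [p hp] [q hq].
exists (fun i => p i * f z + e z * q i) => eps eps0.
pose K := cn (f z) + cn (e z) + 1.
have c1 := cn_ge0 (f z); have c2 := cn_ge0 (e z).
have K0 : 0 < K by rewrite /K; lra.
have e1 : 0 < eps / (2 * K) by rewrite divr_gt0// mulr_gt0.
have [d1 d10 h1] := hp _ e1; have [d2 d20 h2] := hq _ e1.
have LL : 0 < 2 * (L * L' + 1) by have := mulr_ge0 L0 L'0; lra.
exists (Num.min (Num.min (Num.min d0 d0') (Num.min d1 d2)) (eps / (2 * (L * L' + 1)))).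
  by rewrite !lt_min d00 d0'0 d10 d20 divr_gt0.
move=> h; rewrite !lt_min => /andP[/andP[/andP[/hL k1 /hL' k2] /andP[/h1 k3 /h2 k4]]].
rewrite ltr_pdivlMr// => k5; have v0 := vn_ge0 h.
rewrite (_ : lin _ h = lin p h * f z + e z * lin q h); last first.
  by rewrite /lin mulr_suml mulr_sumr -big_split; apply: eq_bigr => i _ /=; ring.
rewrite (_ : _ - _ - _ = (e (z + h) - e z - lin p h) * f z
   + e z * (f (z + h) - f z - lin q h)
   + (e (z + h) - e z) * (f (z + h) - f z)); last by ring.
apply: le_trans (cnD _ _) _; apply: le_trans (lerD (cnD _ _) (lexx _)) _; rewrite !cnM.
have m1 := ler_wpM2r c1 k3; have m2 := ler_wpM2l c2 k4.
have m3 := ler_pM (cn_ge0 _) (cn_ge0 _) k1 k2.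
apply: le_trans (lerD (lerD m1 m2) m3) _.
have n1 : eps / (2 * K) * vn h * cn (f z) + cn (e z) * (eps / (2 * K) * vn h)
    <= eps / 2 * vn h.
  rewrite (_ : _ + _ = eps / 2 * vn h * ((cn (f z) + cn (e z)) / K)); last first.
    by field; rewrite gt_eqF.
  rewrite ler_piMr//; first by rewrite mulr_ge0//; lra.
  by rewrite ler_pdivrMr// mul1r /K; lra.
have n2 : L * vn h * (L' * vn h) <= eps / 2 * vn h.
  rewrite (_ : _ * (L' * _) = (L * L' * vn h) * vn h); last by ring.
  by rewrite ler_wpM2r//; have := mulr_ge0 L0 L'0; nra.
lra.
Qed.

Lemma sdiff_sum (I : Type) (s : seq I) (g : I -> V -> C) z :
  (forall i, sdiff (g i) z) -> sdiff (fun z => \sum_(i <- s) g i z) z.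
Proof.
move=> hg; elim: s => [|i s IH].
  by apply: (@sdiff_ext (fun=> 0) _ _ 1) => [//|h _|]; [rewrite big_nil|exact: sdiff_cst].
apply: (@sdiff_ext (fun z => g i z + \sum_(j <- s) g j z) _ _ 1) => [//|h _|].
  by rewrite big_cons.
exact: sdiffD.
Qed.

Lemma sdiffZ a e z : sdiff e z -> sdiff (fun z => a * e z) z.
Proof. by move=> h; apply: sdiffM => //; exact: sdiff_cst. Qed.

Lemma sdiffB e f z : sdiff e z -> sdiff f z -> sdiff (fun z => e z - f z) z.
Proof.
move=> he hf; apply: (@sdiff_ext (fun z => e z + (-1) * f z) _ _ 1) => [//|h _|].
  by rewrite mulN1r.
by apply: sdiffD => //; exact: sdiffZ.
Qed.

Lemma holo_line e z u (r : R) : vn u <= 1 ->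
  (forall w, vn (w - z) < r -> sdiff e w) -> holo (fun s => e (z + s *: u)) 0 r.
Proof.
move=> u1 h t; rewrite subr0 => ht.
have [|p hp] := h (z + t *: u); last by exists (lin p u); exact: is_cder_line.
rewrite addrC addKr vnZ; have := cn_ge0 t; have := vn_ge0 u; nra.
Qed.

Lemma bounded_line e z u (r M : R) : vn u <= 1 ->
  (forall w, vn (w - z) < r -> cn (e w) <= M) ->
  bounded_on (fun s => e (z + s *: u)) 0 r M.
Proof.
move=> u1 h t; rewrite subr0 => ht; apply: h.
rewrite addrC addKr vnZ; have := cn_ge0 t; have := vn_ge0 u; nra.
Qed.

Lemma vn_delta i : vn (delta_mx 0 i : V) <= 1.
Proof. by apply: vn_le => // j; rewrite mxE eqxx /= cn_nat; case: eqP. Qed.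

Lemma lin_delta p i : lin p (delta_mx 0 i) = p i.
Proof.
rewrite /lin (bigD1 i)//= mxE !eqxx mul1r big1 ?addr0// => j /negbTE ji.
by rewrite mxE ji andbF mul0r.
Qed.

Lemma clim_sum (I : Type) (s : seq I) (g : I -> nat -> C) (l : I -> C) :
  (forall i, clim (g i) (l i)) -> clim (fun n => \sum_(i <- s) g i n) (\sum_(i <- s) l i).
Proof.
move=> hg; elim: s => [|i s IH].
  by apply: eq_clim (clim_cst _) => n; rewrite !big_nil.
rewrite big_cons; apply: eq_clim (climD (hg i) IH) => n; by rewrite big_cons.
Qed.

(** The first order expansions converge along the complex lines through z, with
    remainders bounded uniformly in the direction. *)
Lemma sdiff_lim (g : nat -> V -> C) e z (r M : R) : 0 < r ->
  (forall n w, vn (w - z) < r -> sdiff (g n) w) ->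
  (forall n w, vn (w - z) < r -> cn (g n w) <= M) ->
  (forall w, vn (w - z) < r -> clim (fun n => g n w) (e w)) -> sdiff e z.
Proof.
move=> r0 hd hb hl; have zz : vn (z - z) < r by rewrite subrr vn0.
have /choice[p hp] : forall n, exists p, sdiff_at (g n) z p by move=> n; exact: hd.
have hline u w : vn u <= 1 -> cn w < r -> vn (z + w *: u - z) < r.
  move=> u1 hw; rewrite addrC addKr vnZ; have := vn_ge0 u; have := cn_ge0 w; nra.
have /choice[q hq] : forall i, exists l, clim (fun n => p n i) l.
  move=> i; have u1 := vn_delta i.
  have [||t||l _ hl'] := @montel _ (fun n s => g n (z + s *: delta_mx 0 i))
    (fun s => e (z + s *: delta_mx 0 i)) 0 r M (fun n => lin (p n) (delta_mx 0 i)) r0.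
  - by move=> n; apply: holo_line => // w; exact: hd.
  - by move=> n; apply: bounded_line => // w; exact: hb.
  - by rewrite subr0 => ht; apply: hl; exact: hline.
  - by move=> n; apply: is_cder_line; rewrite scale0r addr0.
  - by exists l; apply: eq_clim hl' => n; rewrite lin_delta.
exists q => eps eps0; have M0 : 0 <= M by exact: le_trans (cn_ge0 _) (hb 0%N _ zz).
pose K := 6 * M / r ^+ 2.
have K0 : 0 <= K by apply: divr_ge0; [rewrite mulr_ge0|rewrite exprn_ge0// ltW].
have K1 : 0 < K + 1 by lra.
exists (Num.min (r / 2) (eps / (K + 1))); first by rewrite !lt_min !divr_gt0.
move=> h; rewrite lt_min => /andP[h1 h2]; rewrite ltr_pdivlMr// in h2.
have [h0|h0] := eqVneq (vn h) 0.
  have /eqP -> : h == 0 by rewrite -vn_eq0 h0.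
  by rewrite addr0 subrr /lin big1 ?subr0 ?cn0 ?vn0 ?mulr0// => i _; rewrite mxE mul0r.
have hv : 0 < vn h by rewrite lt_def h0 vn_ge0.
pose s := rc (vn h); pose u := s^-1 *: h.
have cs : cn s = vn h by rewrite cn_rc gtr0_norm.
have s0 : s != 0 by rewrite -cn_gt0 cs.
have su : s *: u = h by rewrite /u scalerA divff// scale1r.
have u1 : vn u <= 1 by rewrite vnZ cnV cs mulVf ?gt_eqF.
have hc : clim (fun n => g n (z + h) - g n z - lin (p n) h) (e (z + h) - e z - lin q h).
  have h3 : vn (z + h - z) < r by rewrite addrC addKr; lra.
  apply: climB (climB (hl _ h3) (hl _ zz)) _.
  by apply: clim_sum => i; apply: climZ.
apply: le_trans (_ : K * vn h ^+ 2 <= _).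
  apply: (clim_le hc); exists 0%N => n _.
  have := @second_order _ (fun s => g n (z + s *: u)) 0 r M (lin (p n) u) s r0.
  rewrite scale0r addr0 add0r su cs -linZ su; apply; last by lra.
  - by apply: holo_line => // w; exact: hd.
  - by apply: bounded_line => // w; exact: hb.
  - by apply: is_cder_line; rewrite scale0r addr0.
by rewrite expr2; nra.
Qed.

(** Cauchy's estimate for the modulus of continuity. *)
Lemma sdiff_lipschitz e z (r M : R) w : 0 < r ->
  (forall w, vn (w - z) < r -> sdiff e w) ->
  (forall w, vn (w - z) < r -> cn (e w) <= M) ->
  vn (w - z) < r -> cn (e w - e z) <= 4 * M / r * vn (w - z).
Proof.
move=> r0 hd hb hw; have [h0|h0] := eqVneq (vn (w - z)) 0.
  have /eqP : w - z == 0 by rewrite -vn_eq0 h0.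
  by move=> /eqP; rewrite subr_eq0 => /eqP ->; rewrite !subrr cn0 vn0 mulr0.
have hv : 0 < vn (w - z) by rewrite lt_def h0 vn_ge0.
pose s := rc (vn (w - z)); pose u := s^-1 *: (w - z).
have cs : cn s = vn (w - z) by rewrite cn_rc gtr0_norm.
have s0 : s != 0 by rewrite -cn_gt0 cs.
have su : z + s *: u = w by rewrite /u scalerA divff// scale1r addrC subrK.
have u1 : vn u <= 1 by rewrite vnZ cnV cs mulVf ?gt_eqF.
have := @schwarz _ (fun s => e (z + s *: u)) 0 r M s r0.
rewrite scale0r addr0 add0r su cs; apply => //.
- exact: holo_line.
- exact: bounded_line.
Qed.

End Vectors.

(** * Taylor polynomials *)

Section Jets.
Context {R : realType} {k : nat}.
Local Notation C := (Cplx R).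
Local Notation V := (Ck R k).
Implicit Types (z h u : V) (e f : V -> C) (i j : 'I_k) (w : seq 'I_k) (x y : seq 'I_k -> C).

Definition upd z i (t : C) : V := \row_j (if j == i then t else z 0 j).

Definition trunc (n : nat) z : V := \row_j (if (j < n)%N then 0 else z 0 j).

(** Holomorphy in each variable separately, with a bound, suffices for Taylor's
    formula and is easily shown to be stable under division by a coordinate. *)
Definition sep (M : R) e :=
  (forall z, vn z < 1 -> cn (e z) <= M) /\
  (forall z i, vn z < 1 -> holo (fun t => e (upd z i t)) 0 1).

Lemma upd_id z i : upd z i (z 0 i) = z.
Proof. by apply/rowP => j; rewrite mxE; case: eqP => [->|]. Qed.

Lemma upd_upd z i s t : upd (upd z i s) i t = upd z i t.
Proof. by apply/rowP => j; rewrite !mxE; case: eqP. Qed.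

Lemma upd_slice e z i s : (fun t => e (upd (upd z i s) i t)) = (fun t => e (upd z i t)).
Proof. by apply/funext => t; rewrite upd_upd. Qed.

Lemma updC z i j s t : i != j -> upd (upd z i s) j t = upd (upd z j t) i s.
Proof.
move=> ij; apply/rowP => l; rewrite !mxE.
by case: (eqVneq l j) => [->|//]; rewrite eq_sym (negbTE ij).
Qed.

Lemma upd_at z i t : upd z i t 0 i = t.
Proof. by rewrite mxE eqxx. Qed.

Lemma upd_off z i j t : i != j -> upd z i t 0 j = z 0 j.
Proof. by move=> ij; rewrite mxE eq_sym (negbTE ij). Qed.

Lemma vn_upd z i t : vn z < 1 -> cn t < 1 -> vn (upd z i t) < 1.
Proof.
move=> hz ht; apply: vn_lt => // j; rewrite mxE; case: eqP => // _.
exact: le_lt_trans (cn_le_vn _ _) hz.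
Qed.

Lemma vn_trunc n z : vn (trunc n z) <= vn z.
Proof.
apply: vn_le => [|j]; first exact: vn_ge0.
by rewrite mxE; case: ifP => _; rewrite ?cn0 ?vn_ge0 ?cn_le_vn.
Qed.

Lemma trunc0 z : trunc 0 z = z.
Proof. by apply/rowP => j; rewrite mxE. Qed.

Lemma trunc_all z : trunc k z = 0.
Proof. by apply/rowP => j; rewrite !mxE ltn_ord. Qed.

Lemma trunc_id n z : trunc n (trunc n z) = trunc n z.
Proof. by apply/rowP => j; rewrite !mxE; case: (j < n)%N. Qed.

Lemma truncS (i : 'I_k) z : trunc i.+1 z = upd (trunc i z) i 0.
Proof.
apply/rowP => j; rewrite !mxE ltnS leq_eqVlt; case: (eqVneq j i) => [->|ji].
  by rewrite eqxx.
by rewrite (_ : (j == i :> nat) = false)//; apply/negbTE.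
Qed.

Lemma trunc_upd_lt n z i t : (i < n)%N -> trunc n (upd z i t) = trunc n z.
Proof.
move=> hi; apply/rowP => j; rewrite !mxE; case: ifP => // hj.
by case: eqP => // ji; rewrite ji hi in hj.
Qed.

Lemma trunc_upd_ge n z i t : (n <= i)%N -> trunc n (upd z i t) = upd (trunc n z) i t.
Proof.
move=> hi; apply/rowP => j; rewrite !mxE; case: (eqVneq j i) => [->|//].
by rewrite ltnNge hi.
Qed.

Lemma holo_cst (a c : C) (r : R) : holo (fun=> a) c r.
Proof. by move=> t _; exists 0; exact: is_cder_cst. Qed.

Lemma sep_trunc M e n : sep M e -> sep M (fun z => e (trunc n z)).
Proof.
case=> hb hh; split=> [z hz|z i hz].
  by apply: hb; exact: le_lt_trans (vn_trunc _ _) hz.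
have ht : vn (trunc n z) < 1 := le_lt_trans (vn_trunc n z) hz.
have [hi|hi] := ltnP i n.
  rewrite (_ : (fun t => _) = fun=> e (trunc n z)); first exact: holo_cst.
  by apply/funext => t; rewrite trunc_upd_lt.
rewrite (_ : (fun t => _) = fun t => e (upd (trunc n z) i t)); first exact: hh.
by apply/funext => t; rewrite trunc_upd_ge.
Qed.

Definition der0 (phi : C -> C) : C := xget 0 [set a | is_cder phi 0 a].

Lemma der0P phi : holo phi 0 1 -> is_cder phi 0 (der0 phi).
Proof.
move=> h; rewrite /der0; case: xgetP => [a -> //|na].
by have [|a ha] := h 0; [rewrite subrr cn0|case: (na a)].
Qed.

Definition dq i e z : C :=
  dquot (fun t => e (upd z i t)) (der0 (fun t => e (upd z i t))) (z 0 i).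

Lemma dqE i e z : e z = e (upd z i 0) + z 0 i * dq i e z.
Proof.
by have := dquotE (fun t => e (upd z i t)) (der0 (fun t => e (upd z i t))) (z 0 i); rewrite upd_id.
Qed.

Lemma sep_bounded M e z i : sep M e -> vn z < 1 ->
  bounded_on (fun t => e (upd z i t)) 0 1 M.
Proof. by move=> [hb _] hz t; rewrite subr0 => ht; apply: hb; exact: vn_upd. Qed.

(** Where the coordinate that is divided by vanishes, the quotient is a limit of
    bounded quotients, whence its holomorphy in the other variables.  The constant
    is that of Schwarz's lemma. *)
Lemma sep_dq M e i : sep M e -> sep (4 * M) (dq i e).
Proof.
move=> he; have [hb hh] := he; split=> [z hz|z j hz].
  apply: dquot_le; [exact: hh|exact: (sep_bounded i he hz)|exact: der0P (hh _ _ hz)|].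
  exact: le_lt_trans (cn_le_vn _ _) hz.
have [<-|ij] := eqVneq i j.
  pose phi t := e (upd z i t).
  have -> : (fun t => dq i e (upd z i t)) = dquot phi (der0 phi).
    apply/funext => t; rewrite /dq upd_at.
    by rewrite upd_slice.
  apply: dquot_holo; [exact: hh|exact: (sep_bounded i he hz)|exact: der0P (hh _ _ hz)].
have off (s : C) : s != 0 -> cn s < 1 ->
    holo (fun t => dq i e (upd (upd z i s) j t)) 0 1.
  move=> s0 s1 t ht; have [a ha] := hh _ j (vn_upd i hz s1) t ht.
  have hz0 : vn (upd z i 0) < 1 by apply: vn_upd => //; rewrite cn0.
  have [b hb'] := hh _ j hz0 t ht.
  have -> : (fun t => dq i e (upd (upd z i s) j t)) = (fun t =>
      s^-1 * (e (upd (upd z i s) j t) + (-1) * e (upd (upd z i 0) j t))).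
    apply/funext => r; rewrite (dqE i e (upd (upd z i s) j r)).
    rewrite upd_off 1?eq_sym// upd_at.
    have -> : upd (upd (upd z i s) j r) i 0 = upd (upd z i 0) j r.
      by rewrite (updC _ s r ij) upd_upd -(updC _ 0 r ij).
    by field.
  by eexists; exact: (is_cderZ _ (is_cderD ha (is_cderZ _ hb'))).
have [z0|z0] := eqVneq (z 0 i) 0; last first.
  by rewrite -{1}(upd_id z i); apply: off => //; exact: le_lt_trans (cn_le_vn _ _) hz.
pose tn (n : nat) : R := n.+2%:R^-1.
have tn0 n : 0 < tn n by rewrite invr_gt0.
have tn1 n : cn (rc (tn n)) < 1.
  by rewrite cn_rc gtr0_norm// invf_lt1 ?ltr1n.
apply: (@holo_lim _ (fun n t => dq i e (upd (upd z i (rc (tn n))) j t)) _ _ _ (4 * M)).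
- by move=> n; apply: off => //; rewrite -cn_gt0 cn_rc gtr0_norm.
- move=> n t; rewrite subr0 => ht.
  have hz' : vn (upd (upd z i (rc (tn n))) j t) < 1 by apply: vn_upd => //; exact: vn_upd.
  apply: dquot_le; [exact: hh|exact: (sep_bounded i he hz')|exact: der0P (hh _ _ hz')|].
  exact: le_lt_trans (cn_le_vn _ _) hz'.
- move=> t; rewrite subr0 => ht; pose y := upd z j t; pose phi s := e (upd y i s).
  have hy : vn y < 1 by exact: vn_upd.
  have -> : dq i e y = dquot phi (der0 phi) 0.
    by rewrite /dq /y upd_off 1?eq_sym// z0.
  rewrite /dquot eqxx.
  have E n : dq i e (upd (upd z i (rc (tn n))) j t) = (phi (rc (tn n)) - phi 0) / rc (tn n).
    rewrite (updC _ _ _ ij) -/y /dq upd_at.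
    rewrite upd_slice /dquot ifF//; apply/negbTE; by rewrite -cn_gt0 cn_rc gtr0_norm.
  move=> eps eps0; have e2 : 0 < eps / 2 by rewrite divr_gt0.
  have [d d0 hd] := der0P (hh _ i hy) e2.
  have [n0 hn0] : exists n0, forall n, (n0 <= n)%N -> tn n < d.
    exists (Num.truncn d^-1) => n hn; rewrite /tn -[ltRHS]invrK ltf_pV2 ?posrE ?invr_gt0//.
    apply: lt_le_trans (truncnS_gt _) _; rewrite ler_nat ltnS.
    exact: leq_trans hn (leqnSn _).
  exists n0 => n /hn0 hn; rewrite E.
  have cr : cn (rc (tn n)) = tn n by rewrite cn_rc gtr0_norm.
  have := hd (rc (tn n)); rewrite cr add0r => /(_ hn) h1.
  have r0 : rc (tn n) != 0 by rewrite -cn_gt0 cr.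
  rewrite (_ : _ - _ = (phi (rc (tn n)) - phi 0 - rc (tn n) * der0 phi) / rc (tn n)).
    by rewrite cn_div cr ltr_pdivrMr//; have := tn0 n; nra.
  by field.
Qed.

(** Hadamard's lemma: the coordinates are set to zero one after the other. *)
Lemma hadamard M e n : sep M e -> (forall z, e z = e (trunc n z)) -> (n <= k)%N ->
  forall z, e z = e 0 + \sum_(i < k | (n <= i)%N) z 0 i * dq i e (trunc i z).
Proof.
move=> he hn nk z; rewrite hn.
have H m : (m <= k)%N -> e (trunc (k - m) z) =
    e 0 + \sum_(i < k | (k - m <= i)%N) z 0 i * dq i e (trunc i z).
  elim: m => [|m IH] hm.
    rewrite subn0 trunc_all big1 ?addr0// => i; by rewrite leqNgt ltn_ord.
  pose i : 'I_k := Ordinal (_ : k - m.+1 < k)%N.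
  have hi : (k - m.+1 < k)%N by rewrite ltn_subrL (leq_trans _ hm).
  have ki : (k - m)%N = (k - m.+1).+1 by rewrite subnSK.
  rewrite (dqE (Ordinal hi)) -(@truncS (Ordinal hi)) /= -ki IH 1?ltnW//.
  rewrite -addrA; congr (_ + _); rewrite [RHS](bigD1 (Ordinal hi))//= addrC.
  congr (_ + _); first by rewrite mxE /= ltnn.
  apply: eq_bigl => j; rewrite ki ltn_neqAle andbC; congr (_ && _).
  by rewrite -val_eqE eq_sym.
by have := H (k - n)%N (leq_subr _ _); rewrite subKn.
Qed.

Definition mon w z : C := \prod_(i <- w) z 0 i.

(** The sorted words of length at most d in letters from n on, which stand for
    the monomials of degree at most d in these coordinates. *)
Fixpoint swords (d n : nat) : seq (seq 'I_k) :=
  if d is d'.+1 then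
    [::] :: [seq i :: w | i <- [seq i : 'I_k <- enum 'I_k | (n <= i)%N], w <- swords d' i]
  else [:: [::]].

(** Hadamard's lemma, applied to its own quotients.  The quotient by the i-th
    coordinate depends on the coordinates from i on only, and so the words that
    arise are sorted. *)
Lemma taylor d n M e : sep M e -> (forall z, e z = e (trunc n z)) -> (n <= k)%N ->
  exists a : seq 'I_k -> C, [/\ a [::] = e 0, forall w, cn (a w) <= 4 ^+ d * M &
    forall z, vn z < 1 ->
      cn (e z - \sum_(w <- swords d n) a w * mon w z)
        <= (4 * k%:R) ^+ d.+1 * M * vn z ^+ d.+1].
Proof.
elim: d n M e => [|d IH] n M e he hn nk.
  have M0 : 0 <= M by apply: le_trans (cn_ge0 _) (he.1 0 _); rewrite vn0.
  exists (fun=> e 0); split => // [w|z hz].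
    by rewrite expr0 mul1r; apply: he.1; rewrite vn0.
  rewrite big_seq1 /mon big_nil mulr1 (hadamard he hn nk z) addrC addKr !expr1.
  apply: le_trans (cn_sum _ _ _) _.
  apply: le_trans (_ : \sum_(i < k) 4 * M * vn z <= _); last first.
    by rewrite sumr_const card_ord -(mulr_natr (_ * vn z)); lra.
  rewrite big_mkcond; apply: ler_sum => i _; case: ifP => _; last first.
    by rewrite mulr_ge0 ?vn_ge0// mulr_ge0.
  rewrite cnM mulrC; apply: ler_pM; rewrite ?cn_ge0 ?cn_le_vn//.
  by apply: (sep_dq i he).1; exact: le_lt_trans (vn_trunc _ _) hz.
have M0 : 0 <= M by apply: le_trans (cn_ge0 _) (he.1 0 _); rewrite vn0.
have /choice[a ha] : forall i : 'I_k, exists a : seq 'I_k -> C,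
    (forall w, cn (a w) <= 4 ^+ d * (4 * M)) /\
    forall z, vn z < 1 ->
      cn (dq i e (trunc i z) - \sum_(w <- swords d i) a w * mon w z)
        <= (4 * k%:R) ^+ d.+1 * (4 * M) * vn z ^+ d.+1.
  move=> i; have [//|||a [_ h1 h2]] := IH i (4 * M) (fun z => dq i e (trunc i z)).
  - exact/sep_trunc/sep_dq.
  - by move=> z; rewrite trunc_id.
  - exact: ltnW.
  - by exists a.
exists (fun w => if w is i :: w' then a i w' else e 0); split => // [[|i w]|z hz].
- rewrite -[leLHS]mul1r; apply: ler_pM; rewrite ?cn_ge0 ?ler01//.
    by rewrite exprn_ege1// ler1n.
  by apply: he.1; rewrite vn0.
- by have := (ha i).1 w; rewrite mulrA -exprSr.
rewrite /= big_cons /mon big_nil mulr1 (hadamard he hn nk z) opprD addrACA subrr add0r.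
rewrite big_allpairs_dep big_filter big_enum_cond /= -sumrB.
rewrite (eq_bigr (fun i => z 0 i *
  (dq i e (trunc i z) - \sum_(w <- swords d i) a i w * mon w z))); last first.
  move=> i _; rewrite mulrBr mulr_sumr; congr (_ - _); apply: eq_bigr => w _.
  by rewrite /mon big_cons mulrCA.
apply: le_trans (cn_sum _ _ _) _.
pose B := vn z * ((4 * k%:R) ^+ d.+1 * (4 * M) * vn z ^+ d.+1).
have B0 : 0 <= B.
  by rewrite !mulr_ge0 ?vn_ge0 ?exprn_ge0 ?vn_ge0// mulr_ge0.
apply: le_trans (_ : \sum_(i < k) B <= _); last first.
  rewrite sumr_const card_ord -(mulr_natr B) /B.
  by rewrite (exprS (4 * k%:R) d.+1) (exprS (vn z) d.+1) le_eqVlt; apply/orP; left; apply/eqP; ring.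
rewrite big_mkcond; apply: ler_sum => i _; case: ifP => _ //.
by rewrite cnM; apply: ler_pM; rewrite ?cn_ge0 ?cn_le_vn//; exact: (ha i).2.
Qed.

Lemma swords_sorted d n w : w \in swords d n ->
  sorted (fun i j : 'I_k => (i <= j)%N) w && all (fun i : 'I_k => (n <= i)%N) w
  && (size w <= d)%N.
Proof.
elim: d n w => [|d IH] n w; first by rewrite inE => /eqP ->.
rewrite inE => /orP[/eqP -> //|/allpairsPdep[i [w' [hi hw ->]]]].
move: hi; rewrite mem_filter => /andP[hi _].
have /andP[/andP[h1 h2] h3] := IH _ _ hw.
rewrite /= hi /= ltnS h3 andbT; apply/andP; split.
  rewrite path_min_sorted//.
by apply/allP => j /(allP h2); exact: leq_trans.
Qed.

Lemma swords_uniq d n : uniq (swords d n).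
Proof.
elim: d n => [//|d IH] n /=; apply/andP; split.
  by apply/negP => /allpairsPdep[i [w' [_ _ h]]].
apply: allpairs_uniq_dep.
- by rewrite filter_uniq// enum_uniq.
- by move=> i _; exact: IH.
- by move=> [i1 w1] [i2 w2] _ _ /= [-> ->].
Qed.

Lemma mon_count w z : mon w z = \prod_i z 0 i ^+ count_mem i w.
Proof.
elim: w => [|j w IH]; first by rewrite /mon big_nil big1.
rewrite /mon big_cons -/(mon w z) IH (bigD1 j)//= [RHS](bigD1 j)//= mulrA.
congr (_ * _); first by rewrite eqxx add1n exprS.
by apply: eq_bigr => i /negbTE ij; rewrite eq_sym ij.
Qed.

Lemma swords_count d w w' : w \in swords d 0 -> w' \in swords d 0 ->
  (forall i, count_mem i w = count_mem i w') -> w = w'.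
Proof.
move=> /swords_sorted/andP[/andP[h _] _] /swords_sorted/andP[/andP[h' _] _] hc.
have := @sorted_eq _ (fun i j : 'I_k => (i <= j)%N) (fun a b c => @leq_trans a b c).
apply => //; first by move=> a b hab; apply/val_inj/anti_leq.
by apply/allP => i _ /=; rewrite hc.
Qed.

(** The coefficients of a polynomial are averages over tori of radius r, and r
    tends to zero. *)
Lemma jet_zero d (a : seq 'I_k -> C) (c : R) :
  (forall z, vn z < 1 ->
    cn (\sum_(w <- swords d 0) a w * mon w z) <= c * vn z ^+ d.+1) ->
  forall w, w \in swords d 0 -> a w = 0.
Proof.
move=> hc w0 hw0.
pose N := (2 ^ d)%N; pose T := {ffun 'I_k -> 'I_N}.
pose pt (r : R) (th : T) : V := \row_i (rc r * uroot d (th i)).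
pose ch (th : T) : C := \prod_i (uroot d (th i) ^+ count_mem i w0)^-1.
have size_lt w i : w \in swords d 0 -> (count_mem i w < N)%N.
  move=> /swords_sorted/andP[_ h]; apply: leq_ltn_trans (count_size _ _) _.
  by apply: leq_ltn_trans h _; exact: ltn_expl.
have orth r w : w \in swords d 0 ->
    \sum_th mon w (pt r th) * ch th = (w == w0)%:R * (rc r ^+ size w * (N ^ k)%:R).
  move=> hw.
  have -> : \sum_th mon w (pt r th) * ch th = rc r ^+ size w *
      \prod_i \sum_(j < N) uroot d j ^+ count_mem i w / uroot d j ^+ count_mem i w0.
    rewrite bigA_distr_bigA mulr_sumr; apply: eq_bigr => th _.
    rewrite mon_count /ch -big_split /=.
    have -> : rc r ^+ size w = \prod_i rc r ^+ count_mem i w.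
      have := mon_count w (\row__ rc r); rewrite /mon.
      under eq_bigr do rewrite mxE; rewrite big_const_seq count_predT iter_mulr_1 => ->.
      by apply: eq_bigr => i _; rewrite mxE.
    by rewrite -!big_split; apply: eq_bigr => i _ /=; rewrite mxE exprMn mulrA.
  have term i : \sum_(j < N) uroot d j ^+ count_mem i w / uroot d j ^+ count_mem i w0
      = (count_mem i w == count_mem i w0)%:R * (N%:R : C).
    have := avg_root (size_lt w i hw) (size_lt w0 i hw0).
    rewrite /avg => <-; rewrite mulrAC natrX mulVf ?mul1r//; exact: twoC_neq0.
  rewrite (eq_bigr _ (fun i _ => term i)) big_split /= prodr_const card_ord -natrX.
  rewrite mulrCA; congr (_ * _).
  have [->|ne] := eqVneq w w0; first by rewrite big1// => i _; rewrite eqxx.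
  have [i hi] : exists i, count_mem i w != count_mem i w0.
    apply: contrapT => h; move/eqP: ne; apply; apply: (swords_count hw hw0) => i.
    by apply/eqP; apply: contrapT => /negP h'; apply: h; exists i.
  by rewrite (bigD1 i)//= (negbTE hi) mul0r.
have cpt r th : 0 < r -> vn (pt r th) <= r.
  move=> r0; apply: vn_le => [|i]; first exact: ltW.
  by rewrite mxE cnM cn_root mulr1 cn_rc gtr0_norm.
have cch th : cn (ch th) = 1.
  by rewrite /ch cn_prod big1// => i _; rewrite cnV cnX cn_root expr1n invr1.
have Nk : 0 < (N ^ k)%:R :> R by rewrite ltr0n !expn_gt0.
have main (r : R) : 0 < r -> r < 1 -> cn (a w0) <= `|c| * r.
  move=> r0 r1.
  have : \sum_th (\sum_(w <- swords d 0) a w * mon w (pt r th)) * ch th =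
      a w0 * (rc r ^+ size w0 * (N ^ k)%:R).
    under eq_bigr do rewrite mulr_suml.
    rewrite exchange_big /= (bigD1_seq w0)//= ?swords_uniq//.
    rewrite [X in _ + X]big1_seq ?addr0.
      by under eq_bigr do rewrite -mulrA; rewrite -mulr_sumr orth// eqxx mul1r.
    move=> w /andP[ne hw]; under eq_bigr do rewrite -mulrA.
    by rewrite -mulr_sumr orth// (negbTE ne) mul0r mulr0.
  move=> /(congr1 cn); rewrite !cnM cnX cn_nat cn_rc gtr0_norm// => E.
  have : cn (\sum_th (\sum_(w <- swords d 0) a w * mon w (pt r th)) * ch th)
      <= (`|c| * r ^+ d.+1) * (N ^ k)%:R.
    apply: le_trans (cn_sum _ _ _) _.
    apply: le_trans (_ : \sum_(th : T) `|c| * r ^+ d.+1 <= _).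
      apply: ler_sum => th _; rewrite cnM cch mulr1.
      have hv := cpt r th r0; apply: le_trans (hc _ (le_lt_trans hv r1)) _.
      have v0 := vn_ge0 (pt r th).
      apply: le_trans (_ : `|c| * vn (pt r th) ^+ d.+1 <= _).
        by rewrite ler_wpM2r ?exprn_ge0// ler_norm.
      by rewrite ler_wpM2l// lerXn2r ?nnegrE// ltW.
    by rewrite sumr_const card_ffun !card_ord mulr_natr.
  rewrite E mulrA ler_pM2r// => h.
  have hs : (size w0 <= d)%N by have /andP[] := swords_sorted hw0.
  have rs : 0 < r ^+ size w0 by rewrite exprn_gt0.
  rewrite -(ler_pM2r rs); apply: le_trans h _.
  rewrite -mulrA -exprS ler_wpM2l//.
  by apply: ler_wiXn2l => //; exact: ltW.
apply/eqP; rewrite -cn_eq0 eq_le cn_ge0 andbT; apply/ler_addgt0Pr => e e0.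
rewrite add0r; have c0 := normr_ge0 c; have c1 : 0 < `|c| + 1 by lra.
pose r := Num.min 2^-1 (e / (`|c| + 1)).
have r0 : 0 < r by rewrite lt_min divr_gt0// andbT invr_gt0.
have r1 : r < 1 by rewrite gt_min; apply/orP; left; lra.
have r2 : r <= e / (`|c| + 1) by rewrite ge_min lexx orbT.
rewrite ler_pdivlMr// in r2.
by apply: le_trans (main r r0 r1) _; nra.
Qed.

Definition jet_words d := behead (swords d 0).

(** The family x gives the Taylor coefficients of e, which vanishes at 0, up to
    order d. *)
Definition isjet d e (x : seq 'I_k -> C) := exists c : R, forall z, vn z < 1 ->
  cn (e z - \sum_(w <- jet_words d) x w * mon w z) <= c * vn z ^+ d.+1.

Lemma swordsE d : swords d 0 = [::] :: jet_words d.
Proof. by case: d. Qed.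

Lemma jet_exists d M e : sep M e -> e 0 = 0 -> exists x,
  [/\ isjet d e x, forall w, cn (x w) <= 4 ^+ d * M & forall z, vn z < 1 ->
    cn (e z - \sum_(w <- jet_words d) x w * mon w z)
        <= (4 * k%:R) ^+ d.+1 * M * vn z ^+ d.+1].
Proof.
move=> he e0; have [z|a [a0 h1 h2]] := @taylor d 0%N M e he _ (leq0n k).
  by rewrite trunc0.
have {}h2 z : vn z < 1 -> cn (e z - \sum_(w <- jet_words d) a w * mon w z)
        <= (4 * k%:R) ^+ d.+1 * M * vn z ^+ d.+1.
  by move=> /h2; rewrite swordsE big_cons a0 e0 mul0r add0r.
by exists a; split => //; exists ((4 * k%:R) ^+ d.+1 * M).
Qed.

Lemma jet_uniq d e x y : isjet d e x -> isjet d e y ->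
  forall w, w \in jet_words d -> x w = y w.
Proof.
move=> [c1 h1] [c2 h2] w hw; apply/eqP; rewrite -subr_eq0; apply/eqP.
pose a w := if w is [::] then 0 else x w - y w.
have hw0 : w \in swords d 0 by rewrite swordsE inE hw orbT.
have wn : w != [::].
  by have := swords_uniq d 0; rewrite swordsE /= => /andP[h _]; apply: contraNneq h => <-.
have := @jet_zero d a (c1 + c2); rewrite {2}/a; case: w hw hw0 wn => // i w hw hw0 _.
move=> /(_ _ (i :: w) hw0); apply=> z hz.
rewrite swordsE big_cons mul0r add0r.
rewrite (eq_big_seq (fun w => x w * mon w z - y w * mon w z)); last first.
  move=> [|j v] hv; last by rewrite /a mulrBl.
  by have := swords_uniq d 0; rewrite swordsE /= hv.
rewrite sumrB mulrDl.
rewrite (_ : _ - _ = (e z - \sum_(w <- jet_words d) y w * mon w z)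
   - (e z - \sum_(w <- jet_words d) x w * mon w z)); last by ring.
by apply: le_trans (cnB _ _) _; rewrite addrC lerD ?h1 ?h2.
Qed.

Lemma isjetD d e f x y : isjet d e x -> isjet d f y ->
  isjet d (fun z => e z + f z) (fun w => x w + y w).
Proof.
move=> [c1 h1] [c2 h2]; exists (c1 + c2) => z hz.
rewrite (eq_bigr (fun w => x w * mon w z + y w * mon w z)) => [|w _]; last by rewrite mulrDl.
rewrite big_split /= mulrDl opprD addrACA.
by apply: le_trans (cnD _ _) _; rewrite lerD ?h1 ?h2.
Qed.

Lemma isjetZ d e x a : isjet d e x -> isjet d (fun z => a * e z) (fun w => a * x w).
Proof.
move=> [c h]; exists (cn a * c) => z hz.
rewrite (eq_bigr (fun w => a * (x w * mon w z))) => [|w _]; last by rewrite mulrA.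
by rewrite -mulr_sumr -mulrBr cnM -mulrA ler_wpM2l ?cn_ge0 ?h.
Qed.

Lemma isjetB d e f x y : isjet d e x -> isjet d f y ->
  isjet d (fun z => e z - f z) (fun w => x w - y w).
Proof.
move=> h1 h2; have := isjetD h1 (isjetZ (-1) h2).
by congr (isjet d _ _); apply/funext => z; rewrite mulN1r.
Qed.

Lemma upd_line z i t : upd z i t = upd z i 0 + t *: delta_mx 0 i.
Proof.
apply/rowP => j; rewrite !mxE eqxx /=; case: eqP => _; rewrite ?mulr0 ?addr0//.
by rewrite mulr1 add0r.
Qed.

Lemma sdiff_sep M e : (forall z, vn z < 1 -> sdiff e z) ->
  (forall z, vn z < 1 -> cn (e z) <= M) -> sep M e.
Proof.
move=> hd hb; split => // z i hz t; rewrite subr0 => ht.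
have [|p hp] := hd (upd z i 0 + t *: delta_mx 0 i).
  by rewrite -upd_line; exact: vn_upd.
exists (lin p (delta_mx 0 i)).
rewrite (_ : (fun t => _) = (fun s => e (upd z i 0 + s *: delta_mx 0 i))).
  exact: is_cder_line.
by apply/funext => s; rewrite -upd_line.
Qed.

End Jets.

(** * Fixed points of contractions on bounded families *)

Section Picard.
Context {R : realType} {T : Type}.
Local Notation C := (Cplx R).
Implicit Types (x y : T -> C).

Definition inball (w : T -> R) (r : R) x := forall t, cn (x t) <= r * w t.

(** The contraction principle on the ball of radius r of the weighted sup norm.
    The fixed point is obtained as the limit of the iterates of the zero family,
    so that it inherits what is stable under bounded pointwise limits. *)
Lemma picard (w : T -> R) (theta r : R) (Gam : (T -> C) -> T -> C) :
  0 <= theta -> theta < 1 -> 0 <= r -> (forall t, 0 <= w t) ->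
  (forall t, cn (Gam (fun=> 0) t) <= (1 - theta) * r * w t) ->
  (forall x y c, inball w r x -> inball w r y -> 0 <= c ->
     (forall t, cn (x t - y t) <= c * w t) ->
     forall t, cn (Gam x t - Gam y t) <= theta * c * w t) ->
  exists x, [/\ inball w r x, forall t, Gam x t = x t,
    forall j, inball w r (iter j Gam (fun=> 0)) &
    forall t, clim (fun j => iter j Gam (fun=> 0) t) (x t)].
Proof.
move=> th0 th1 r0 w0 hz hc; pose X j := iter j Gam (fun=> 0).
have X0 : inball w r (X 0%N) by move=> t; rewrite cn0 mulr_ge0.
have inX j : inball w r (X j).
  elim: j => [//|j IH] t; rewrite /X iterS -/(X j).
  have := hc _ _ _ IH X0 r0 (_ : forall t, cn (X j t - X 0%N t) <= r * w t) t.
  move=> /(_ ltac:(by move=> t'; rewrite subr0; exact: IH)) h1.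
  rewrite (_ : Gam (X j) t = (Gam (X j) t - Gam (X 0%N) t) + Gam (fun=> 0) t); last by rewrite subrK.
  apply: le_trans (cnD _ _) _; apply: le_trans (lerD h1 (hz t)) _.
  by rewrite le_eqVlt; apply/orP; left; apply/eqP; ring.
have dX j i t : cn (X (j + i)%N t - X j t) <= theta ^+ j * r * w t.
  elim: j i t => [|j IH] i t; first by rewrite subr0 expr0 mul1r; exact: inX.
  rewrite addSn /X !iterS -!/(X _) exprS.
  have := hc _ _ (theta ^+ j * r) (inX (j + i)%N) (inX j) _ (IH i) t.
  by rewrite mulr_ge0 ?exprn_ge0// => /(_ isT); rewrite !mulrA.
have small t : forall e : R, 0 < e -> exists n0, forall n, (n0 <= n)%N ->
    theta ^+ n * r * w t < e.
  move=> e e0; have q0 : 0 <= r * w t by rewrite mulr_ge0.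
  have q1 : 0 < r * w t + 1 by lra.
  have [n0 h] := expr_small th0 th1 (divr_gt0 e0 q1); exists n0 => n /h.
  rewrite ltr_pdivlMr// -mulrA; have := exprn_ge0 n th0; nra.
have /choice[x hx] : forall t, exists l, clim (fun j => X j t) l.
  move=> t; apply: clim_cauchy => e e0.
  have [n0 h] := small t _ (divr_gt0 e0 (ltr0n R 2)); exists n0 => n m hn hm.
  have := dX n0 (n - n0)%N t; have := dX n0 (m - n0)%N t; rewrite !subnKC//.
  have := h _ (leqnn _); have := cn_dist_add (X n0 t) (X n t) (X m t).
  by rewrite (cn_distC (X n0 t)); lra.
have inx : inball w r x.
  by move=> t; apply: (clim_le (hx t)); exists 0%N => n _; exact: inX.
have dx j t : cn (x t - X j t) <= theta ^+ j * r * w t.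
  apply: (clim_le (climB (hx t) (clim_cst (X j t)))); exists j => n hn.
  by have := dX j (n - j)%N t; rewrite subnKC.
exists x; split => // t.
apply: (clim_uniq (u := fun j => X j.+1 t)).
  apply: (@clim_squeeze _ _ _ (fun j => theta ^+ j * r * w t)); last exact: small.
  move=> j; rewrite /X iterS -/(X j) cn_distC.
  have q : 0 <= theta ^+ j * r by rewrite mulr_ge0// exprn_ge0.
  have := hc _ _ _ inx (inX j) q (dx j) t => h; apply: le_trans h _.
  by rewrite -mulrA ler_piMl ?(ltW th1)// mulr_ge0.
by move=> e /(hx t)[n0 h]; exists n0 => n hn; apply: h; exact: leqW.
Qed.

End Picard.

(** * Polynomial maps and their coefficients *)

Section Polynomials.
Context {R : realType} {k : nat}.
Local Notation C := (Cplx R).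
Local Notation V := (Ck R k).
Implicit Types (z u : V) (e : V -> C) (i j : 'I_k) (w : seq 'I_k).
Implicit Types (x y : 'I_k -> seq 'I_k -> C).

Lemma mon_le w z (B : R) : vn z <= B -> cn (mon w z) <= B ^+ size w.
Proof.
move=> hz; rewrite /mon cn_prod; elim: w => [|i w IH]; first by rewrite big_nil.
rewrite big_cons exprS; apply: ler_pM => //; first exact: cn_ge0.
  by rewrite prodr_ge0// => j _; exact: cn_ge0.
exact: le_trans (cn_le_vn _ _) hz.
Qed.

Lemma mon_lip w z u (B : R) : 1 <= B -> vn z <= B -> vn u <= B ->
  cn (mon w z - mon w u) <= (size w)%:R * B ^+ size w * vn (z - u).
Proof.
move=> B1 hz hu; have B0 : 0 <= B by lra.
elim: w => [|i w IH]; first by rewrite /mon !big_nil subrr cn0 !mul0r.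
rewrite /mon !big_cons -!/(mon w _).
rewrite (_ : _ - _ = (z - u) 0 i * mon w z + u 0 i * (mon w z - mon w u)); last first.
  by rewrite !mxE; ring.
have v0 := vn_ge0 (z - u).
apply: le_trans (cnD _ _) _; rewrite !cnM /= -[(size w).+1]addn1 natrD mulrDl mulrDl addrC.
have bs : 0 <= B ^+ size w by rewrite exprn_ge0.
apply: lerD.
  apply: le_trans (ler_pM (cn_ge0 _) (cn_ge0 _) (le_trans (cn_le_vn u i) hu) IH) _.
  by rewrite addn1 exprS le_eqVlt; apply/orP; left; apply/eqP; ring.
rewrite mul1r mulrC; apply: ler_pM; rewrite ?cn_ge0 ?cn_le_vn//.
apply: le_trans (mon_le w hz) _; rewrite addn1 exprS ler_peMl//.
Qed.

Lemma sdiff_mon w z : sdiff (mon w) z.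
Proof.
elim: w => [|i w IH].
  by apply: (@sdiff_ext _ _ (fun=> 1) _ _ 1) => [//|h _|]; [rewrite /mon big_nil|exact: sdiff_cst].
apply: (@sdiff_ext _ _ (fun z => z 0 i * mon w z) _ _ 1) => [//|h _|].
  by rewrite /mon big_cons.
by apply: sdiffM => //; exact: sdiff_coord.
Qed.

Lemma mon0 w : w != [::] -> mon w (0 : V) = 0.
Proof. by case: w => // i w _; rewrite /mon big_cons mxE mul0r. Qed.

Context (d : nat).

Lemma jet_words_neq w : w \in jet_words d -> w != [::].
Proof.
move=> hw; have := swords_uniq (k := k) d 0; rewrite swordsE /= => /andP[h _].
by apply: contraNneq h => <-.
Qed.

Lemma jet_words_size w : w \in jet_words d -> (0 < size w <= d)%N.
Proof.
move=> hw; have := jet_words_neq hw; rewrite -size_eq0 -lt0n => ->.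
have hw' : w \in swords d 0 by rewrite swordsE inE hw orbT.
by have /andP[] := swords_sorted hw'.
Qed.

(** The number of monomials, and a common Lipschitz constant for them on the
    polydisc of radius 2. *)
Definition nmon : R := (size (jet_words (k := k) d))%:R.
Definition lmon : R := d%:R * 2 ^+ d.

Lemma nmon_ge0 : 0 <= nmon. Proof. exact: ler0n. Qed.
Lemma lmon_ge0 : 0 <= lmon. Proof. by rewrite mulr_ge0// exprn_ge0. Qed.

Lemma mon_lip2 w z u : w \in jet_words d -> vn z <= 2 -> vn u <= 2 ->
  cn (mon w z - mon w u) <= lmon * vn (z - u).
Proof.
move=> hw hz hu; have /andP[_ hs] := jet_words_size hw.
have two : 1 <= 2 :> R by lra.
apply: le_trans (mon_lip w two hz hu) _.
rewrite ler_wpM2r ?vn_ge0//; apply: ler_pM; rewrite ?exprn_ge0 ?ler_nat//.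
by rewrite ler_weXn2l.
Qed.

Lemma mon_le_vn w z : w \in jet_words d -> vn z <= 1 -> cn (mon w z) <= vn z.
Proof.
move=> hw hz; have /andP[hs _] := jet_words_size hw.
apply: le_trans (mon_le w (lexx _)) _; rewrite -{2}(expr1 (vn z)).
by apply: ler_wiXn2l => //; exact: vn_ge0.
Qed.

Definition pol x z : V := \row_i \sum_(w <- jet_words d) x i w * mon w z.

Lemma sdiff_pol x i z : sdiff (fun z => pol x z 0 i) z.
Proof.
apply: (@sdiff_ext _ _ (fun z => \sum_(w <- jet_words d) x i w * mon w z) _ _ 1) => [//|h _|].
  by rewrite mxE.
by apply: sdiff_sum => w; apply: sdiffZ; exact: sdiff_mon.
Qed.

Lemma sum_jet_le (g : seq 'I_k -> C) (c : R) :
  (forall w, w \in jet_words d -> cn (g w) <= c) ->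
  cn (\sum_(w <- jet_words d) g w) <= nmon * c.
Proof.
move=> h; apply: le_trans (cn_sum _ _ _) _.
rewrite big_seq; apply: le_trans (ler_sum _ (fun w hw => h w hw)) _.
by rewrite -big_seq big_const_seq count_predT iter_addr_0 mulr_natl.
Qed.

Lemma pol_le x z (s : R) : 0 <= s -> (forall i w, cn (x i w) <= s) -> vn z <= 1 ->
  vn (pol x z) <= nmon * s * vn z.
Proof.
move=> s0 hx hz; apply: vn_le => [|i].
  by rewrite !mulr_ge0 ?nmon_ge0 ?vn_ge0.
rewrite mxE -mulrA; apply: sum_jet_le => w hw; rewrite cnM.
by apply: ler_pM; rewrite ?cn_ge0 ?mon_le_vn.
Qed.

Lemma pol_lip x z u (s : R) : 0 <= s -> (forall i w, cn (x i w) <= s) ->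
  vn z <= 2 -> vn u <= 2 -> vn (pol x z - pol x u) <= nmon * s * lmon * vn (z - u).
Proof.
move=> s0 hx hz hu; apply: vn_le => [|i].
  by rewrite !mulr_ge0 ?nmon_ge0 ?lmon_ge0 ?vn_ge0.
rewrite !mxE -sumrB -[leRHS]mulrA -[leRHS]mulrA; apply: sum_jet_le => w hw.
rewrite -mulrBr cnM; apply: ler_pM; rewrite ?cn_ge0//.
exact: mon_lip2.
Qed.

Lemma polB x y z : pol x z - pol y z = pol (fun i w => x i w - y i w) z.
Proof.
apply/rowP => i; rewrite !mxE -sumrB; apply: eq_bigr => w _; ring.
Qed.

Lemma pol0 x : pol x 0 = 0.
Proof.
apply/rowP => i; rewrite !mxE big_seq big1// => w hw.
by rewrite mon0 ?mulr0// jet_words_neq.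
Qed.

(** The property isjet determines the values on jet_words; taking zero elsewhere
    makes the coefficients unique and bounded. *)
Definition jet e w : C :=
  if w \in jet_words d then xget (fun=> 0) [set a | isjet d e a] w else 0.

Lemma jetP M e : sep M e -> e 0 = 0 -> isjet d e (jet e).
Proof.
move=> he e0; have [a [ha _ _]] := jet_exists d he e0.
have [c hc] : isjet d e (xget (fun=> 0) [set a | isjet d e a]) by exact: (xgetPex _ (ex_intro _ a ha)).
exists c => z /hc; congr (cn (_ - _) <= _).
by apply: eq_big_seq => w hw; rewrite /jet hw.
Qed.

Lemma jet_eq M e a w : sep M e -> e 0 = 0 -> isjet d e a -> w \in jet_words d ->
  jet e w = a w.
Proof. by move=> he e0 ha hw; exact: (jet_uniq (jetP he e0) ha). Qed.

Lemma jet_le M e w : sep M e -> e 0 = 0 -> cn (jet e w) <= 4 ^+ d * M.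
Proof.
move=> he e0; have [a [ha hb _]] := jet_exists d he e0.
case: (boolP (w \in jet_words d)) => hw; first by rewrite (jet_eq he e0 ha hw).
by rewrite /jet (negbTE hw) cn0; apply: le_trans (cn_ge0 _) (hb w).
Qed.

Lemma jet_rem M e z : sep M e -> e 0 = 0 -> vn z < 1 ->
  cn (e z - \sum_(w <- jet_words d) jet e w * mon w z)
    <= (4 * k%:R) ^+ d.+1 * M * vn z ^+ d.+1.
Proof.
move=> he e0; have [a [ha _ hb]] := jet_exists d he e0.
move=> /hb; congr (cn (_ - _) <= _); apply: eq_big_seq => w hw.
by rewrite (jet_eq he e0 ha hw).
Qed.

End Polynomials.

(** * Formal conjugation to a triangular polynomial map *)

Section FormalConjugation.
Context {R : realType} {k : nat}.
Local Notation C := (Cplx R).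
Local Notation V := (Ck R k).
Implicit Types (z u : V) (e : V -> C) (i j : 'I_k) (w : seq 'I_k).
Implicit Types (x y : 'I_k -> seq 'I_k -> C).
Context (d : nat) (lam : 'I_k -> C).

Definition lev i : R := cn (lam i).

(** The monomials kept in component i: those in the coordinates on which the
    linear part contracts strictly less than on the i-th one, and the
    coordinates on which it contracts as much. *)
Definition good i w : bool :=
  all (fun j => lev i < lev j) w || (if w is [:: j] then lev j == lev i else false).

Definition lamw w : C := \prod_(j <- w) lam j.

Definition diag z : V := \row_i (lam i * z 0 i).

Definition cpart x : 'I_k -> seq 'I_k -> C := fun i w => if good i w then x i w else 0.
Definition bpart x : 'I_k -> seq 'I_k -> C := fun i w => if good i w then 0 else x i w.

Definition gmap x z : V := diag z + pol d (cpart x) z.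
Definition hmap x z : V := z + pol d (bpart x) z.

Lemma mon_diag w z : mon w (diag z) = lamw w * mon w z.
Proof.
by rewrite /mon /lamw -big_split; apply: eq_bigr => i _; rewrite mxE.
Qed.

Lemma sdiff_diag i z : sdiff (fun z => diag z 0 i) z.
Proof.
apply: (@sdiff_ext _ _ (fun z => lam i * z 0 i) _ _ 1) => [//|h _|].
  by rewrite [RHS]mxE.
by apply: sdiffZ; exact: sdiff_coord.
Qed.

Lemma vdiffD (F G : V -> V) z : vdiff F z -> vdiff G z -> vdiff (fun z => F z + G z) z.
Proof.
move=> hF hG i; apply: (@sdiff_ext _ _ (fun z => F z 0 i + G z 0 i) _ _ 1) => [//|h _|].
  by rewrite [RHS]mxE.
exact: sdiffD.
Qed.

Lemma vdiff_id z : vdiff id z.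
Proof. by move=> i; exact: sdiff_coord. Qed.

Lemma vdiff_comp (F G : V -> V) z : vdiff F (G z) -> vdiff G z -> vdiff (fun z => F (G z)) z.
Proof. by move=> hF hG i; exact: (@sdiff_comp _ _ (fun z => F z 0 i)). Qed.

Lemma vdiff_hmap x z : vdiff (hmap x) z.
Proof. by apply: vdiffD => [|i]; [exact: vdiff_id|exact: sdiff_pol]. Qed.

Lemma vdiff_gmap x z : vdiff (gmap x) z.
Proof. by apply: vdiffD => i; [exact: sdiff_diag|exact: sdiff_pol]. Qed.

Lemma cpart_le x (s : R) : 0 <= s -> (forall i w, cn (x i w) <= s) ->
  forall i w, cn (cpart x i w) <= s.
Proof. by move=> s0 h i w; rewrite /cpart; case: ifP => _; rewrite ?cn0. Qed.

Lemma bpart_le x (s : R) : 0 <= s -> (forall i w, cn (x i w) <= s) ->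
  forall i w, cn (bpart x i w) <= s.
Proof. by move=> s0 h i w; rewrite /bpart; case: ifP => _; rewrite ?cn0. Qed.

Context (a : R) (a0 : 0 <= a) (a1 : a < 1) (lev_a : forall i, lev i <= a).

Lemma lamw_le w : cn (lamw w) <= 1.
Proof.
rewrite /lamw cn_prod; apply: prodr_ile1 => j _; rewrite cn_ge0/=.
by apply: le_trans (lev_a j) _; exact: ltW.
Qed.

Lemma lamw_le_a w : w != [::] -> cn (lamw w) <= a.
Proof.
case: w => // j w _; rewrite /lamw big_cons cnM -/(lamw w).
by apply: le_trans (lev_a j); rewrite ler_piMr ?cn_ge0 ?lamw_le.
Qed.

(** A monomial that is not kept contains a coordinate on which the linear part
    contracts at least as much as on the i-th one.  It contains a further
    coordinate, or else it contracts strictly more: there is no resonance. *)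
Lemma nonresonance : exists2 theta : R, 0 <= theta < 1 &
  forall i w, w != [::] -> ~~ good i w -> cn (lamw w) <= theta * lev i.
Proof.
pose q (p : 'I_k * 'I_k) : R := if lev p.1 < lev p.2 then lev p.1 / lev p.2 else 0.
pose th := Num.max a (\big[Num.max/0]_p q p).
have q1 p : q p < 1.
  rewrite /q; case: ifP => // h; rewrite ltr_pdivrMr ?mul1r//.
  by apply: le_lt_trans h; exact: cn_ge0.
exists th.
  rewrite le_max a0 /= gt_max a1 /=; apply/bigmax_ltP; split => // p _; exact: q1.
move=> i w wn; rewrite negb_or => /andP[/allPn[j jw]]; rewrite -leNgt => hj.
have th_a : a <= th by rewrite le_max lexx.
have hrem : cn (lamw w) = lev j * cn (lamw (rem j w)).
  by rewrite /lamw (perm_big _ (perm_to_rem jw)) big_cons cnM.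
have li : 0 <= lev i := cn_ge0 _.
have [r0|rn] := eqVneq (rem j w) [::].
  have -> : w = [:: j].
    by have := perm_to_rem jw; rewrite r0 => /perm_small_eq ->.
  move=> hne; rewrite /lamw big_seq1 -/(lev j).
  have lt : lev j < lev i by rewrite lt_neqAle hne.
  have l0 : 0 < lev i by apply: le_lt_trans lt; exact: cn_ge0.
  rewrite -ler_pdivrMr//; apply: (@le_trans _ _ (q (j, i))).
    by rewrite /q /= lt.
  by rewrite le_max; apply/orP; right; exact: (le_bigmax _ q).
move=> _; rewrite hrem mulrC; apply: ler_pM; rewrite ?cn_ge0//.
by apply: le_trans (lamw_le_a rn) _.
Qed.

End FormalConjugation.

Arguments pol_le {R k} d {x z s}.
Arguments pol_lip {R k} d {x z u s}.
Arguments cpart_le {R k} lam {x s}.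
Arguments bpart_le {R k} lam {x s}.
Arguments jet_le {R k} d {M e} w.
Arguments jetP {R k} d {M e}.
Arguments jet_rem {R k d M e z}.
Arguments jet_eq {R k d M e a w}.

Section FormalStep.
Context {R : realType} {k : nat}.
Local Notation C := (Cplx R).
Local Notation V := (Ck R k).
Implicit Types (z u : V) (e : V -> C) (i j : 'I_k) (w : seq 'I_k).
Implicit Types (x y : 'I_k -> seq 'I_k -> C).

Lemma ex_small (l : seq (R * R)) : all (fun p => 0 < p.2) l ->
  exists2 t : R, 0 < t & forall v, 0 <= v -> v <= t -> all (fun p => p.1 * v <= p.2) l.
Proof.
elim: l => [_|[c b] l IH /= /andP[b0 /IH[t t0 ht]]]; first by exists 1.
have c0 := normr_ge0 c; have c1 : 0 < `|c| + 1 by lra.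
exists (Num.min t (b / (`|c| + 1))); first by rewrite lt_min t0 divr_gt0.
move=> v v0; rewrite le_min => /andP[/(ht _ v0) -> h]; rewrite andbT.
rewrite ler_pdivlMr// in h; apply: le_trans h; rewrite mulrC ler_wpM2l//.
by apply: le_trans (ler_norm _) _; rewrite lerDl.
Qed.

Lemma vdiffB (F G : V -> V) z : vdiff F z -> vdiff G z -> vdiff (fun z => F z - G z) z.
Proof.
move=> hF hG i; apply: (@sdiff_ext _ _ (fun z => F z 0 i - G z 0 i) _ _ 1) => [//|h _|].
  by rewrite !mxE.
exact: sdiffB.
Qed.

Lemma coord_le z i (c : R) : vn z <= c -> cn (z 0 i) <= c.
Proof. exact: le_trans (cn_le_vn _ _). Qed.

Context (d : nat) (lam : 'I_k -> C) (rho a : R).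
Context (rho0 : 0 < rho) (rho1 : rho <= 1) (rho_lev : forall i, rho <= lev lam i).
Context (a0 : 0 <= a) (a1 : a < 1) (lev_a : forall i, lev lam i <= a).

Local Notation nm := (@nmon R k d).
Local Notation lm := (@lmon R d).
Local Notation bp := (bpart lam).
Local Notation cp := (cpart lam).
Local Notation D := (diag lam).

Lemma vn_diag z : vn (D z) <= a * vn z.
Proof.
apply: vn_le => [|i]; first by rewrite mulr_ge0 ?vn_ge0.
by rewrite mxE cnM; apply: ler_pM; rewrite ?cn_ge0 ?cn_le_vn//; exact: lev_a.
Qed.

(** What is left of the conjugacy equation for h = id + bpart and g = D + cpart
    once the terms that are linear in the coefficients of h and g at the current
    time have been moved to the other side. *)
Definition residue (f : V -> V) x0 x1 z : V :=
  (f z - D z) + pol d (bp x1) (f z)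
  - (pol d (cp x0) (hmap d lam x0 z) - pol d (cp x0) z).

Lemma residue_eq (f : V -> V) x0 x1 z :
  hmap d lam x1 (f z) - gmap d lam x0 (hmap d lam x0 z) =
  residue f x0 x1 z - (D (pol d (bp x0) z) + pol d (cp x0) z).
Proof.
have -> : gmap d lam x0 (hmap d lam x0 z) =
    D z + D (pol d (bp x0) z) + pol d (cp x0) (hmap d lam x0 z).
  rewrite /gmap; congr (_ + _); apply/rowP => i; rewrite !mxE; ring.
rewrite /residue {1}/hmap; set p := pol d (cp x0) _; set q := pol d (cp x0) z.
by apply/rowP => i; rewrite !mxE; ring.
Qed.

Context (f : V -> V) (eta s : R).
Context (s0 : 0 <= s) (nms : nm * s <= 1).
Context (fd : forall z, vn z < 1 -> vdiff f z) (f0 : f 0 = 0).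
Context (f1 : forall z, vn z < 1 -> vn (f z) <= 1).
Context (fD : forall z, vn z < 1 -> vn (f z - D z) <= eta).

Definition small x := forall i w, cn (x i w) <= s.

Lemma hmap2 x z : small x -> vn z < 1 -> vn (hmap d lam x z) <= 2.
Proof.
move=> hx hz; apply: le_trans (vnD _ _) _.
have h := pol_le d s0 (bpart_le lam s0 hx) (ltW hz).
have h' : nm * s * vn z <= vn z by rewrite ler_piMl ?vn_ge0.
by have := ltW hz; lra.
Qed.

Lemma residue_vdiff x0 x1 z : vn z < 1 -> vdiff (residue f x0 x1) z.
Proof.
move=> hz; apply: vdiffB.
  apply: vdiffD.
    by apply: vdiffB => [|i]; [exact: fd|exact: sdiff_diag].
  by apply: (@vdiff_comp _ _ (pol d (bp x1))) => [i|]; [exact: sdiff_pol|exact: fd].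
apply: vdiffB => [|i]; last exact: sdiff_pol.
by apply: (@vdiff_comp _ _ (pol d (cp x0))) => [i|]; [exact: sdiff_pol|exact: vdiff_hmap].
Qed.

Lemma residue0 x0 x1 : residue f x0 x1 0 = 0.
Proof.
rewrite /residue f0 /hmap !pol0 !addr0 ?pol0 subrr subr0.
by apply/rowP => i; rewrite !mxE; ring.
Qed.

Lemma residue_le x0 x1 z : small x0 -> small x1 -> vn z < 1 ->
  vn (residue f x0 x1 z) <= eta + nm * s * (1 + lm * (nm * s)).
Proof.
move=> h0 h1 hz; have n0 := nmon_ge0 (R := R) (k := k) d; have l0 := @lmon_ge0 R d.
have ns0 : 0 <= nm * s by rewrite mulr_ge0.
apply: le_trans (vnB _ _) _; apply: le_trans (lerD (vnD _ _) (lexx _)) _.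
have b1 := fD hz.
have b2 : vn (pol d (bp x1) (f z)) <= nm * s.
  apply: le_trans (pol_le d s0 (bpart_le lam s0 h1) (f1 hz)) _.
  by rewrite ler_piMr// f1.
have b3 : vn (pol d (cp x0) (hmap d lam x0 z) - pol d (cp x0) z) <= nm * s * lm * (nm * s).
  apply: le_trans (pol_lip d s0 (cpart_le lam s0 h0) (hmap2 h0 hz) _) _; first by lra.
  rewrite ler_wpM2l ?mulr_ge0// /hmap addrC addKr.
  apply: le_trans (pol_le d s0 (bpart_le lam s0 h0) (ltW hz)) _.
  by rewrite ler_piMr// ltW.
by apply: le_trans (lerD (lerD b1 b2) b3) _; rewrite mulrDr mulr1 !mulrA addrA.
Qed.

Lemma residue_sep x0 x1 i : small x0 -> small x1 ->
  sep (eta + nm * s * (1 + lm * (nm * s))) (fun z => residue f x0 x1 z 0 i).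
Proof.
move=> h0 h1; apply: sdiff_sep => z hz; first exact: residue_vdiff.
by apply: coord_le; exact: residue_le.
Qed.

(** Up to a small error, the dependence of the Taylor coefficients of the residue
    on the unknown coefficients is diagonal. *)
Lemma residue_jet x0 x1 y0 y1 (c : R) i w :
  small x0 -> small x1 -> small y0 -> small y1 -> 0 <= c ->
  (forall i w, cn (x0 i w - y0 i w) <= c) -> (forall i w, cn (x1 i w - y1 i w) <= c) ->
  w \in jet_words d ->
  cn (jet d (fun z => residue f x0 x1 z 0 i) w - jet d (fun z => residue f y0 y1 z 0 i) w
      - lamw lam w * (bp x1 i w - bp y1 i w))
  <= 4 ^+ d * ((nm * lm * eta + 2 * nm ^+ 2 * lm * s) * c).
Proof.
move=> hx0 hx1 hy0 hy1 c0 d0 d1 hw.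
have n0 := nmon_ge0 (R := R) (k := k) d; have l0 := @lmon_ge0 R d.
pose be i w := bp x1 i w - bp y1 i w.
pose P (z : V) : C := \sum_(v <- jet_words d) (be i v * lamw lam v) * mon v z.
pose G z := residue f x0 x1 z 0 i - residue f y0 y1 z 0 i - P z.
have jP : isjet d P (fun v => be i v * lamw lam v).
  by exists 0 => z _; rewrite subrr cn0 mul0r.
have rx := residue_sep i hx0 hx1; have ry := residue_sep i hy0 hy1.
have zx : residue f x0 x1 0 0 i = 0 by rewrite residue0 mxE.
have zy : residue f y0 y1 0 0 i = 0 by rewrite residue0 mxE.
have jG := isjetB (isjetB (jetP d rx zx) (jetP d ry zy)) jP.
have PE z : P z = pol d be (D z) 0 i.
  by rewrite mxE; apply: eq_bigr => v _; rewrite mon_diag mulrA.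
have be_c i' v : cn (be i' v) <= c.
  by rewrite /be /bpart; case: ifP => _; rewrite ?subrr ?cn0.
pose ga i' v := cp x0 i' v - cp y0 i' v.
have ga_c i' v : cn (ga i' v) <= c.
  by rewrite /ga /cpart; case: ifP => _; rewrite ?subrr ?cn0.
have G_le z : vn z < 1 -> cn (G z) <= (nm * lm * eta + 2 * nm ^+ 2 * lm * s) * c.
  move=> hz.
  have hz2 : vn z <= 2 by lra.
  have GE : G z = (pol d be (f z) - pol d be (D z)) 0 i
      - (pol d ga (hmap d lam x0 z) - pol d ga z) 0 i
      - (pol d (cp y0) (hmap d lam x0 z) - pol d (cp y0) (hmap d lam y0 z)) 0 i.
    rewrite /G PE /residue -[pol d be (f z)]polB -!(polB _ (cp x0)).
    move: (pol d be (D z)) (pol d (bp x1) (f z)) (pol d (bp y1) (f z))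
      (pol d (cp x0) (hmap d lam x0 z)) (pol d (cp x0) z)
      (pol d (cp y0) (hmap d lam y0 z)) (pol d (cp y0) z)
      (pol d (cp y0) (hmap d lam x0 z)) (f z) (D z) => p1 p2 p3 p4 p5 p6 p7 p8 p9 p10.
    by rewrite !mxE; ring.
  have b1 : cn ((pol d be (f z) - pol d be (D z)) 0 i) <= nm * c * lm * eta.
    apply: coord_le; apply: le_trans (pol_lip d c0 be_c _ _) _.
    - by have := f1 hz; lra.
    - by have := vn_diag z; have := vn_ge0 z; move: a0 a1; nra.
    - by rewrite ler_wpM2l ?fD// !mulr_ge0.
  have b2 : cn ((pol d ga (hmap d lam x0 z) - pol d ga z) 0 i) <= nm * c * lm * (nm * s).
    apply: coord_le; apply: le_trans (pol_lip d c0 ga_c (hmap2 hx0 hz) hz2) _.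
    rewrite ler_wpM2l ?mulr_ge0// /hmap addrC addKr.
    apply: le_trans (pol_le d s0 (bpart_le lam s0 hx0) (ltW hz)) _.
    by rewrite ler_piMr ?mulr_ge0// ltW.
  have b3 : cn ((pol d (cp y0) (hmap d lam x0 z) - pol d (cp y0) (hmap d lam y0 z)) 0 i)
      <= nm * s * lm * (nm * c).
    apply: coord_le.
    apply: le_trans (pol_lip d s0 (cpart_le lam s0 hy0) (hmap2 hx0 hz) (hmap2 hy0 hz)) _.
    rewrite ler_wpM2l ?mulr_ge0// /hmap opprD addrACA subrr add0r polB.
    apply: le_trans (pol_le (s := c) d c0 _ (ltW hz)) _ => [i' v|].
      by rewrite /bpart; case: ifP => _; rewrite ?subrr ?cn0.
    by rewrite ler_piMr ?mulr_ge0// ltW.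
  rewrite GE; apply: le_trans (cnB _ _) _; apply: le_trans (lerD (cnB _ _) (lexx _)) _.
  apply: le_trans (lerD (lerD b1 b2) b3) _; rewrite le_eqVlt; apply/orP; left; apply/eqP.
  by ring.
have G_sd z : vn z < 1 -> sdiff G z.
  move=> hz; apply: sdiffB; first by apply: sdiffB; exact: residue_vdiff.
  by apply: sdiff_sum => v; apply: sdiffZ; exact: sdiff_mon.
have sG := sdiff_sep G_sd G_le.
have G0 : G 0 = 0 by rewrite /G zx zy PE (_ : D 0 = 0) ?pol0 ?mxE ?subrr//;
  apply/rowP => j; rewrite !mxE mulr0.
by have := jet_le d w sG G0; rewrite (jet_eq sG G0 jG hw) (mulrC (be i w)).
Qed.

End FormalStep.

Section FormalTheorem.
Context {R : realType} {k : nat}.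
Local Notation C := (Cplx R).
Local Notation V := (Ck R k).
Implicit Types (z u : V) (i j : 'I_k) (w : seq 'I_k).
Context (d : nat) (lam : 'I_k -> C) (rho a : R).
Context (rho0 : 0 < rho) (rho1 : rho <= 1) (rho_lev : forall i, rho <= lev lam i).
Context (a0 : 0 <= a) (a1 : a < 1) (lev_a : forall i, lev lam i <= a).

Local Notation nm := (@nmon R k d).
Local Notation lm := (@lmon R d).

(** The coefficients of the conjugacies and of the polynomial maps, at all times
    together, solve a fixed point equation.  The equation for a monomial that is
    kept determines the coefficient of the polynomial map, that for any other
    monomial the coefficient of the conjugacy at time n from the one at time
    n + 1; the latter is contractive because there is no resonance. *)
Theorem formal_conjugation : exists2 s0 : R, 0 < s0 & exists2 c0 : R, 0 < c0 &
  forall s, 0 < s -> s <= s0 -> exists2 eta : R, 0 < eta &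
  forall f : nat -> V -> V,
    (forall n z, vn z < 1 -> vdiff (f n) z) -> (forall n, f n 0 = 0) ->
    (forall n z, vn z < 1 -> vn (f n z - diag lam z) <= eta) ->
  exists x : nat -> 'I_k -> seq 'I_k -> C,
    (forall n i w, cn (x n i w) <= s) /\
    forall n z, vn z < 1 ->
      vn (hmap d lam (x n.+1) (f n z) - gmap d lam (x n) (hmap d lam (x n) z))
        <= c0 * s * vn z ^+ d.+1.
Proof.
have n0 := nmon_ge0 (R := R) (k := k) d; have l0 := @lmon_ge0 R d.
have [theta /andP[th0 th1] nonres] := nonresonance a0 a1 lev_a.
pose F : R := 4 ^+ d; have F0 : 0 < F by rewrite exprn_gt0.
pose kap := (1 - theta) / 4 * rho.
have kap0 : 0 < kap by rewrite mulr_gt0//; lra.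
have [|s0 s00 hs0] := @ex_small R [:: (nm, 1); (nm * lm, 1); (F * (2 * nm ^+ 2 * lm), kap)].
  by rewrite /= kap0 !ltr01.
pose c0 : R := (4 * k%:R) ^+ d.+1 * (1 + 2 * nm) + 1.
have k40 : 0 <= (4 * k%:R : R) ^+ d.+1 by rewrite exprn_ge0// mulr_ge0.
exists s0 => //; exists c0.
  by rewrite /c0; have : 0 <= (4 * k%:R) ^+ d.+1 * (1 + 2 * nm) by [rewrite mulr_ge0//; lra]; lra.
move=> s s_gt0 ss0; have sge0 := ltW s_gt0.
have /and4P[nms nlms Qs _] := hs0 s sge0 ss0; rewrite /= in nms nlms Qs.
have [|eta eta0 heta] := @ex_small R
    [:: (1, s); (1, 1 - a); (F * (nm * lm), kap); (F, (1 - theta) / 2 * s * rho)].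
  rewrite /= s_gt0 kap0 subr_gt0 a1 !mulr_gt0//; lra.
exists eta => // f fd f0 fD.
have /and5P[es e1a Qe Fe _] := heta eta (ltW eta0) (lexx _); rewrite /= !mul1r in es e1a Qe Fe.
have f1 n z : vn z < 1 -> vn (f n z) <= 1.
  move=> hz; rewrite -(subrK (diag lam z) (f n z)); apply: le_trans (vnD _ _) _.
  have := fD n z hz; have := vn_diag a0 lev_a z; have := vn_ge0 z; move: a0 a1 e1a; nra.
pose T := (nat * 'I_k * seq 'I_k)%type.
pose co (X : T -> C) n i w := X (n, i, w).
pose J X n i w := jet d (fun z => residue d lam (f n) (co X n) (co X n.+1) z 0 i) w.
pose mu i w : C := if good lam i w then 1 else (lam i)^-1.
pose Gam X (t : T) : C := mu t.1.2 t.2 * J X t.1.1 t.1.2 t.2.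
have lam0 i : lam i != 0.
  by rewrite -cn_gt0; apply: lt_le_trans rho0 _; exact: rho_lev.
have mu_le i w : cn (mu i w) <= rho^-1.
  rewrite /mu; case: ifP => _; first by rewrite cn1 invf_ge1.
  by rewrite cnV lef_pV2 ?posrE ?cn_gt0//; exact: rho_lev.
have ri0 : 0 <= rho^-1 by rewrite invr_ge0 ltW.
have sep0 X n i : (forall t, cn (X t) <= s) ->
    sep (eta + nm * s * (1 + lm * (nm * s))) (fun z => residue d lam (f n) (co X n) (co X n.+1) z 0 i).
  move=> hX; apply: (residue_sep _ _ (fd n) (f1 n) (fD n)) => // i' w'; exact: hX.
have z0 X n i : residue d lam (f n) (co X n) (co X n.+1) 0 0 i = 0.
  by rewrite residue0// mxE.
have jout X n i w : w \notin jet_words d -> J X n i w = 0.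
  by move=> hw; rewrite /J /jet (negbTE hw).
have [||||||x [inx xfix _ _]] := @picard R T (fun=> 1) ((1 + theta) / 2) s Gam.
- by lra.
- by lra.
- exact: sge0.
- by [].
- move=> [[n i] w]; rewrite /Gam cnM /= mulr1.
  have hz : sep eta (fun z => residue d lam (f n) (co (fun=> 0) n) (co (fun=> 0) n.+1) z 0 i).
    have pz x z : (forall i w, x i w = 0) -> pol d x z = 0 :> V.
      by move=> hx; apply/rowP => j; rewrite !mxE big1// => v _; rewrite hx mul0r.
    apply: sdiff_sep => z hz; first by apply: residue_vdiff => //; exact: fd.
    apply: coord_le; rewrite /residue !pz ?subrr ?subr0 ?addr0 ?fD//;
      by move=> j v; rewrite /cpart /bpart /co; case: ifP.
  apply: le_trans (ler_pM (cn_ge0 _) (cn_ge0 _) (mu_le i w) (jet_le d w hz (z0 _ _ _))) _.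
  rewrite mulrC ler_pdivrMr//; apply: le_trans Fe _.
  by rewrite le_eqVlt; apply/orP; left; apply/eqP; field.
- move=> X Y c hX hY c_ge0 hXY [[n i] w]; rewrite /Gam /= -mulrBr cnM !mulr1.
  have {}hX t : cn (X t) <= s by have := hX t; rewrite mulr1.
  have {}hY t : cn (Y t) <= s by have := hY t; rewrite mulr1.
  have {}hXY t : cn (X t - Y t) <= c by have := hXY t; rewrite mulr1.
  have tc0 : 0 <= (1 + theta) / 2 * c by rewrite mulr_ge0//; lra.
  case: (boolP (w \in jet_words d)) => hw; last first.
    by rewrite !jout// subrr cn0 mulr0.
  have := @residue_jet _ _ d lam a a0 a1 lev_a (f n) eta s sge0 nms (fd n) (f0 n) (f1 n) (fD n)
    (co X n) (co X n.+1) (co Y n) (co Y n.+1) c i w.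
  have co_s Z m : (forall t, cn (Z t) <= s) -> small s (co Z m) by move=> h i' w'; exact: h.
  move=> /(_ (co_s _ _ hX) (co_s _ _ hX) (co_s _ _ hY) (co_s _ _ hY) c_ge0).
  move=> /(_ (fun i' w' => hXY _) (fun i' w' => hXY _) hw).
  rewrite -!/(J _ _ _ _); set jj := J X n i w - J Y n i w.
  pose be := bpart lam (co X n.+1) i w - bpart lam (co Y n.+1) i w; rewrite -/be => h.
  have {h} : cn (jj - lamw lam w * be) <= (1 - theta) / 2 * rho * c.
    apply: le_trans h _; rewrite mulrA ler_wpM2r//.
    by rewrite mulrDr -/F; move: Qe Qs; rewrite /kap; lra.
  rewrite /be /mu /bpart; case: ifP => hg.
    rewrite subrr mulr0 subr0 cn1 mul1r => h; apply: le_trans h _.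
    rewrite ler_wpM2r//; move: rho0 rho1 th0 th1; nra.
  move=> h; rewrite cnV mulrC ler_pdivrMr ?cn_gt0//.
  rewrite -(subrK (lamw lam w * (co X n.+1 i w - co Y n.+1 i w)) jj).
  apply: le_trans (cnD _ _) _; rewrite cnM.
  have n1 := nonres i w (jet_words_neq hw) (negbT hg).
  have n2 := ler_pM (cn_ge0 _) (cn_ge0 _) n1 (hXY (n.+1, i, w)).
  apply: le_trans (lerD h n2) _.
  have := rho_lev i; rewrite -/(lev lam i) => hr.
  have : (1 - theta) / 2 * rho * c <= (1 - theta) / 2 * lev lam i * c.
    by rewrite ler_wpM2r// ler_wpM2l//; lra.
  by move=> h3; apply: le_trans (lerD h3 (lexx _)) _; lra.
have {}inx t : cn (x t) <= s by have := inx t; rewrite mulr1.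
exists (co x); split => [n i w|n z hz]; first exact: inx.
rewrite residue_eq; apply: vn_le => [|i].
  by rewrite !mulr_ge0 ?exprn_ge0 ?vn_ge0// /c0 addr_ge0// mulr_ge0//; lra.
have entry (A p q : V) : (A - (diag lam p + q)) 0 i = A 0 i - (lam i * p 0 i + q 0 i).
  by rewrite !mxE.
rewrite entry [pol d (bpart _ _) _ 0 i]mxE [pol d (cpart _ _) _ 0 i]mxE.
have -> : lam i * (\sum_(w <- jet_words d) bpart lam (co x n) i w * mon w z)
    + \sum_(w <- jet_words d) cpart lam (co x n) i w * mon w z
    = \sum_(w <- jet_words d) J x n i w * mon w z.
  rewrite mulr_sumr -big_split; apply: eq_bigr => w _ /=.
  rewrite /bpart /cpart /co -(xfix (n, i, w)) /Gam /mu /=.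
  case: (good lam i w); first by rewrite mul0r mulr0 add0r mul1r.
  by rewrite mul0r addr0 !mulrA mulfV// mul1r.
have := jet_rem (d := d) (sep0 x n i inx) (z0 x n i) hz; rewrite -/(J x n i).
move=> h; apply: le_trans h _; rewrite ler_wpM2r ?exprn_ge0 ?vn_ge0//.
have ns0 : 0 <= nm * s by rewrite mulr_ge0.
have : eta + nm * s * (1 + lm * (nm * s)) <= (1 + 2 * nm) * s.
  have : lm * (nm * s) <= 1 by rewrite mulrA (mulrC lm).
  by move: es; nra.
move=> h; apply: le_trans (ler_wpM2l k40 h) _; rewrite mulrA.
by rewrite ler_wpM2r// /c0 lerDl ler01.
Qed.

End FormalTheorem.

(** * Holomorphic conjugation to a triangular polynomial map *)

Section HolomorphicConjugation.
Context {R : realType} {k : nat}.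
Local Notation C := (Cplx R).
Local Notation V := (Ck R k).
Implicit Types (z u : V) (i j : 'I_k) (w : seq 'I_k).
Context (d : nat) (lam : 'I_k -> C) (rho al a : R).
Context (rho0 : 0 < rho) (rho1 : rho <= 1) (rho_lev : forall i, rho <= lev lam i).
Context (al0 : 0 <= al) (lev_al : forall i, lev lam i <= al) (al_a : al < a) (a1 : a < 1).
Context (ad : a ^+ d.+1 <= rho / 2).

Local Notation nm := (@nmon R k d).
Local Notation lm := (@lmon R d).
Local Notation D := (diag lam).

Lemma schwarz_diag (f : V -> V) (eta : R) z :
  (forall z, vn z < 1 -> vdiff f z) -> f 0 = 0 ->
  (forall z, vn z < 1 -> vn (f z - D z) <= eta) -> 4 * eta <= a - al ->
  vn z < 1 -> vn (f z) <= a * vn z.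
Proof.
move=> fd f0 fD he hz; have z0 : 0 <= vn z := vn_ge0 z.
have a0 : 0 <= a by apply: le_trans al0 (ltW al_a).
have D0 : D 0 = 0 by apply/rowP => i; rewrite !mxE mulr0.
rewrite -(subrK (D z) (f z)); apply: le_trans (vnD _ _) _.
have h : vn (f z - D z) <= 4 * eta * vn z.
  have eta0 : 0 <= eta by apply: le_trans (vn_ge0 _) (fD _ hz).
  apply: vn_le => [|i]; first by rewrite !mulr_ge0.
  have := @sdiff_lipschitz _ _ (fun z => (f z - D z) 0 i) 0 1 eta z ltr01.
  rewrite f0 D0 !subr0 divr1 [(0 : V) 0 i]mxE subr0; apply => // u; rewrite subr0 => hu.
    by apply: (@vdiffB _ _ f D) => //; [exact: fd|move=> j; exact: sdiff_diag].
  by apply: coord_le; exact: fD.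
have h' := vn_diag al0 lev_al z.
apply: le_trans (lerD h h') _; rewrite -mulrDl ler_wpM2r//; lra.
Qed.

(** The formal conjugacies are corrected by maps that vanish to order d + 1.
    The corrections at time n are determined by those at time n + 1, and this
    equation is contractive, as a ^ (d + 1) is small compared with the strongest
    contraction of the linear part. *)
Theorem holomorphic_conjugation (tau : R) : 0 < tau -> exists2 eta : R, 0 < eta &
  forall f : nat -> V -> V,
    (forall n z, vn z < 1 -> vdiff (f n) z) -> (forall n, f n 0 = 0) ->
    (forall n z, vn z < 1 -> vn (f n z - D z) <= eta) ->
  exists (x : nat -> 'I_k -> seq 'I_k -> C) (Phi : nat -> V -> V),
    [/\ forall n i w, cn (x n i w) <= tau,
        forall n z, vn z < 1 -> vdiff (Phi n) z,
        forall n z, vn z < 1 -> vn (Phi n z - z) <= tau * vn z,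
        forall n z, vn z < 1 -> Phi n.+1 (f n z) = gmap d lam (x n) (Phi n z) &
        forall n z, vn z < 1 -> vn (f n z) <= a * vn z].
Proof.
move=> tau0.
have n0 := nmon_ge0 (R := R) (k := k) d; have l0 := @lmon_ge0 R d.
have a0 : 0 <= a by apply: le_trans al0 (ltW al_a).
have lev_a i : lev lam i <= a by apply: le_trans (lev_al i) (ltW al_a).
have [s0 s00 [c0 c00 main]] := formal_conjugation d rho0 rho1 rho_lev a0 a1 lev_a.
have ri0 : 0 < rho^-1 by rewrite invr_gt0.
pose B : R := 4 * rho^-1 * c0.
have B0 : 0 < B by rewrite !mulr_gt0.
have [|s s_gt0 hs] := @ex_small R [:: (1, s0); (nm, 2^-1); (nm * lm, rho / 4);
    (B, 2^-1); (nm + B, tau); (1, tau)].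
  by rewrite /= s00 tau0 divr_gt0// !invr_gt0 !ltr0n.
have sge0 := ltW s_gt0.
have /and5P[ss0 nms nlms Bs /and3P[taus staus _]] := hs s sge0 (lexx _).
rewrite /= !mul1r in ss0 nms nlms Bs taus staus.
have [eta1 eta10 {}main] := main s s_gt0 ss0.
exists (Num.min eta1 ((a - al) / 4)); first by rewrite lt_min eta10 divr_gt0// subr_gt0.
move=> f fd f0 fD.
have fD1 n z : vn z < 1 -> vn (f n z - D z) <= eta1.
  by move=> /(fD n); rewrite le_min => /andP[].
have fa n z : vn z < 1 -> vn (f n z) <= a * vn z.
  move=> hz; apply: (@schwarz_diag (f n) ((a - al) / 4)) => //; [exact: fd| |lra].
  by move=> u /(fD n); rewrite le_min => /andP[].
have f1 n z : vn z < 1 -> vn (f n z) < 1.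
  by move=> hz; apply: le_lt_trans (fa n z hz) _; have := vn_ge0 z; move: a0 a1; nra.
have [x [xs hE]] := main f fd f0 fD1.
pose h n := hmap d lam (x n).
pose c n := pol d (cpart lam (x n)) : V -> V.
pose E n z : V := h n.+1 (f n z) - gmap d lam (x n) (h n z).
have h_le n z : vn z < 1 -> vn (h n z) <= 3 / 2.
  move=> hz; apply: le_trans (vnD _ _) _.
  have b := pol_le d sge0 (bpart_le lam sge0 (xs n)) (ltW hz).
  have b' : nm * s * vn z <= 2^-1 * vn z by rewrite ler_wpM2r ?vn_ge0.
  lra.
pose T := (nat * V * 'I_k)%type.
pose rv (r : T -> C) n z : V := \row_i r (n, z, i).
pose wt (t : T) : R := vn t.1.2 ^+ d.+1.
pose Gam (r : T -> C) (t : T) : C := let: (n, z, i) := t in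
  if vn z < 1 then (lam i)^-1 * (E n z 0 i + r (n.+1, f n z, i)
    - (c n (h n z + rv r n z) - c n (h n z)) 0 i) else 0.
have wt0 t : 0 <= wt t by rewrite exprn_ge0// vn_ge0.
have wt1 z : vn z < 1 -> vn z ^+ d.+1 <= vn z.
  by move=> hz; rewrite -[leRHS]expr1; apply: ler_wiXn2l; rewrite ?vn_ge0// ltW.
have lam0 i : lam i != 0.
  by rewrite -cn_gt0; apply: lt_le_trans rho0 _; exact: rho_lev.
have lamV i : cn (lam i)^-1 <= rho^-1.
  by rewrite cnV lef_pV2 ?posrE ?cn_gt0//; exact: rho_lev.
have cls n : forall i w, cn (cpart lam (x n) i w) <= s by exact: cpart_le.
have rv_le r n z : inball wt (B * s) r -> vn z < 1 -> vn (rv r n z) <= 2^-1.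
  move=> hr hz; apply: vn_le => [|i]; first by lra.
  rewrite mxE; apply: le_trans (hr _) _; rewrite /wt /=.
  apply: le_trans Bs; rewrite ler_piMr ?(le_trans (wt1 _ hz)) ?(ltW hz)//.
  by rewrite mulr_ge0// ltW.
have [||||||r [rin rfix riter rlim]] := @picard R T wt (3 / 4) (B * s) Gam.
- by lra.
- by lra.
- by rewrite mulr_ge0// ltW.
- exact: wt0.
- move=> [[n z] i]; rewrite /Gam /wt /=; case: ifP => hz; last first.
    rewrite cn0; apply: mulr_ge0; last by rewrite exprn_ge0// vn_ge0.
    by apply: mulr_ge0; [lra|rewrite mulr_ge0// ltW].
  have -> : rv (fun=> 0) n z = 0 by apply/rowP => j; rewrite !mxE.
  rewrite !addr0 subrr [(0 : V) 0 i]mxE subr0 cnM.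
  apply: le_trans (ler_pM (cn_ge0 _) (cn_ge0 _) (lamV i) (coord_le i (hE n z hz))) _.
  by rewrite le_eqVlt; apply/orP; left; apply/eqP; rewrite /B; field; rewrite gt_eqF.
- move=> X Y e hX hY e0 hXY [[n z] i]; rewrite /Gam /wt /=.
  case: ifP => hz; last first.
    rewrite subrr cn0; apply: mulr_ge0; last by rewrite exprn_ge0// vn_ge0.
    by apply: mulr_ge0 => //; lra.
  set P := c n (h n z + rv X n z); set Q := c n (h n z + rv Y n z); set c1 := c n (h n z).
  rewrite -mulrBr (_ : _ - _ = (X (n.+1, f n z, i) - Y (n.+1, f n z, i)) - (P - Q) 0 i); last first.
    by rewrite !mxE; ring.
  have b1 : cn (X (n.+1, f n z, i) - Y (n.+1, f n z, i)) <= e * (rho / 2 * vn z ^+ d.+1).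
    apply: le_trans (hXY _) _; rewrite /wt /= ler_wpM2l//.
    apply: le_trans (_ : (a * vn z) ^+ d.+1 <= _).
      by apply: lerXn2r; rewrite ?nnegrE ?vn_ge0 ?mulr_ge0 ?vn_ge0// fa.
    by rewrite exprMn ler_wpM2r// exprn_ge0// vn_ge0.
  have b2 : cn ((P - Q) 0 i) <= rho / 4 * (e * vn z ^+ d.+1).
    apply: coord_le; rewrite /P /Q /c.
    apply: le_trans (pol_lip d sge0 (cls n) _ _) _.
    + by apply: le_trans (vnD _ _) _; have := h_le n z hz; have := rv_le X n z hX hz; lra.
    + by apply: le_trans (vnD _ _) _; have := h_le n z hz; have := rv_le Y n z hY hz; lra.
    + rewrite opprD addrACA subrr add0r; apply: ler_pM; rewrite ?vn_ge0 ?mulr_ge0//.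
        by rewrite mulrAC.
      apply: vn_le => [|j]; first by rewrite mulr_ge0// exprn_ge0// vn_ge0.
      by rewrite !mxE; exact: hXY.
  rewrite cnM; apply: le_trans (ler_pM (cn_ge0 _) (cn_ge0 _) (lamV i) (cnB _ _)) _.
  apply: le_trans (ler_wpM2l (ltW ri0) (lerD b1 b2)) _.
  by rewrite le_eqVlt; apply/orP; left; apply/eqP; field; rewrite gt_eqF.
have hol m : forall n i z, vn z < 1 -> sdiff (fun z => iter m Gam (fun=> 0) (n, z, i)) z.
  elim: m => [|m IH] n i z hz; first exact: sdiff_cst.
  set r' := iter m Gam (fun=> 0) in IH.
  have z1 : 0 < 1 - vn z by lra.
  pose g z := (lam i)^-1 * (E n z 0 i + r' (n.+1, f n z, i)
    - (c n (h n z + rv r' n z) - c n (h n z)) 0 i).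
  apply: (@sdiff_ext _ _ g _ _ (1 - vn z)) => // [u hu|].
    by rewrite iterS -/r' /Gam ifT// (le_lt_trans (vnD _ _))//; lra.
  have hh : vdiff (h n) z by exact: vdiff_hmap.
  have hc u : vdiff (c n) u by move=> l; exact: sdiff_pol.
  have hrv : vdiff (rv r' n) z.
    move=> l; apply: (@sdiff_ext _ _ (fun z => r' (n, z, l)) _ _ 1) => [//|u _|].
      by rewrite mxE.
    exact: IH.
  apply: sdiffZ; apply: sdiffB.
    apply: sdiffD.
      apply: (@vdiffB _ _ (fun z => h n.+1 (f n z))).
        by apply: vdiff_comp; [exact: vdiff_hmap|exact: fd].
      by apply: vdiff_comp => //; exact: vdiff_gmap.
    apply: (@sdiff_comp _ _ (fun z => r' (n.+1, z, i))); last exact: fd.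
    by apply: IH; exact: f1.
  apply: (@vdiffB _ _ (fun z => c n (h n z + rv r' n z))).
    by apply: vdiff_comp => //; exact: vdiffD.
  exact: vdiff_comp.
have r_sd n i z : vn z < 1 -> sdiff (fun z => r (n, z, i)) z.
  move=> hz; have z1 : 0 < 1 - vn z by lra.
  have near u : vn (u - z) < 1 - vn z -> vn u < 1.
    by move=> hu; rewrite -(subrK z u); apply: le_lt_trans (vnD _ _) _; lra.
  apply: (@sdiff_lim _ _ (fun m z => iter m Gam (fun=> 0) (n, z, i)) _ _ _ (B * s) z1).
  - by move=> m u /near; exact: hol.
  - move=> m u /near hu; apply: le_trans (riter m _) _; rewrite /wt /=.
    rewrite ler_piMr ?(le_trans (wt1 _ hu)) ?(ltW hu)//.
    by rewrite mulr_ge0// ltW.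
  - by move=> u _; exact: rlim.
exists x, (fun n z => h n z + rv r n z); split => //.
- by move=> n i w; apply: le_trans (xs n i w) staus.
- move=> n z hz; apply: vdiffD; first exact: vdiff_hmap.
  move=> l; apply: (@sdiff_ext _ _ (fun z => r (n, z, l)) _ _ 1) => [//|u _|].
    by rewrite mxE.
  exact: r_sd.
- move=> n z hz; rewrite /h /hmap addrAC [z + _]addrC addrK.
  apply: le_trans (vnD _ _) _.
  have b1 := pol_le d sge0 (bpart_le lam sge0 (xs n)) (ltW hz).
  have b2 : vn (rv r n z) <= B * s * vn z.
    have Bs0 : 0 <= B * s by rewrite mulr_ge0// ltW.
    apply: vn_le => [|i]; first by rewrite mulr_ge0// vn_ge0.
    by rewrite mxE; apply: le_trans (rin _) _; rewrite /wt /= ler_wpM2l// wt1.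
  apply: le_trans (lerD b1 b2) _; rewrite -mulrDl ler_wpM2r ?vn_ge0//.
  by rewrite -mulrDl.
- move=> n z hz; apply/rowP => i.
  have := rfix (n, z, i); rewrite /Gam hz => h1.
  have h2 : lam i * r (n, z, i) = E n z 0 i + r (n.+1, f n z, i)
      - (c n (h n z + rv r n z) - c n (h n z)) 0 i.
    by rewrite -h1 mulrA mulfV// mul1r.
  have h3 : gmap d lam (x n) (h n z + rv r n z) 0 i =
      lam i * h n z 0 i + lam i * r (n, z, i) + c n (h n z + rv r n z) 0 i.
    rewrite /gmap -/(c n _); move: (c n (h n z + rv r n z)) (h n z) => p q.
    by rewrite !mxE mulrDr.
  have h4 : E n z 0 i = h n.+1 (f n z) 0 i - (lam i * h n z 0 i + c n (h n z) 0 i).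
    rewrite /E /gmap -/(c n _); move: (c n (h n z)) (h n z) (h n.+1 (f n z)) => p q q'.
    by rewrite !mxE.
  rewrite h3 h2 h4; move: (c n (h n z + rv r n z)) (c n (h n z)) (h n z) (h n.+1 (f n z)).
  by move=> p q q1 q2; rewrite !mxE; ring.
Qed.

End HolomorphicConjugation.

(** * Local inversion near the identity *)

Section LocalInverse.
Context {R : realType} {k : nat}.
Local Notation C := (Cplx R).
Local Notation V := (Ck R k).
Implicit Types (z u y : V) (i j : 'I_k).
Context (Phi : V -> V) (tau : R).
Context (Phid : forall z, vn z < 1 -> vdiff Phi z).
Context (Phi1 : forall z, vn z < 1 -> vn (Phi z - z) <= tau * vn z).
Context (tau0 : 0 < tau) (tau1 : tau <= 1 / 32).

Let b z : V := Phi z - z.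

(** Cauchy's estimate; for distant points, the bound on the defect suffices. *)
Lemma defect_lip z u : vn z < 1 / 2 -> vn u < 1 / 2 ->
  vn (b u - b z) <= 1 / 4 * vn (u - z).
Proof.
move=> hz hu; have v0 := vn_ge0 (u - z).
have b1 y : vn y < 1 -> vn (b y) <= tau.
  move=> hy; apply: le_trans (Phi1 hy) _.
  by rewrite ler_piMr ?ltW.
have [h|h] := ltP (vn (u - z)) (1 / 2); last first.
  apply: le_trans (vnB _ _) _.
  have := b1 u ltac:(lra); have := b1 z ltac:(lra); move: tau1; lra.
apply: vn_le => [|i]; first by lra.
rewrite [(b u - b z) 0 i]mxE [(- b z) 0 i]mxE.
have near y : vn (y - z) < 1 / 2 -> vn y < 1.
  by move=> hy; rewrite -(subrK z y); apply: le_lt_trans (vnD _ _) _; lra.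
have h2 : 0 < 1 / 2 :> R by lra.
have := @sdiff_lipschitz _ _ (fun z => b z 0 i) z (1 / 2) tau u h2.
move=> /(_ _ _ h) h3; apply: le_trans (h3 _ _) _.
- move=> y /near hy; apply: (@vdiffB _ _ Phi id) => //; [exact: Phid|exact: vdiff_id].
- by move=> y /near hy; apply: coord_le; exact: b1.
- rewrite ler_wpM2r//; move: tau1; lra.
Qed.

Lemma near_id_inj z u : vn z < 1 / 2 -> vn u < 1 / 2 -> Phi z = Phi u -> z = u.
Proof.
move=> hz hu e; have := defect_lip hz hu.
have -> : b u - b z = z - u by apply/rowP => i; rewrite /b e !mxE; ring.
rewrite (vn_distC z).
have := vn_ge0 (u - z) => v0 h.
have /eqP : vn (u - z) = 0 by lra.
by rewrite vn_eq0 subr_eq0 => /eqP.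
Qed.

Theorem local_inverse : exists Psi : V -> V,
  [/\ forall y, vn y < 1 / 4 -> vdiff Psi y,
      forall y, vn y < 1 / 4 -> vn (Psi y) < 1 / 2,
      forall y, vn y < 1 / 4 -> Phi (Psi y) = y &
      forall z, vn z < 1 / 2 -> vn (Phi z) < 1 / 4 -> Psi (Phi z) = z].
Proof.
pose T := (V * 'I_k)%type.
pose pv (p : T -> C) y : V := \row_i p (y, i).
pose Gam (p : T -> C) (t : T) : C :=
  if vn t.1 < 1 / 4 then (t.1 - b (pv p t.1)) 0 t.2 else 0.
have b0 : b 0 = 0.
  apply/eqP; rewrite -vn_eq0 eq_le vn_ge0 andbT.
  by have := @Phi1 0; rewrite vn0 mulr0; apply.
have pv_le p y : inball (fun=> 1) (3 / 8) p -> vn (pv p y) <= 3 / 8.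
  move=> hp; apply: vn_le => [|i]; first by lra.
  by rewrite mxE; have := hp (y, i); rewrite mulr1.
(* The contraction y - b (.) with factor 1 / 4, on the ball of radius 3 / 8:
   this is the radius for which (1 - 1 / 4) * 3 / 8 exceeds 1 / 4. *)
have [||||||p [pin pfix piter plim]] := @picard R T (fun=> 1) (1 / 4) (3 / 8) Gam.
- by lra.
- by lra.
- by lra.
- by [].
- move=> [y i]; rewrite /Gam /= mulr1; case: ifP => hy; last by rewrite cn0; lra.
  have -> : pv (fun=> 0) y = 0 by apply/rowP => j; rewrite !mxE.
  by rewrite b0 subr0; apply: le_trans (cn_le_vn _ _) _; lra.
- move=> X Y c hX hY c0 hXY [y i]; rewrite /Gam /= mulr1; case: ifP => hy; last first.
    by rewrite subrr cn0; apply: mulr_ge0 => //; lra.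
  have -> : (y - b (pv X y)) 0 i - (y - b (pv Y y)) 0 i = (b (pv Y y) - b (pv X y)) 0 i.
    by move: (b (pv X y)) (b (pv Y y)) => p q; rewrite !mxE; ring.
  apply: coord_le; have hX' := pv_le X y hX; have hY' := pv_le Y y hY.
  apply: le_trans (@defect_lip (pv X y) (pv Y y) _ _) _; [lra|lra|].
  rewrite ler_wpM2l ?divr_ge0//.
  rewrite vn_distC; apply: vn_le => // j; rewrite !mxE.
  by have := hXY (y, j); rewrite mulr1.
have near y u : vn (u - y) < 1 / 4 - vn y -> vn u < 1 / 4.
  by move=> hu; rewrite -(subrK y u); apply: le_lt_trans (vnD _ _) _; lra.
have hol m : forall i y, vn y < 1 / 4 -> sdiff (fun y => iter m Gam (fun=> 0) (y, i)) y.
  elim: m => [|m IH] i y hy; first exact: sdiff_cst.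
  set p' := iter m Gam (fun=> 0) in IH.
  have y1 : 0 < 1 / 4 - vn y by lra.
  apply: (@sdiff_ext _ _ (fun y => (y - b (pv p' y)) 0 i) _ _ (1 / 4 - vn y)) => // [u hu|].
    by rewrite iterS -/p' /Gam /= ifT// (le_lt_trans (vnD _ _))//; lra.
  have hp : vdiff (pv p') y.
    move=> l; apply: (@sdiff_ext _ _ (fun y => p' (y, l)) _ _ 1) => [//|u _|].
      by rewrite mxE.
    exact: IH.
  have hpy : vn (pv p' y) < 1.
    by have := pv_le p' y (piter m); lra.
  apply: (@vdiffB _ _ id (fun y => b (pv p' y))); first exact: vdiff_id.
  apply: (@vdiff_comp _ _ b); last exact: hp.
  by apply: vdiffB; [exact: Phid|exact: vdiff_id].
have hP y : vn y < 1 / 4 -> Phi (pv p y) = y.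
  move=> hy; suff h : pv p y = y - b (pv p y) by rewrite -[RHS](subrK (b (pv p y))) -h /b addrC subrK.
  by apply/rowP => i; rewrite {1}/pv mxE -(pfix (y, i)) /Gam /= hy.
have P12 y : vn (pv p y) < 1 / 2 by have := pv_le p y pin; lra.
exists (pv p); split => //.
- move=> y hy l; apply: (@sdiff_ext _ _ (fun y => p (y, l)) _ _ 1) => [//|u _|].
    by rewrite mxE.
  have y1 : 0 < 1 / 4 - vn y by lra.
  apply: (@sdiff_lim _ _ (fun m y => iter m Gam (fun=> 0) (y, l)) _ _ _ (3 / 8) y1).
  + by move=> m u /near; exact: hol.
  + by move=> m u _; have := piter m (u, l); rewrite mulr1.
  + by move=> u _; exact: plim.
- by move=> z hz hPz; apply: near_id_inj => //; exact: hP.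
Qed.

End LocalInverse.

(** * Triangular polynomial maps *)

Section Triangular.
Context {R : realType} {k : nat}.
Local Notation C := (Cplx R).
Local Notation V := (Ck R k).
Implicit Types (z u v : V) (i j l : 'I_k) (w : seq 'I_k).
Context (d : nat) (lam : 'I_k -> C) (rho a tau : R).
Context (rho0 : 0 < rho) (rho_lev : forall i, rho <= lev lam i).
Context (a0 : 0 <= a) (lev_a : forall i, lev lam i <= a).
Context (tau0 : 0 <= tau).

Local Notation nm := (@nmon R k d).
Local Notation D := (diag lam).
Local Notation lv := (lev lam).

Context (tau_rho : nm * tau <= rho / 2) (tau_a : a + nm * tau < 1).

Definition same i w : bool := if w is [:: j] then lv j == lv i else false.
Definition spart (x : 'I_k -> seq 'I_k -> C) i w := if same i w then x i w else 0.
Definition lpart (x : 'I_k -> seq 'I_k -> C) i w := if same i w then 0 else cpart lam x i w.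

Lemma entryB (z u : V) i : (z - u) 0 i = z 0 i - u 0 i.
Proof. by rewrite !mxE. Qed.

Lemma lpart_low x i w j : lpart x i w != 0 -> j \in w -> lv i < lv j.
Proof.
rewrite /lpart /cpart /good; case: ifP => [_|hs]; first by rewrite eqxx.
case: ifP; last by rewrite eqxx.
by move=> /orP[/allP h _ /h //|]; rewrite -/(same i w) hs.
Qed.

(** The kept monomials of component i that are not linear involve only coordinates
    of smaller rank, which gives the maps their triangular structure. *)
Definition rank i : nat := #|[pred j | lv i < lv j]|.

Lemma rank_lt i j : lv i < lv j -> (rank j < rank i)%N.
Proof.
move=> h; apply: proper_card; apply/properP; split.
  by apply/fintype.subsetP => l; rewrite !inE; exact: lt_trans.
by exists j; rewrite !inE ?ltxx.
Qed.

Lemma rank_ltk i : (rank i < k)%N.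
Proof.
rewrite -[ltnRHS](card_ord k); apply: proper_card; apply/properP; split.
  by apply/fintype.subsetP => l; rewrite !inE.
by exists i; rewrite !inE ?ltxx.
Qed.

Lemma rank_same i j : lv i = lv j -> rank i = rank j.
Proof. by rewrite /rank => ->. Qed.

Lemma gmap_split x z : gmap d lam x z = (D z + pol d (spart x) z) + pol d (lpart x) z.
Proof.
rewrite /gmap -addrA; congr (_ + _); apply/rowP => i; rewrite !mxE -big_split.
apply: eq_bigr => w _ /=; rewrite -mulrDl; congr (_ * _).
rewrite /spart /lpart; case hs: (same i w); last by rewrite add0r.
by rewrite addr0 /cpart /good -/(same i w) hs orbT.
Qed.

Definition classmax i z : R := \big[Num.max/0]_(j | lv j == lv i) cn (z 0 j).

Lemma classmax_ge0 i z : 0 <= classmax i z.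
Proof. exact: bigmax_ge_id. Qed.

Lemma le_classmax i j z : lv j = lv i -> cn (z 0 j) <= classmax i z.
Proof.
by move=> h; apply: (le_bigmax_cond _ (fun j => cn (z 0 j))); apply/eqP.
Qed.

Lemma spart_le x i l z : (forall i w, cn (x i w) <= tau) -> lv l = lv i ->
  cn (pol d (spart x) z 0 l) <= nm * tau * classmax i z.
Proof.
move=> hx li; rewrite mxE -mulrA; apply: sum_jet_le => w _; rewrite cnM /spart.
case hs: (same l w); last by rewrite cn0 mul0r mulr_ge0 ?classmax_ge0.
apply: ler_pM; rewrite ?cn_ge0 ?hx//.
case: w hs => // j [|//] /= /eqP hj; rewrite /mon big_seq1.
by apply: le_classmax; rewrite hj.
Qed.

Definition linmat (x : 'I_k -> seq 'I_k -> C) : 'M[C]_k := \matrix_(j, i)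
  (lam i * (j == i)%:R + \sum_(w <- jet_words d) (w == [:: j])%:R * spart x i w).

Lemma linmatE x z : z *m linmat x = D z + pol d (spart x) z.
Proof.
apply/rowP => i; rewrite !mxE.
rewrite (eq_bigr (fun j => z 0 j * (lam i * (j == i)%:R) +
   \sum_(w <- jet_words d) z 0 j * ((w == [:: j])%:R * spart x i w))); last first.
  by move=> j _; rewrite mxE mulrDr mulr_sumr.
rewrite big_split /=; congr (_ + _).
  rewrite (bigD1 i)//= eqxx mulr1 mulrC big1 ?addr0// => j /negbTE ->.
  by rewrite !mulr0.
rewrite exchange_big; apply: eq_bigr => w _ /=.
rewrite /spart; case hs: (same i w); last first.
  by rewrite mul0r big1// => j _; rewrite !mulr0.
case: w hs => // l [|//] _; rewrite /mon big_seq1 (bigD1 l)//= eqxx mul1r mulrC.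
rewrite big1 ?addr0// => j /negbTE jl.
by rewrite (_ : ([:: l] == [:: j]) = false) ?mul0r ?mulr0//; apply/eqP => -[e]; rewrite e eqxx in jl.
Qed.

(** The linear part is dominated by its diagonal on each class of coordinates
    that are contracted equally. *)
Lemma linmat_class0 x z i : (forall i w, cn (x i w) <= tau) ->
  (forall l, lv l = lv i -> (z *m linmat x) 0 l = 0) -> z 0 i = 0.
Proof.
move=> hx hz; have m0 := classmax_ge0 i z.
have step l : lv l = lv i -> cn (z 0 l) <= 1 / 2 * classmax i z.
  move=> li; have := hz l li; rewrite linmatE mxE => /eqP; rewrite addr_eq0 => /eqP e.
  have := spart_le z hx li; rewrite -cnN -e mxE cnM -/(lv l) => h.
  have h1 : rho * cn (z 0 l) <= lv l * cn (z 0 l) by rewrite ler_wpM2r ?cn_ge0.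
  have h2 : nm * tau * classmax i z <= rho / 2 * classmax i z by rewrite ler_wpM2r.
  rewrite -(ler_pM2l rho0); lra.
have : classmax i z <= 1 / 2 * classmax i z.
  apply/bigmax_leP; split=> [|l /eqP li]; [lra|exact: step].
move=> h; have c0 : classmax i z = 0 by lra.
apply/eqP; rewrite -cn_eq0 eq_le cn_ge0 andbT -c0; exact: le_classmax.
Qed.

Lemma linmat_unit x : (forall i w, cn (x i w) <= tau) -> linmat x \in unitmx.
Proof.
move=> hx; rewrite -row_free_unit; apply: inj_row_free => v hv.
apply/rowP => i; rewrite [RHS]mxE; apply: (linmat_class0 hx) => l _.
by rewrite hv mxE.
Qed.

Lemma lpart_agree x z u m i :
  (forall j, (rank j < m)%N -> z 0 j = u 0 j) -> (rank i <= m)%N ->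
  pol d (lpart x) z 0 i = pol d (lpart x) u 0 i.
Proof.
move=> h hi; rewrite !mxE; apply: eq_bigr => w _.
have [->|ne] := eqVneq (lpart x i w) 0; first by rewrite !mul0r.
congr (_ * _); rewrite /mon; apply: eq_big_seq => j jw; apply: h.
by apply: leq_trans hi; apply: rank_lt; exact: (lpart_low ne jw).
Qed.

Lemma gmap_inj x : (forall i w, cn (x i w) <= tau) -> injective (gmap d lam x).
Proof.
move=> hx z u; rewrite !gmap_split -!linmatE => e.
have agree m : forall i, (rank i < m)%N -> z 0 i = u 0 i.
  elim: m => [//|m IH] i hi; apply/eqP; rewrite -subr_eq0; apply/eqP.
  suff : (z - u) 0 i = 0 by rewrite !mxE.
  apply: (linmat_class0 hx) => l li.
  have -> : (z - u) *m linmat x = pol d (lpart x) u - pol d (lpart x) z.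
    rewrite mulmxBl -[z *m _](addrK (pol d (lpart x) z)) e.
    by rewrite addrAC [u *m _ + _]addrC addrK.
  rewrite entryB (@lpart_agree _ z u m) ?subrr//.
  by rewrite (rank_same li).
by apply/rowP => i; exact: (agree k _ (rank_ltk i)).
Qed.

Lemma vdiff_mulmx (A : 'M[C]_k) z : vdiff (fun z => z *m A) z.
Proof.
move=> i; apply: (@sdiff_ext _ _ (fun z => \sum_j z 0 j * A j i) _ _ 1) => [//|h _|].
  by rewrite mxE.
by apply: sdiff_sum => j; apply: sdiffM; [exact: sdiff_coord|exact: sdiff_cst].
Qed.

(** Solving for the coordinates class by class amounts to iterating a map whose
    iterates become stationary after as many steps as there are coordinates. *)
Theorem gmap_automorphism x : (forall i w, cn (x i w) <= tau) ->
  exists G : V -> V, [/\ cancel (gmap d lam x) G, cancel G (gmap d lam x) &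
    forall z, vdiff G z].
Proof.
move=> hx; have U := linmat_unit hx; pose P := pol d (lpart x) : V -> V.
pose step v y : V := (v - P y) *m invmx (linmat x).
pose Y m v := iter m (step v) 0.
have stepM v y : step v y *m linmat x = v - P y by rewrite mulmxKV.
have YM m v : Y m.+1 v *m linmat x = v - P (Y m v) by exact: stepM.
have stat m : forall v i, (rank i < m)%N -> Y m.+1 v 0 i = Y m v 0 i.
  elim: m => [//|m IH] v i hi; apply/eqP; rewrite -subr_eq0; apply/eqP.
  suff : (Y m.+2 v - Y m.+1 v) 0 i = 0 by rewrite !mxE.
  apply: (linmat_class0 hx) => l li.
  rewrite mulmxBl !YM.
  rewrite opprB addrC addrA subrK entryB.
  rewrite /P (@lpart_agree x (Y m.+1 v) (Y m v) m) ?subrr//; first exact: IH.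
  by rewrite (rank_same li).
have YK v : Y k.+1 v = Y k v by apply/rowP => i; apply: stat; exact: rank_ltk.
have GK : cancel (Y k) (gmap d lam x).
  move=> v; rewrite gmap_split -linmatE -[X in X *m _]YK YM.
  exact: subrK.
exists (Y k); split => //.
  by move=> z; apply: (gmap_inj hx); exact: GK.
move=> z; suff h m : vdiff (Y m) z by exact: h.
elim: m => [|m IH]; first by move=> i; exact: sdiff_cst.
apply: (@vdiff_comp _ _ (fun y => y *m invmx (linmat x)) (fun v => v - P (Y m v))).
  exact: vdiff_mulmx.
apply: vdiffB; first exact: vdiff_id.
by apply: (@vdiff_comp _ _ P) => // i; exact: sdiff_pol.
Qed.

Lemma contraction_lim (th : R) (u e : nat -> R) : 0 <= th -> th < 1 ->
  (forall n, 0 <= u n) -> (forall n, u n.+1 <= th * u n + e n) ->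
  (forall c : R, 0 < c -> exists n0, forall n, (n0 <= n)%N -> e n < c) ->
  forall c : R, 0 < c -> exists n0, forall n, (n0 <= n)%N -> u n < c.
Proof.
move=> th0 th1 u0 hu he c c0.
have [n0 hn0] := he ((1 - th) * (c / 2)) ltac:(by rewrite mulr_gt0; lra).
have bnd m : u (n0 + m)%N <= th ^+ m * u n0 + c / 2.
  elim: m => [|m IH]; first by rewrite addn0 expr0 mul1r; lra.
  rewrite addnS; apply: le_trans (hu _) _; rewrite exprS.
  have := hn0 (n0 + m)%N (leq_addr _ _) => h.
  have := ler_wpM2l th0 IH; rewrite mulrDr mulrA; lra.
have c2 : 0 < c / (2 * (u n0 + 1)) by rewrite divr_gt0// mulr_gt0//; have := u0 n0; lra.
have [n1 hn1] := expr_small th0 th1 c2.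
exists (n0 + n1)%N => n hn; have h1 : (n0 <= n)%N by exact: leq_trans (leq_addr _ _) hn.
have := hn1 (n - n0)%N ltac:(by rewrite leq_subRL).
have u1 : 0 < 2 * (u n0 + 1) by have := u0 n0; lra.
rewrite ltr_pdivlMr// => h2; have := bnd (n - n0)%N; rewrite subnKC// => h3.
have := exprn_ge0 (n - n0) th0 => h4.
by apply: le_lt_trans h3 _; nra.
Qed.

Lemma climM0 (s t : nat -> C) (c : C) : clim s 0 -> clim t c -> clim (fun n => s n * t n) 0.
Proof.
move=> hs ht e e0; have l0 := cn_ge0 c; have l1 : 0 < cn c + 1 by lra.
have [n1 h1] := hs _ (divr_gt0 e0 l1); have [n2 h2] := ht 1 ltr01.
exists (maxn n1 n2) => n; rewrite geq_max => /andP[/h1 k1 /h2 k2].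
rewrite subr0 cnM; rewrite subr0 ltr_pdivlMr// in k1; apply: le_lt_trans k1.
rewrite ler_wpM2l ?cn_ge0//.
by have := cn_dist_add c (t n) 0; rewrite !subr0; lra.
Qed.

(** On each class of coordinates that are contracted equally, the maps act as
    contractions driven by monomials in the coordinates of smaller rank, which
    tend to zero by induction. *)
Theorem gmap_orbit (x : nat -> 'I_k -> seq 'I_k -> C) (y : nat -> V) :
  (forall n i w, cn (x n i w) <= tau) ->
  (forall n, y n.+1 = gmap d lam (x n) (y n)) ->
  forall e : R, 0 < e -> exists n0, forall n, (n0 <= n)%N -> vn (y n) < e.
Proof.
move=> hx hy.
have coords m : forall i, (rank i < m)%N -> clim (fun n => y n 0 i) 0.
  elim: m => [//|m IH] i hi.
  have low j : lv i < lv j -> clim (fun n => y n 0 j) 0.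
    by move=> h; apply: IH; exact: leq_trans (rank_lt h) _.
  have monlim w : w != [::] -> all (fun j => lv i < lv j) w ->
      clim (fun n => mon w (y n)) 0.
    elim: w => [//|j [|j' w] IHw] _ /= /andP[hj hw].
      by apply: eq_clim (low j hj) => n; rewrite /mon big_seq1.
    apply: eq_clim (climM0 (low j hj) (IHw isT hw)) => n.
    by rewrite [RHS]/mon big_cons.
  have lplim l : lv l = lv i -> forall c : R, 0 < c -> exists n0, forall n, (n0 <= n)%N ->
      cn (pol d (lpart (x n)) (y n) 0 l) < c.
    move=> li c c0.
    have hw0 : forall w, clim (fun n =>
        rc (tau * (if (w != [::]) && all (fun j => lv i < lv j) w then cn (mon w (y n)) else 0))) 0.
      move=> w; case: (boolP ((w != [::]) && _)) => [/andP[w0 hw]|_]; last first.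
        by rewrite mulr0 rc0; exact: clim_cst.
      have hc : clim (fun n => rc (cn (mon w (y n)))) 0.
        move=> e /(monlim w w0 hw)[n0 h]; exists n0 => n /h.
        by rewrite !subr0 cn_rc ger0_norm ?cn_ge0.
      by have := climZ (rc tau) hc; rewrite mulr0; apply: eq_clim => n; rewrite rcM.
    have := clim_sum (jet_words d) hw0.
    rewrite big1// => /(_ _ c0)[n0 h]; exists n0 => n /h; rewrite subr0.
    apply: le_lt_trans; rewrite [X in cn X <= _]mxE; apply: le_trans (cn_sum _ _ _) _.
    have rcsum (s : seq (seq 'I_k)) (F : seq 'I_k -> R) : \sum_(w <- s) rc (F w) = rc (\sum_(w <- s) F w).
      by rewrite (big_morph _ (@rcD R) (@rc0 R)).
    rewrite rcsum cn_rc; apply: le_trans (ler_norm _).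
    rewrite big_seq [leRHS]big_seq; apply: ler_sum => w hw.
    have [->|ne] := eqVneq (lpart (x n) l w) 0.
      by rewrite mul0r cn0 mulr_ge0//; case: ifP => // _; exact: cn_ge0.
    rewrite (jet_words_neq hw) /= ifT; last first.
      by apply/allP => j jw; rewrite -li; exact: (lpart_low ne jw).
    rewrite cnM ler_wpM2r ?cn_ge0// /lpart; case: ifP => _; first by rewrite cn0.
    by apply: cpart_le => //; exact: hx.
  have step n : classmax i (y n.+1) <= (a + nm * tau) * classmax i (y n) +
      \sum_(l | lv l == lv i) cn (pol d (lpart (x n)) (y n) 0 l).
    apply/bigmax_leP; split=> [|l hl].
      rewrite addr_ge0 ?sumr_ge0// => [|l _]; last exact: cn_ge0.
      by rewrite mulr_ge0 ?classmax_ge0// addr_ge0// mulr_ge0// nmon_ge0.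
    have li := eqP hl; rewrite hy gmap_split.
    rewrite [X in cn X]mxE; apply: le_trans (cnD _ _) _; apply: lerD; last first.
      rewrite (bigD1 l)//= lerDl sumr_ge0// => j _; exact: cn_ge0.
    rewrite [X in cn X]mxE; apply: le_trans (cnD _ _) _; rewrite mulrDl; apply: lerD.
      rewrite mxE cnM; apply: ler_pM; rewrite ?cn_ge0//; first exact: lev_a.
      exact: le_classmax.
    exact: spart_le.
  have th0 : 0 <= a + nm * tau by rewrite addr_ge0// mulr_ge0// nmon_ge0.
  move=> e e0; have [|n0 h] := contraction_lim th0 tau_a (fun n => classmax_ge0 i (y n)) step _ e0.
    move=> c c0; pose c' := c / (k%:R + 1).
    have k1 : 0 < k%:R + 1 :> R by have := ler0n R k; lra.
    have /choice[nl hnl] : forall l, exists n0, lv l = lv i -> forall n, (n0 <= n)%N ->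
        cn (pol d (lpart (x n)) (y n) 0 l) < c'.
      move=> l; have [li|ne] := eqVneq (lv l) (lv i); last by exists 0%N => h; rewrite h eqxx in ne.
      by have [n0 h] := lplim l li _ (divr_gt0 c0 k1); exists n0.
    exists (\max_l nl l) => n hn.
    apply: le_lt_trans (_ : _ <= \sum_(l : 'I_k) c') _.
      rewrite big_mkcond; apply: ler_sum => l _; case: ifP => [/eqP li|_].
        by apply/ltW/hnl => //; apply: leq_trans hn; exact: leq_bigmax.
      by rewrite divr_ge0// ltW.
    rewrite sumr_const card_ord -(mulr_natr c') /c' mulrAC ltr_pdivrMr//.
    by rewrite ltr_pM2l// ltrDl.
  exists n0 => n /h; rewrite subr0; apply: le_lt_trans; exact: le_classmax.
move=> e e0.
have /choice[nl hnl] : forall i, exists n0, forall n, (n0 <= n)%N -> cn (y n 0 i) < e.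
  move=> i; have [n0 h] := coords k i (rank_ltk i) e e0.
  by exists n0 => n /h; rewrite subr0.
exists (\max_i nl i) => n hn; apply: vn_lt => // i; apply: hnl.
by apply: leq_trans hn; exact: leq_bigmax.
Qed.

End Triangular.

(** * The basin of a normalized sequence *)

Section Composition.
Context {T : Type}.

Fixpoint comp_inv (g : nat -> T -> T) (n : nat) : T -> T :=
  if n is m.+1 then comp_inv g m \o g m else id.

Lemma comp_uptoK (f g : nat -> T -> T) n : (forall n, cancel (f n) (g n)) ->
  cancel (comp_upto f n) (comp_inv g n).
Proof. by move=> h; elim: n => [//|n IH] x /=; rewrite h IH. Qed.

Lemma comp_invK (f g : nat -> T -> T) n : (forall n, cancel (g n) (f n)) ->
  cancel (comp_inv g n) (comp_upto f n).
Proof. by move=> h; elim: n => [//|n IH] x /=; rewrite IH h. Qed.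

End Composition.

Section NormalizedBasin.
Context {R : realType} {k : nat}.
Local Notation C := (Cplx R).
Local Notation V := (Ck R k).
Implicit Types (z u x y : V) (i j : 'I_k).

Lemma vdiff_comp_upto (f : nat -> V -> V) n z : (forall n z, vdiff (f n) z) ->
  vdiff (comp_upto f n) z.
Proof.
move=> h; elim: n z => [|n IH] z; first exact: vdiff_id.
by apply: (@vdiff_comp _ _ (f n)); [exact: h|exact: IH].
Qed.

Lemma vdiff_comp_inv (f : nat -> V -> V) n z : (forall n z, vdiff (f n) z) ->
  vdiff (comp_inv f n) z.
Proof.
move=> h; elim: n z => [|n IH] z; first exact: vdiff_id.
by apply: (@vdiff_comp _ _ (comp_inv f n)); [exact: IH|exact: h].
Qed.

Lemma vdiff_near (F G : V -> V) z (r : R) : 0 < r ->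
  (forall u, vn (u - z) < r -> F u = G u) -> vdiff F z -> vdiff G z.
Proof.
move=> r0 h hF i; apply: (sdiff_ext r0) (hF i) => u hu.
by rewrite h// addrC addKr.
Qed.

Lemma vdiff_small (F : V -> V) z (c : R) : vdiff F z -> vn (F z) < c ->
  exists2 r : R, 0 < r & forall u, vn (u - z) < r -> vn (F u) < c.
Proof.
move=> hF hz; have e0 : 0 < c - vn (F z) by rewrite subr_gt0.
have [r r0 hr] := vdiff_cont hF e0; exists r => // u /hr h.
by rewrite -(subrK (F z) (F u)); apply: le_lt_trans (vnD _ _) _; lra.
Qed.

Lemma orbit_decay (f : nat -> V -> V) (a : R) n m z : 0 <= a -> a < 1 ->
  (forall n z, vn z < 1 -> vn (f n z) <= a * vn z) -> vn (comp_upto f n z) < 1 ->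
  vn (comp_upto f (n + m) z) <= a ^+ m * vn (comp_upto f n z).
Proof.
move=> a0 a1 fa h; elim: m => [|m IH]; first by rewrite addn0 expr0 mul1r.
rewrite addnS /= exprS -mulrA.
have v0 := vn_ge0 (comp_upto f n z); have am : a ^+ m <= 1 by rewrite exprn_ile1// ltW.
apply: le_trans (fa _ _ _) _; last by rewrite ler_wpM2l.
by apply: le_lt_trans IH _; have := exprn_ge0 m a0; nra.
Qed.

Definition nbasin (f : nat -> V -> V) : set V :=
  [set z | exists n, vn (comp_upto f n z) < 1 / 8].

(** The local conjugacies Phi n with polynomial automorphisms are propagated to
    the whole basin by the dynamics.  This turns them into an isomorphism with the
    basin of the polynomial automorphisms, which is the whole space. *)
Theorem normalized_basin (lam : 'I_k -> C) : (forall i, 0 < lev lam i < 1) ->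
  exists eta a : R, [/\ 0 < eta, 0 <= a, a < 1 &
  forall f fi : nat -> V -> V,
    (forall n, cancel (f n) (fi n)) -> (forall n, cancel (fi n) (f n)) ->
    (forall n z, vdiff (f n) z) -> (forall n z, vdiff (fi n) z) ->
    (forall n, f n 0 = 0) ->
    (forall n z, vn z < 1 -> vn (f n z - diag lam z) <= eta) ->
  (forall n z, vn z < 1 -> vn (f n z) <= a * vn z) /\
  exists H G : V -> V,
    [/\ forall z, nbasin f z -> vdiff H z, forall y, vdiff G y,
        forall y, nbasin f (G y), forall z, nbasin f z -> G (H z) = z &
        forall y, H (G y) = y]].
Proof.
move=> hlam.
pose rho : R := \big[Num.min/1]_i lev lam i.
pose al : R := \big[Num.max/0]_i lev lam i.
have rho0 : 0 < rho by apply/bigmin_gtP; split => // i _; have /andP[] := hlam i.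
have rho1 : rho <= 1 by exact: bigmin_le_id.
have rho_lev i : rho <= lev lam i by exact: bigmin_le.
have al0 : 0 <= al by exact: bigmax_ge_id.
have al1 : al < 1 by apply/bigmax_ltP; split => // i _; have /andP[] := hlam i.
have lev_al i : lev lam i <= al by exact: (le_bigmax _ (fun i => lev lam i)).
pose a := (1 + al) / 2.
have al_a : al < a by rewrite /a; lra.
have a0 : 0 <= a by lra.
have a1 : a < 1 by rewrite /a; lra.
have lev_a i : lev lam i <= a by apply: le_trans (lev_al i) (ltW al_a).
have [d hd] := @expr_small R a a0 a1 (rho / 2) ltac:(lra).
have {hd} ad : a ^+ d.+1 <= rho / 2 by apply/ltW/hd; exact: leqnSn.
have [|tau tau0 htau] := @ex_small R
    [:: (@nmon R k d, rho / 2); (@nmon R k d, (1 - a) / 2); (1, 1 / 32)].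
  by rewrite /= !divr_gt0 ?subr_gt0.
have /and4P[t1 t2 t3 _] := htau tau (ltW tau0) (lexx _).
rewrite /= in t1 t2 t3; rewrite !mul1r -[32^-1]mul1r in t3.
have ta : a + @nmon R k d * tau < 1 by lra.
have tge0 := ltW tau0.
have [eta eta0 main] := holomorphic_conjugation rho0 rho1 rho_lev al0 lev_al al_a a1 ad tau0.
exists eta, a; split => // f fi fK fiK fd fid f0 fD.
have [x [Phi [xs Phid Phi1 conj fa]]] := main f (fun n z _ => fd n z) f0 fD.
split; first exact: fa.
pose g n := gmap d lam (x n).
have /choice[gi hgi] : forall n, exists G : V -> V,
    [/\ cancel (g n) G, cancel G (g n) & forall z, vdiff G z].
  by move=> n; exact: (gmap_automorphism rho0 rho_lev tge0 t1 (xs n)).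
have gK n : cancel (g n) (gi n) by have [] := hgi n.
have giK n : cancel (gi n) (g n) by have [] := hgi n.
have gid n z : vdiff (gi n) z by have [_ _] := hgi n; exact.
have gd n z : vdiff (g n) z by exact: vdiff_gmap.
have /choice[Psi hPsi] : forall n, exists P : V -> V,
    [/\ forall y, vn y < 1 / 4 -> vdiff P y,
      forall y, vn y < 1 / 4 -> vn (P y) < 1 / 2,
      forall y, vn y < 1 / 4 -> Phi n (P y) = y &
      forall z, vn z < 1 / 2 -> vn (Phi n z) < 1 / 4 -> P (Phi n z) = z].
  by move=> n; exact: (local_inverse (Phid n) (Phi1 n) tau0 t3).
pose F n := comp_upto f n; pose Fi n := comp_inv fi n.
pose gc n := comp_upto g n; pose gci n := comp_inv gi n.
have FK n : cancel (F n) (Fi n) by exact: comp_uptoK.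
have FiK n : cancel (Fi n) (F n) by exact: comp_invK.
have gcK n : cancel (gc n) (gci n) by exact: comp_uptoK.
have gciK n : cancel (gci n) (gc n) by exact: comp_invK.
have Fd n z : vdiff (F n) z by exact: vdiff_comp_upto.
have Fid n z : vdiff (Fi n) z by exact: vdiff_comp_inv.
have gcd n z : vdiff (gc n) z by exact: vdiff_comp_upto.
have gcid n z : vdiff (gci n) z by exact: vdiff_comp_inv.
have decay n m z : vn (F n z) < 1 -> vn (F (n + m)%N z) <= a ^+ m * vn (F n z).
  by apply: orbit_decay => // l y; exact: fa.
have decay1 n m z : (n <= m)%N -> vn (F n z) < 1 -> vn (F m z) <= vn (F n z).
  move=> nm h; rewrite -(subnKC nm); apply: le_trans (decay _ _ _ h) _.
  by rewrite ler_piMl ?vn_ge0// exprn_ile1// ltW.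
(* Near a point of the basin, Hn n does not depend on n, for n large. *)
pose Hn n z := gci n (Phi n (F n z)).
have HnS n z : vn (F n z) < 1 -> Hn n.+1 z = Hn n z.
  move=> h; rewrite /Hn /gci /= -/(gci n); congr (gci n _).
  by rewrite /F /= -/(F n) (conj _ _ h) gK.
have Hn_eq n m z : (n <= m)%N -> vn (F n z) < 1 -> Hn m z = Hn n z.
  move=> nm h; rewrite -(subnKC nm); elim: (m - n)%N => [|l IH]; first by rewrite addn0.
  by rewrite addnS HnS ?IH//; apply: (le_lt_trans _ h); apply: decay1; rewrite ?leq_addr.
pose nu z := xget 0%N [set n | vn (F n z) < 1 / 8].
pose H z := Hn (nu z) z.
have lt1 (r : R) : r < 1 / 8 -> r < 1 by lra.
have H_eq n z : vn (F n z) < 1 / 8 -> H z = Hn n z.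
  move=> h; have h' : vn (F (nu z) z) < 1 / 8.
    by apply: (@xgetPex _ 0%N [set n | vn (F n z) < 1 / 8]); exists n.
  rewrite /H -(Hn_eq _ (maxn (nu z) n) z (leq_maxl _ _) (lt1 _ h')).
  exact: Hn_eq (leq_maxr _ _) (lt1 _ h).
pose Gn n y := Fi n (Psi n (gc n y)).
have Psi_le n y : vn y < 1 / 4 -> vn (Psi n y) <= 32 / 31 * vn y.
  move=> hy; have [_ P1 P2 _] := hPsi n; have p1 := P1 y hy.
  have := Phi1 n (Psi n y) ltac:(lra); rewrite (P2 y hy) => h.
  have := vnB y (y - Psi n y); rewrite subKr => h'.
  have : tau * vn (Psi n y) <= 1 / 32 * vn (Psi n y) by rewrite ler_wpM2r ?vn_ge0.
  lra.
(* Once the polynomial orbit of y is small, the inverse conjugacies turn it into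
   an orbit of the given sequence. *)
have follow n m y : vn (gc n y) < 1 / 8 -> (n <= m)%N ->
    [/\ vn (F m (Gn n y)) < 1 / 6, Phi m (F m (Gn n y)) = gc m y & Gn m y = Gn n y].
  move=> hy nm; set z := Gn n y.
  have Fz : F n z = Psi n (gc n y) by rewrite /z /Gn FiK.
  have h0 : vn (F n z) < 1 / 6.
    by rewrite Fz; have := Psi_le n (gc n y) ltac:(lra); have := vn_ge0 (gc n y); lra.
  have hm l : (n <= l)%N -> vn (F l z) < 1 / 6.
    by move=> nl; apply: (le_lt_trans (decay1 _ _ _ nl _) h0); lra.
  have hP : Phi m (F m z) = gc m y.
    rewrite -(subnKC nm); elim: (m - n)%N => [|l IH].
      by rewrite addn0 Fz; have [_ _ -> //] := hPsi n; lra.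
    rewrite addnS /F /= -/(F _) conj ?IH//.
    by have := hm (n + l)%N (leq_addr _ _); lra.
  split => //; first exact: hm.
  rewrite {1}/Gn -hP; have [_ _ _ ->] := hPsi m; first by rewrite FK.
    by have := hm m nm; lra.
  have := Phi1 m (F m z) ltac:(by have := hm m nm; lra).
  have := vnD (Phi m (F m z) - F m z) (F m z); rewrite subrK.
  have : tau * vn (F m z) <= 1 / 32 * vn (F m z) by rewrite ler_wpM2r ?vn_ge0.
  by have := hm m nm; lra.
have orbit (c : R) : 0 < c -> forall y, exists n, vn (gc n y) < c.
  move=> c0 y.
  have [n0 h] := gmap_orbit a0 lev_a tge0 ta xs (fun n => erefl (gc n.+1 y)) c0.
  by exists n0; apply: h.
pose nu' y := xget 0%N [set n | vn (gc n y) < 1 / 8].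
pose G y := Gn (nu' y) y.
have G_eq n y : vn (gc n y) < 1 / 8 -> G y = Gn n y.
  move=> h; have h' : vn (gc (nu' y) y) < 1 / 8.
    by apply: (@xgetPex _ 0%N [set n | vn (gc n y) < 1 / 8]); exists n.
  have [_ _ e1] := follow _ (maxn (nu' y) n) _ h' (leq_maxl _ _).
  by have [_ _ e2] := follow _ (maxn (nu' y) n) _ h (leq_maxr _ _); rewrite /G -e1.
have c16 : 0 < 1 / 16 :> R by lra.
have FG n y : vn (gc n y) < 1 / 8 -> F n (G y) = Psi n (gc n y).
  by move=> h; rewrite (G_eq _ _ h) /Gn FiK.
exists H, G; split.
- move=> z [n hn]; have [r r0 hr] := vdiff_small (Fd n z) hn.
  apply: (vdiff_near r0 (F := Hn n)) => [u /hr hu|]; first by rewrite (H_eq n).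
  apply: (@vdiff_comp _ _ (gci n) (fun z => Phi n (F n z))); first exact: gcid.
  by apply: (@vdiff_comp _ _ (Phi n)); [apply: Phid; exact: lt1|exact: Fd].
- move=> y; have [n hn] := orbit (1 / 8) ltac:(lra) y.
  have [r r0 hr] := vdiff_small (gcd n y) hn.
  apply: (vdiff_near r0 (F := Gn n)) => [u /hr hu|]; first by rewrite (G_eq n).
  apply: (@vdiff_comp _ _ (Fi n) (fun y => Psi n (gc n y))); first exact: Fid.
  apply: (@vdiff_comp _ _ (Psi n)); last exact: gcd.
  by have [P0 _ _ _] := hPsi n; apply: P0; lra.
- move=> y; have [n hn] := orbit _ c16 y; exists n.
  rewrite -/(F n) FG; last by lra.
  by have := Psi_le n (gc n y) ltac:(lra); have := vn_ge0 (gc n y); lra.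
- move=> z [n hn]; rewrite -/(F n) in hn.
  have [m hm] := @expr_small R a a0 a1 (1 / 2) ltac:(lra).
  have {hm} am : a ^+ m < 1 / 2 by exact: hm.
  pose N := (n + m)%N.
  have hN : vn (F N z) < 1 / 16.
    apply: le_lt_trans (decay _ _ _ (lt1 _ hn)) _.
    by have := vn_ge0 (F n z); have := exprn_ge0 m a0; nra.
  have hP : vn (Phi N (F N z)) < 1 / 8.
    have := Phi1 N (F N z) ltac:(lra).
    have := vnD (Phi N (F N z) - F N z) (F N z); rewrite subrK.
    have : tau * vn (F N z) <= 1 / 32 * vn (F N z) by rewrite ler_wpM2r ?vn_ge0.
    by lra.
  have hH : gc N (H z) = Phi N (F N z) by rewrite (H_eq N) ?gciK//; lra.
  rewrite (G_eq N); last by rewrite hH.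
  rewrite /Gn hH; have [_ _ _ ->] := hPsi N; [exact: FK|lra|lra].
- move=> y; have [n hn] := orbit _ c16 y.
  have h8 : vn (gc n y) < 1 / 8 by lra.
  rewrite (H_eq n); last first.
    rewrite FG//.
    by have := Psi_le n (gc n y) ltac:(lra); have := vn_ge0 (gc n y); lra.
  by rewrite /Hn FG//; have [_ _ e _] := hPsi n; rewrite e ?gcK//; lra.
Qed.

End NormalizedBasin.

(** * The derivative as a matrix, and its almost diagonal forms *)

Section Jacobian.
Context {R : realType} {k : nat}.
Local Notation C := (Cplx R).
Local Notation V := (Ck R k).
Implicit Types (F : V -> V) (z : V) (A : 'M[C]_k).

Definition opn A : R := \sum_i \sum_j cn (A i j).

Lemma opn_ge0 A : 0 <= opn A.
Proof. by apply: sumr_ge0 => i _; apply: sumr_ge0 => j _; exact: cn_ge0. Qed.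

Lemma vn_mulmx A z : vn (z *m A) <= opn A * vn z.
Proof.
apply: vn_le => [|i]; first by rewrite mulr_ge0 ?opn_ge0 ?vn_ge0.
rewrite mxE /opn mulr_suml; apply: le_trans (cn_sum _ _ _) _.
apply: ler_sum => j _; rewrite cnM mulrC ler_pM ?cn_ge0 ?cn_le_vn//.
by rewrite (bigD1 i)//= lerDl sumr_ge0// => l _; exact: cn_ge0.
Qed.

Lemma differentiable_jac F z : differentiable F z -> forall eps : R, 0 < eps ->
  exists2 d : R, 0 < d &
  forall h, vn h < d -> vn (F (z + h) - F z - h *m 'J F z) <= eps * vn h.
Proof.
move=> /diff_locally /eqaddoP h eps e0.
have := h (rc eps); rewrite -rc0 lt_rc => /(_ e0) /nbhs_vn[d d0 hd].
exists d => // y hy; have := hd y; rewrite subr0 => /(_ hy).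
rewrite /= !mx_norm_vn -rcM le_rc /jacobian mul_rV_lin1 => H.
apply: le_trans H; rewrite le_eqVlt; apply/orP; left; apply/eqP; congr vn.
by rewrite /= !fctE /= [y + z]addrC opprD addrA.
Qed.

Lemma differentiable_vdiff F z : differentiable F z -> vdiff F z.
Proof.
move=> /differentiable_jac h i; exists (fun j => 'J F z j i) => eps e0.
have [d d0 hd] := h eps e0; exists d => // y /hd; apply: le_trans.
apply: le_trans (cn_le_vn _ i); rewrite le_eqVlt; apply/orP; left; apply/eqP.
by rewrite !mxE.
Qed.

Lemma continuous_mulmx A : continuous (mulmxr A : V -> V).
Proof.
move=> z U /nbhs_vn[d d0 h]; apply/nbhs_vn.
have o0 := opn_ge0 A; exists (d / (1 + opn A)); first by rewrite divr_gt0//; lra.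
move=> w hw; apply: h; rewrite /= -mulmxBl; apply: le_lt_trans (vn_mulmx _ _) _.
move: hw; rewrite ltr_pdivlMr; last by lra.
by apply: le_lt_trans; rewrite mulrC ler_wpM2l ?vn_ge0//; lra.
Qed.

Lemma vdiff_differentiable F z : vdiff F z -> differentiable F z.
Proof.
move=> /choice[p hp]; pose A : 'M[C]_k := \matrix_(j, i) p i j.
have dF : F \o shift z = cst (F z) + (mulmxr A : V -> V) +o_ (0 : V) id.
  apply/eqaddoP => e /pos_rc[c c0 ->].
  have /choice[d hd] : forall i, exists d : R, 0 < d /\ forall h, vn h < d ->
      cn (F (z + h) 0 i - F z 0 i - lin (p i) h) <= c * vn h.
    by move=> i; have [d d0 h] := hp i c c0; exists d.
  apply/nbhs_vn; exists (\big[Num.min/1]_i d i).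
    by apply/bigmin_gtP; split => // i _; have [] := hd i.
  move=> h; rewrite subr0 => hh; rewrite /= !mx_norm_vn -rcM le_rc.
  apply: vn_le => [|i]; first by rewrite mulr_ge0 ?vn_ge0// ltW.
  have di : \big[Num.min/1]_i d i <= d i by exact: bigmin_le.
  have [_ /(_ h (lt_le_trans hh di))] := hd i; apply: le_trans.
  rewrite le_eqVlt; apply/orP; left; apply/eqP; congr cn.
  rewrite /= !fctE /= [h + z]addrC !mxE /lin opprD addrA; congr (_ - _).
  by apply: eq_bigr => j _; rewrite !mxE.
have e := diff_unique (@continuous_mulmx A) dF.
by apply/diff_locallyP; rewrite e; split => //; exact: continuous_mulmx.
Qed.

(** The chain rule applied to the inverse. *)
Lemma jac_unit F G z : cancel F G -> differentiable F z -> differentiable G (F z) ->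
  'J F z \in unitmx.
Proof.
move=> FK dF dG; have e : G \o F = id by apply/funext.
have hid : 'd (G \o F) z = id :> (V -> V) by rewrite e; have [] := is_diff_id z.
have h v : 'd G (F z) ('d F z v) = v.
  transitivity ('d (G \o F) z v); last exact: (congr1 (@^~ v) hid).
  exact: (esym (congr1 (@^~ v) (diff_comp dF dG))).
have hJ : 'J F z *m 'J G (F z) = 1%:M.
  by apply/row_matrixP => i; rewrite row_mul rowE !mul_rV_lin1 h row1.
exact: (proj1 (mulmx1_unit hJ)).
Qed.

Lemma triangular_form A : exists P T, [/\ P \in unitmx, is_trig_mx T,
  P *m A *m invmx P = T & forall i, eigenvalue A (T i i)].
Proof.
suff [P [Pu Ptr]] : exists P, P \in unitmx /\ is_trig_mx (conjmx P A).
  exists P, (conjmx P A); split => //; first by rewrite conjumx.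
  move=> i; apply: (@eigenvalue_conjmx _ _ _ P); rewrite ?stablemx_unit ?row_free_unit//.
  rewrite [_ \in _]eigenvalue_root_char char_poly_trig//.
  by rewrite (bigD1 i)//= rootM root_XsubC eqxx.
have [k0|k0] := posnP k.
  exists 1%:M; rewrite unitmx1; split => //; apply/is_trig_mxP => i.
  by exfalso; case: i => m; rewrite k0.
have [P Pu PA] := @Schur _ k A k0; exists P; split; first exact: unitarymx_unit.
exact: PA.
Qed.

(** Conjugation with the diagonal matrix of the powers of t multiplies the
    entries below the diagonal by positive powers of t. *)
Lemma almost_diagonal A : exists lam : 'I_k -> C, (forall i, eigenvalue A (lam i)) /\
  forall e : R, 0 < e -> exists2 Q, Q \in unitmx &
    forall z, vn (z *m (Q *m A *m invmx Q) - diag lam z) <= e * vn z.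
Proof.
have [P [T [Pu Ttrig PT Teig]]] := triangular_form A.
exists (fun i => T i i); split => // e e0.
have o0 := opn_ge0 T.
have [t t0 ht] := @ex_small R [:: (1, 1); (opn T, e)] ltac:(by rewrite /= e0 ltr01).
have /and3P[/= t1 te _] := ht t (ltW t0) (lexx _).
rewrite mul1r in t1; have {ht}rt0 : rc t != 0 by rewrite -cn_eq0 cn_rc ?gt_eqF ?normr_gt0// gt_eqF.
pose D : 'M[C]_k := diag_mx (\row_i rc t ^+ i).
pose Di : 'M[C]_k := diag_mx (\row_i (rc t ^+ i)^-1).
have DDi : D *m Di = 1%:M.
  rewrite mulmx_diag -diag_const_mx; congr diag_mx; apply/rowP => i.
  by rewrite !mxE mulfV// expf_neq0.
have [Du _] := mulmx1_unit DDi.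
have Dinv : invmx D = Di by rewrite -[invmx D]mulmx1 -DDi mulKmx.
exists (D *m P); first by rewrite unitmx_mul Du.
have -> : D *m P *m A *m invmx (D *m P) = D *m T *m Di.
  rewrite -PT -Dinv; have -> : invmx (D *m P) = invmx P *m invmx D.
    have DPu : D *m P \in unitmx by rewrite unitmx_mul Du.
    by rewrite -[RHS](mulmxK DPu) (mulmxA _ D P) mulmxKV// mulVmx// mul1mx.
  by rewrite !mulmxA.
move=> z; pose S : 'M[C]_k := D *m T *m Di - diag_mx (\row_i T i i).
have -> : z *m (D *m T *m Di) - diag (fun i => T i i) z = z *m S.
  rewrite mulmxBr; congr (_ - _); apply/rowP => i.
  by rewrite mul_mx_diag !mxE mulrC.
apply: le_trans (vn_mulmx _ _) _; rewrite ler_wpM2r ?vn_ge0//.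
apply: le_trans te; rewrite mulrC /opn mulr_sumr; apply: ler_sum => i _.
rewrite mulr_sumr; apply: ler_sum => j _.
have -> : S i j = rc t ^+ i * T i j / rc t ^+ j - (if i == j then T i i else 0).
  by rewrite /S mul_diag_mx mul_mx_diag !mxE; case: eqP => //= <-; rewrite mulr1n.
have [ij|ji|/val_inj ->] := ltngtP i j.
- have /is_trig_mxP/(_ i j ij) -> := Ttrig.
  rewrite mulr0 mul0r (_ : (i == j) = false) ?subr0 ?cn0 ?mulr0//.
  by apply/eqP => E; rewrite E ltnn in ij.
- rewrite (_ : (i == j) = false) ?subr0; last by apply/eqP => E; rewrite E ltnn in ji.
  rewrite -(subnK ji) addnS -addSn exprD mulrAC mulfK ?expf_neq0//.
  rewrite cnM cnX cn_rc ger0_norm; last exact: ltW.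
  by rewrite ler_wpM2r ?cn_ge0// exprS ler_piMr ?(ltW t0)// exprn_ile1// ltW.
- rewrite eqxx mulrAC mulfV ?expf_neq0// mul1r subrr cn0.
  by rewrite mulr_ge0 ?cn_ge0// ltW.
Qed.

End Jacobian.

(** * Coordinates adapted to the fixed point *)

Section AdaptedCoordinates.
Context {R : realType} {k : nat}.
Local Notation C := (Cplx R).
Local Notation V := (Ck R k).
Implicit Types (F : V -> V) (z : V) (A : 'M[C]_k).

Lemma vn_le_enorm z : vn z <= enorm z.
Proof.
apply: vn_le => [|i]; first exact: sqrtr_ge0.
rewrite -[cn _]ger0_norm ?cn_ge0// -sqrtr_sqr ler_wsqrtr// (bigD1 i)//=.
by rewrite lerDl sumr_ge0// => j _; rewrite sqr_ge0.
Qed.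

Lemma enorm_le_vn z : enorm z <= (k%:R + 1) * vn z.
Proof.
have v0 := vn_ge0 z; have k0 : 0 <= k%:R :> R by [].
have h0 : 0 <= (k%:R + 1) * vn z by rewrite mulr_ge0//; lra.
rewrite -[leRHS]ger0_norm// -sqrtr_sqr ler_wsqrtr//.
apply: (@le_trans _ _ (\sum_(i < k) vn z ^+ 2)).
  by apply: ler_sum => i _; rewrite lerXn2r ?nnegrE ?cn_ge0//; exact: (cn_le_vn z i).
rewrite sumr_const card_ord -[leLHS]mulr_natl exprMn ler_wpM2r ?sqr_ge0//; nra.
Qed.

(** A triangular form with small entries below the diagonal takes care of the
    linear part of F, and a dilation of the remainder.  The radius 2 leaves room
    for unit polydiscs about the points of an orbit that stays near the origin. *)
Lemma adapted_coordinates F : holomorphic_automorphism F ->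
  attracting_fixed_point0 F ->
  exists lam : 'I_k -> C, (forall i, 0 < lev lam i < 1) /\
  forall e : R, 0 < e -> exists2 A, A \in unitmx &
    forall x, vn x <= 2 -> unit_ball (x *m A) /\
      vn (F (x *m A) *m invmx A - diag lam x) <= e * vn x.
Proof.
move=> [G [[_ dF] [_ dG] FK _]] [F0 eigF].
have Ju : 'J F 0 \in unitmx by apply: (jac_unit FK); [exact: dF|exact: dG].
have [lam [lam_eig hlam]] := almost_diagonal ('J F 0).
exists lam; split=> [i|e e0].
  rewrite cn_gt0 -lt_rc -normE rc1 eigF// andbT.
  apply/eqP => l0; have /eigenvalueP[v hv v0] := lam_eig i.
  by move/negP: v0; apply; rewrite -[v](mulmxK Ju) hv l0 scale0r mul0mx.
have [Q Qu hQ] := hlam (e / 2) ltac:(by rewrite divr_gt0).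
have q0 := opn_ge0 Q; have qi0 := opn_ge0 (invmx Q).
have qq0 : 0 <= opn Q * opn (invmx Q) by rewrite mulr_ge0.
pose e2 := e / 2 / (opn Q * opn (invmx Q) + 1).
have e20 : 0 < e2 by rewrite !divr_gt0//; lra.
have [d d0 hd] := differentiable_jac (dF 0 I) e20.
have [s s0 hs] := @ex_small R [:: (opn Q * 2, d / 2); ((k%:R + 1) * (opn Q * 2), 1 / 2)]
  ltac:(by rewrite /= !divr_gt0).
have {hs} /and3P[/= s1 s2 _] := hs s (ltW s0) (lexx _).
have rs0 : rc s != 0 by rewrite -cn_eq0 cn_rc normr_eq0 gt_eqF.
have cs : cn (rc s) = s by rewrite cn_rc ger0_norm ?ltW.
pose A := rc s *: Q.
have Au : A \in unitmx by rewrite unitmxZ// unitfE.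
have Ai : invmx A = (rc s)^-1 *: invmx Q by rewrite invmxZ.
have xA x : x *m A = rc s *: (x *m Q) by rewrite -scalemxAr.
have vA x : vn (x *m A) <= s * (opn Q * vn x).
  by rewrite xA vnZ cs ler_wpM2l ?vn_mulmx// ltW.
exists A => // x x2; have x0 := vn_ge0 x.
have vA2 : vn (x *m A) <= opn Q * 2 * s.
  by apply: le_trans (vA x) _; rewrite [s * _]mulrC ler_wpM2r ?(ltW s0)// ler_wpM2l.
split.
  rewrite /unit_ball /=; apply: le_lt_trans (enorm_le_vn _) _.
  apply: (@le_lt_trans _ _ ((k%:R + 1) * (opn Q * 2) * s)); last by lra.
  by rewrite -mulrA ler_wpM2l// addr_ge0.
have vAd : vn (x *m A) < d by lra.
have -> : F (x *m A) *m invmx A - diag lam x =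
    (F (0 + x *m A) - F 0 - x *m A *m 'J F 0) *m invmx A +
    (x *m (Q *m 'J F 0 *m invmx Q) - diag lam x).
  rewrite F0 subr0 add0r mulmxBl.
  have -> : x *m A *m 'J F 0 *m invmx A = x *m (Q *m 'J F 0 *m invmx Q).
    by rewrite Ai xA -scalemxAr -!scalemxAl scalerA mulVf// scale1r !mulmxA.
  by rewrite addrA subrK.
apply: le_trans (vnD _ _) _.
suff h : vn ((F (0 + x *m A) - F 0 - x *m A *m 'J F 0) *m invmx A) <= e / 2 * vn x.
  by apply: le_trans (lerD h (hQ x)) _; rewrite -mulrDl -splitr.
rewrite Ai -scalemxAr vnZ cnV cs; apply: le_trans (ler_wpM2l _ (vn_mulmx _ _)) _.
  by rewrite invr_ge0 ltW.
apply: (@le_trans _ _ (s^-1 * (opn (invmx Q) * (e2 * (s * (opn Q * vn x)))))).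
  rewrite ler_wpM2l ?invr_ge0 ?(ltW s0)// ler_wpM2l//.
  by apply: le_trans (hd _ vAd) _; rewrite ler_wpM2l ?vA// (ltW e20).
have -> : s^-1 * (opn (invmx Q) * (e2 * (s * (opn Q * vn x)))) =
    e2 * (opn Q * opn (invmx Q)) * vn x.
  by field; rewrite gt_eqF.
rewrite ler_wpM2r// /e2 mulrAC ler_pdivrMr; last by lra.
by rewrite ler_wpM2l// ?divr_ge0 ?ltW//; lra.
Qed.

End AdaptedCoordinates.

(** * Sequences that move the origin *)

Section PerturbedBasin.
Context {R : realType} {k : nat}.
Local Notation C := (Cplx R).
Local Notation V := (Ck R k).
Implicit Types (z u x y : V) (i j : 'I_k).

Definition pbasin (phi : nat -> V -> V) : set V :=
  [set x | exists n, vn (comp_upto phi n.+1 x) < 1 / 16].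

(** The orbit of the origin stays close to it.  The maps that express the
    dynamics relative to this orbit fix the origin and are still close to the
    diagonal map, and the two basins coincide. *)
Theorem perturbed_basin (lam : 'I_k -> C) : (forall i, 0 < lev lam i < 1) ->
  exists e s r : R, [/\ 0 < e, 0 < s, r < 1 / 16 &
  forall phi psi : nat -> V -> V,
    (forall n, cancel (phi n) (psi n)) -> (forall n, cancel (psi n) (phi n)) ->
    (forall n z, vdiff (phi n) z) -> (forall n z, vdiff (psi n) z) ->
    (forall n x, vn x <= 2 -> vn (phi n x - diag lam x) <= e * vn x + s) ->
  [/\ forall n x, vn x < 1 / 16 -> vn (phi n x) <= r,
      forall x, pbasin phi x -> forall c : R, 0 < c -> exists n0, forall n,
        (n0 <= n)%N -> vn (comp_upto phi n x - comp_upto phi n 0) < c &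
      exists H G : V -> V,
        [/\ forall z, pbasin phi z -> vdiff H z, forall y, vdiff G y,
            forall y, pbasin phi (G y), forall z, pbasin phi z -> G (H z) = z &
            forall y, H (G y) = y]]].
Proof.
move=> hlam.
pose al : R := \big[Num.max/0]_i lev lam i.
have al0 : 0 <= al by exact: bigmax_ge_id.
have al1 : al < 1 by apply/bigmax_ltP; split => // i _; have /andP[] := hlam i.
have lev_al i : lev lam i <= al by exact: (le_bigmax _ (fun i => lev lam i)).
have [eta [a [eta0 a0 a1 main]]] := normalized_basin hlam.
have [e e0 he] := @ex_small R [:: (3, eta / 2); (1, (1 - al) / 2)]
  ltac:(by rewrite /= !divr_gt0// subr_gt0).
have {he} /and3P[/= e1 e2 _] := he e (ltW e0) (lexx _).
have [s s0 hs] := @ex_small R [:: (2, eta / 2); (32, (1 - al) / 2)]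
  ltac:(by rewrite /= !divr_gt0// subr_gt0).
have {hs} /and3P[/= s1 s2 _] := hs s (ltW s0) (lexx _).
rewrite mul1r in e2.
exists e, s, ((al + e) / 16 + s); split => //; first by lra.
move=> phi psi phiK psiK phid psid phiD.
have vD x : vn (diag lam x) <= al * vn x.
  exact: vn_diag.
have phi_le n x : vn x <= 2 -> vn (phi n x) <= (al + e) * vn x + s.
  move=> hx; rewrite -[phi n x](subrK (diag lam x)).
  by apply: le_trans (vnD _ _) _; have := phiD n x hx; have := vD x; lra.
pose o n := comp_upto phi n 0.
have ho n : vn (o n) <= 1 / 32.
  elim: n => [|n IH]; first by rewrite /o /= vn0; lra.
  by apply: le_trans (phi_le _ _ _) _; have := vn_ge0 (o n); nra.
pose f n y := phi n (o n + y) - o n.+1; pose fi n w := psi n (w + o n.+1) - o n.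
have fE n y : comp_upto f n y = comp_upto phi n y - o n.
  elim: n => [|n IH]; first by rewrite /o subr0.
  by rewrite [LHS]/= IH /f (addrC (o n)) subrK.
have f0 n : f n 0 = 0 by rewrite /f addr0 subrr.
have fD n y : vn y < 1 -> vn (f n y - diag lam y) <= eta.
  move=> hy; have -> : f n y - diag lam y =
      (phi n (o n + y) - diag lam (o n + y)) - (phi n (o n) - diag lam (o n)).
    have -> : diag lam (o n + y) = diag lam (o n) + diag lam y.
      by apply/rowP => i; rewrite !mxE mulrDr.
    rewrite /f /o /= -/(o n).
    by rewrite !opprD !opprK !addrA; apply/rowP => i; rewrite !mxE; ring.
  have v0 := vn_ge0 y; have v1 := vn_ge0 (o n); have h1 := ho n.
  have v2 := vnD (o n) y; have v3 := vn_ge0 (o n + y).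
  apply: le_trans (vnB _ _) _.
  have := phiD n (o n + y) ltac:(lra); have := phiD n (o n) ltac:(lra).
  nra.
have [||||||fa [H [G [Hd Gd GB GH HG]]]] := main f fi.
- by move=> n y; rewrite /f /fi subrK phiK addrC addKr.
- by move=> n y; rewrite /f /fi (addrC (o n)) subrK psiK addrK.
- move=> n z; apply: vdiffB; last by move=> i; exact: sdiff_cst.
  apply: (@vdiff_comp _ _ (phi n)); first exact: phid.
  by apply: vdiffD; [move=> i; exact: sdiff_cst|exact: vdiff_id].
- move=> n z; apply: vdiffB; last by move=> i; exact: sdiff_cst.
  apply: (@vdiff_comp _ _ (psi n)); first exact: psid.
  by apply: vdiffD; [exact: vdiff_id|move=> i; exact: sdiff_cst].
- exact: f0.
- exact: fD.
have shrink n z (c : R) : vn (comp_upto f n z) < 1 / 8 -> 0 < c ->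
    exists n0, forall m, (n0 <= m)%N -> vn (comp_upto f m z) < c.
  move=> hz c0; have [n0 hn0] := expr_small a0 a1 c0.
  exists (n + n0)%N => m hm; rewrite -(subnKC (leq_trans (leq_addr n0 n) hm)).
  have z1 : vn (comp_upto f n z) < 1 by lra.
  apply: le_lt_trans (orbit_decay _ a0 a1 fa z1) _.
  have := hn0 (m - n)%N; rewrite leq_subRL ?(leq_trans (leq_addr n0 n) hm)//.
  move=> /(_ hm); apply: le_lt_trans; rewrite ler_piMr ?exprn_ge0// ltW//.
have basinE z : pbasin phi z <-> nbasin f z.
  split=> [[n hn]|[n hn]].
    exists n.+1; rewrite fE; apply: le_lt_trans (vnB _ _) _.
    by have := ho n.+1; lra.
  have [n0 hn0] := shrink n z (1 / 32) hn ltac:(lra).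
  exists n0; have := hn0 n0.+1 (leqnSn _); rewrite fE => h.
  rewrite -(subrK (o n0.+1) (comp_upto phi _ _)); apply: le_lt_trans (vnD _ _) _.
  by have := ho n0.+1; lra.
split.
- move=> n x hx; have x0 := vn_ge0 x.
  by apply: le_trans (phi_le _ _ _) _; nra.
- move=> x /basinE[n hn] c c0; have [n0 hn0] := shrink n x c hn c0.
  by exists n0 => m /hn0; rewrite fE.
- exists H, G; split => // [z /basinE|y|z /basinE]; first exact: Hd.
    exact/basinE.
  exact: GH.
Qed.

End PerturbedBasin.

(** * Compact sets of vectors *)

Section Compactness.
Context {R : realType} {k : nat}.
Local Notation C := (Cplx R).
Local Notation V := (Ck R k).
Implicit Types (z u x y : V) (K U : set V).

Lemma bounded_closed_compact_vn K (M : R) : closed K -> (forall z, K z -> vn z <= M) ->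
  compact K.
Proof.
move=> Kcl KM; pose c (p : R * R) : C := complex.Complex p.1 p.2.
pose B : set C := c @` (`[-M, M] `*` `[-M, M]).
have cont : continuous c.
  move=> p; apply/cvgrPdist_lt => _ /pos_rc[e e0 ->].
  have e2 : 0 < e / 2 by rewrite divr_gt0.
  exists (ball p.1 (e / 2), ball p.2 (e / 2)); first by split; exact: nbhsx_ballx.
  move=> q [/=]; rewrite -!ball_normE /= normE lt_rc => h1 h2.
  apply: le_lt_trans (cn_le_ReIm _) _; move: h1 h2.
  by rewrite /c; case: (p) (q) => [p1 p2] [q1 q2] /=; lra.
have Bco : compact B.
  apply: continuous_compact; first exact: continuous_subspaceT.
  by apply: compact_setX; exact: segment_compact.
apply: subclosed_compact Kcl (rV_compact (fun=> Bco)) _ => z /KM hz i /=.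
have h : cn (z ord0 i) <= M by exact: le_trans (cn_le_vn z i) hz.
exists (complex.Re (z ord0 i), complex.Im (z ord0 i)); last by rewrite /c /=; case: (z _ _).
rewrite /= !in_itv /= -!ler_norml.
by rewrite (le_trans (cn_Re _) h) (le_trans (cn_Im _) h).
Qed.

Lemma relatively_compactP U K (B : set V) (M : R) : closed K ->
  (forall z, K z -> vn z <= M) -> B `<=` K -> K `<=` U -> relatively_compact_in B U.
Proof.
move=> Kcl KM BK KU; have Kco := bounded_closed_compact_vn Kcl KM; split.
  by apply: (precompact_subset BK); rewrite precompact_closed.
by apply: subset_trans KU; rewrite [X in _ `<=` X](closure_id K).1//; exact: closure_subset.
Qed.

(** The existence of a Lebesgue number. *)
Lemma compact_inside K U : compact K -> open U -> K `<=` U ->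
  exists2 r : R, 0 < r & forall z u, K z -> vn (u - z) < r -> U u.
Proof.
move=> /compact_near_coveringP Kco /open_vn Uop KU.
have H : \forall r \near (0 : R)^'+, K `<=` [set z | forall u, vn (u - z) < r -> U u].
  apply: Kco => z /KU/Uop[d d0 hd]; have d2 : 0 < d / 2 by rewrite divr_gt0.
  exists ([set x | vn (x - z) < d / 2], [set r | r < d / 2]) => /=.
    split; first by apply/nbhs_vn; exists (d / 2).
    exact: nbhs_right_lt.
  move=> [x r] /= [hx hr] u hu; apply: hd; apply: le_lt_trans (vn_dist_add x _ _) _; lra.
have [r [hr r0]] : exists r, K `<=` [set z | forall u, vn (u - z) < r -> U u] /\ 0 < r.
  apply: (@filter_ex _ ((0 : R)^'+)); apply: filterI H _; exact: nbhs_right_gt.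
by exists r => // z u /hr; exact.
Qed.

End Compactness.

(** * The basin of a perturbed sequence *)

Theorem mainTheorem1 (R : realType) (k : nat) (F : Ck R k -> Ck R k) :
  holomorphic_automorphism F ->
  attracting_fixed_point0 F ->
  exists eps : R, 0 < eps /\
  exists N : set (Ck R k), [/\ open N, N 0, N `<=` unit_ball &
    forall f : nat -> Ck R k -> Ck R k,
      (forall n, holomorphic_automorphism (f n)) ->
      (forall n z, unit_ball z -> enorm (F z - f n z) < eps) ->
      [/\ forall n, relatively_compact_in (f n @` N) N,
          biholomorphic (basin f N) setT,
          (* the basin is the same for every smaller admissible neighborhood *)
          forall N' : set (Ck R k), open N' -> N' 0 -> N' `<=` N ->
            relatively_compact_in (\bigcup_n (f n @` N')) N' ->
            basin f N' = basin f N
        & (forall n, f n 0 = 0) ->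
            basin f N = [set z | comp_upto f n z @[n --> \oo] --> (0 : Ck R k)]]].
Proof.
move=> hF attF; have [lam [hlam coord]] := adapted_coordinates hF attF.
have [e [s [r [e0 s0 r16 main]]]] := perturbed_basin hlam.
have [A Au hA] := coord e e0; set Ai := invmx A in hA.
have AK (z : Ck R k) : z *m A *m Ai = z by exact: mulmxK.
have AiK (z : Ck R k) : z *m Ai *m A = z by exact: mulmxKV.
have oA := opn_ge0 A; have oAi := opn_ge0 Ai.
exists (s / (opn Ai + 1)); split; first by rewrite divr_gt0//; lra.
(* N is a small polydisc in the adapted coordinates. *)
pose N : set (Ck R k) := [set z | vn (z *m Ai) < 1 / 16].
have Nop : open N.
  apply/open_vn => z Nz; exact: (vdiff_small (vdiff_mulmx Ai z) Nz).
exists N; split => //.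
- by rewrite /N /= mul0mx vn0; lra.
- move=> z Nz; rewrite -(AiK z); apply: (hA _ _).1; move: Nz; rewrite /N /=; lra.
move=> f /choice[fi hf] fF.
have fd n z : vdiff (f n) z by have [[_ h] _ _ _] := hf n; exact: differentiable_vdiff (h z I).
have fid n z : vdiff (fi n) z by have [_ [_ h] _ _] := hf n; exact: differentiable_vdiff (h z I).
have fK n : cancel (f n) (fi n) by have [] := hf n.
have fiK n : cancel (fi n) (f n) by have [] := hf n.
pose phi n (x : Ck R k) := f n (x *m A) *m Ai.
pose psi n (x : Ck R k) := fi n (x *m A) *m Ai.
have conjd (g : Ck R k -> Ck R k) x : (forall z, vdiff g z) ->
    vdiff (fun x => g (x *m A) *m Ai) x.
  move=> gd; apply: (@vdiff_comp _ _ (mulmxr Ai) (fun x => g (x *m A))).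
    exact: vdiff_mulmx.
  by apply: (@vdiff_comp _ _ g); [exact: gd|exact: vdiff_mulmx].
have phiE n z : comp_upto f n z *m Ai = comp_upto phi n (z *m Ai).
  by elim: n => [//|n IH] /=; rewrite -IH /phi AiK.
have [|||||inv conv [H [G [Hd Gd GB GH HG]]]] := main phi psi.
- by move=> n x; rewrite /phi /psi AiK fK AK.
- by move=> n x; rewrite /phi /psi AiK fiK AK.
- by move=> n x; exact: conjd.
- by move=> n x; exact: conjd.
- move=> n x x2; have [ub close] := hA x x2.
  have -> : phi n x - diag lam x =
      (F (x *m A) *m Ai - diag lam x) - (F (x *m A) - f n (x *m A)) *m Ai.
    by rewrite mulmxBl opprB [RHS]addrC addrA subrK.
  apply: le_trans (vnB _ _) _; rewrite lerD//.
  apply: le_trans (vn_mulmx _ _) _.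
  have := le_lt_trans (vn_le_enorm _) (fF n _ ub); rewrite ltr_pdivlMr; last by lra.
  have := vn_ge0 (F (x *m A) - f n (x *m A)); nra.
have basinE z : basin f N z <-> pbasin phi (z *m Ai).
  split=> [[n _]|[n]]; rewrite /N /preimage /=.
    by rewrite -[f n _ *m Ai]/(comp_upto f n.+1 z *m Ai) phiE => h; exists n.
  by rewrite -[phi n _]/(comp_upto phi n.+1 (z *m Ai)) -phiE => h; exists n.
pose K : set (Ck R k) := [set z | vn (z *m Ai) <= r].
have Kcl : closed K.
  have -> : K = ~` [set z | r < vn (z *m Ai)].
    by apply/seteqP; split => z; rewrite /K /= leNgt => /negP.
  apply: open_closedC; apply/open_vn => z /= hz.
  have c0 : 0 < vn (z *m Ai) - r by rewrite subr_gt0.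
  have [d d0 hd] := vdiff_cont (vdiff_mulmx Ai z) c0; exists d => // u hu.
  have := hd u hu.
  have := vnD (u *m Ai) (z *m Ai - u *m Ai); rewrite subrKC (vn_distC (z *m Ai)); lra.
have Kbd z : K z -> vn z <= opn A * r.
  move=> hz; rewrite -(AiK z); apply: le_trans (vn_mulmx _ _) _.
  by rewrite ler_wpM2l.
have KN : K `<=` N by move=> z; rewrite /K /N /=; lra.
have fNK n : f n @` N `<=` K.
  move=> _ [z Nz <-]; have := inv n _ Nz; by rewrite /phi AiK.
have conv0 z (c : R) : basin f N z -> 0 < c -> exists n0, forall n, (n0 <= n)%N ->
    vn (comp_upto f n z - comp_upto f n 0) < c.
  move=> /basinE hz c0; have c1 : 0 < c / (opn A + 1) by rewrite divr_gt0//; lra.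
  have [n0 hn0] := conv _ hz _ c1; exists n0 => n /hn0.
  have -> : comp_upto phi n 0 = comp_upto f n 0 *m Ai by rewrite phiE mul0mx.
  rewrite -phiE -mulmxBl => h; rewrite -(AiK (_ - _)).
  apply: le_lt_trans (vn_mulmx _ _) _; move: h; rewrite ltr_pdivlMr; last by lra.
  have := vn_ge0 ((comp_upto f n z - comp_upto f n 0) *m Ai); nra.
split.
- by move=> n; exact: (relatively_compactP Kcl Kbd (fNK n) KN).
- exists (fun z => H (z *m Ai)), (fun y => G y *m A); split.
  + split=> [|z /basinE hz]; last first.
      apply: vdiff_differentiable; apply: (@vdiff_comp _ _ H); first exact: Hd.
      exact: vdiff_mulmx.
    apply/open_vn => z [n _ hz].
    have dz : vdiff (fun u => comp_upto f n.+1 u *m Ai) z.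
      apply: (@vdiff_comp _ _ (mulmxr Ai) (comp_upto f n.+1)); first exact: vdiff_mulmx.
      exact: vdiff_comp_upto.
    have [d d0 hd] := vdiff_small dz hz.
    by exists d => // u /hd h; exists n.
  + split=> [|y _]; first exact: openT.
    apply: vdiff_differentiable; apply: (@vdiff_comp _ _ (mulmxr A) G); last exact: Gd.
    exact: vdiff_mulmx.
  + by [].
  + by move=> y _; apply/basinE; rewrite AK; exact: GB.
  + by split=> [z|y _]; rewrite ?AK// inE => /basinE hz; rewrite GH.
(* The orbit of the origin stays in the closure of the images of N', at a positive
   distance from the complement of N'; the orbits in the basin approach it. *)
- move=> N' N'op N'0 N'N [N'co N'cl]; apply/seteqP; split => z.
    by move=> [n _ hn]; exists n => //; exact: N'N.
  move: N'co; rewrite precompactE => N'co hz.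
  have [d d0 hd] := compact_inside N'co N'op N'cl.
  have orb n : N' (comp_upto f n 0).
    elim: n => [//|n IH]; apply: N'cl; apply: subset_closure; exists n => //.
    by exists (comp_upto f n 0).
  have [n0 hn0] := conv0 z d hz d0; exists n0 => //.
  apply: (hd (comp_upto f n0.+1 0)); last exact: hn0.
  by apply: subset_closure; exists n0 => //; exists (comp_upto f n0 0).
- move=> f0; have o n : comp_upto f n (0 : Ck R k) = 0 by elim: n => //= n ->.
  apply/seteqP; split => z.
    move=> hz U /nbhs_vn[d d0 hd]; have [n0 hn0] := conv0 z d hz d0.
    by exists n0 => // n /= /hn0; rewrite o; exact: hd.
  move=> /(_ N) []; first by apply: open_nbhs_nbhs; split => //; rewrite /N /= mul0mx vn0; lra.
  by move=> n0 _ hn0; exists n0 => //; exact: (hn0 n0.+1 (leqnSn _)).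
Qed.
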